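(* Let $A$ be a simple separable C*-algebra and let $\alpha$ be an action of a finite group $G$ on $A$ with the weak tracial Rokhlin property. If $A'\cap A_{\omega}$ has real rank zero for some free ultrafilter $\omega$ on $\mathbb{N}$, then $\alpha$ has the tracial Rokhlin property.
   Context: For a free ultrafilter $\omega$ on $\mathbb{N}$, let $c_{\omega}(A)=\{(a_n)_n\in\ell^{\infty}(A):\lim_{n\in\omega}\|a_n\|=0\}$ and $A_{\omega}=\ell^{\infty}(A)/c_{\omega}(A)$. $A$ is regarded as a subalgebra of $A_{\omega}$ via (classes of) constant sequences, and $A'\cap A_{\omega}$ is the set of elements of $A_{\omega}$ commuting with every element of $A$. A C*-algebra $B$ has real rank zero if the invertible self-adjoint elements are dense in the self-adjoint part of $B^{\sim}$, where $B^{\sim}=B$ if $B$ is unital and $B^{\sim}$ is the unitization of $B$ otherwise. For positive elements $a,b\in A$, write $a\precsim_A b$ (Cuntz subequivalence) if there is a sequence $(v_n)$ in $A$ with $\|a-v_nbv_n^*\|\to 0$. For a self-adjoint element $c$ and $\varepsilon>0$, $(c-\varepsilon)_+$ is obtained by functional calculus with $t\mapsto\max(t-\varepsilon,0)$. An action $\alpha\colon G\to\mathrm{Aut}(A)$ of a finite group $G$ on a simple (not necessarily unital) C*-algebra $A$ has the tracial Rokhlin property if for every finite subset $F\subseteq A$, every $\varepsilon>0$, and all positive elements $x,y\in A$ with $\|x\|=1$, there exists a family of mutually orthogonal projections $(p_g)_{g\in G}$ in $A$ such that, with $p=\sum_{g\in G}p_g$: (i) $\|p_ga-ap_g\|<\varepsilon$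 for all $a\in F$ and $g\in G$; (ii) $\|\alpha_g(p_h)-p_{gh}\|<\varepsilon$ for all $g,h\in G$; (iii) $(y^2-ypy-\varepsilon)_+\precsim_A x$; (iv) $\|pxp\|>1-\varepsilon$. The action $\alpha$ has the weak tracial Rokhlin property if the same condition holds with the mutually orthogonal projections $(p_g)_{g\in G}$ replaced by mutually orthogonal positive contractions $(p_g)_{g\in G}$ in $A$. *)

(* Defs.v *)
From HB Require Import structures.
From mathcomp Require Import all_boot all_order all_algebra all_fingroup.
From mathcomp Require Import generic_quotient ring_quotient.
From mathcomp Require Import all_classical all_reals topology normedtype.
From mathcomp Require Import complex ring lra.
Set Implicit Arguments.
Unset Strict Implicit.
Unset Printing Implicit Defensive.
Import Order.TTheory GRing.Theory Num.Theory.
Import numFieldNormedType.Exports.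
Local Open Scope classical_set_scope.
Local Open Scope ring_scope.
Local Open Scope complex_scope.

Declare Scope cstar_scope.
Delimit Scope cstar_scope with cstar.
Local Open Scope cstar_scope.

Reserved Notation "a ** b" (at level 40, left associativity).

(* C*-algebras over R[i], not necessarily unital.  The library norm `|a| of a
   normedModType R[i] takes its values in R[i]; cnorm below is the same norm
   read in R. *)
HB.mixin Record isCStarAlgebra (R : realType) A
    & CompleteNormedModule R[i] A := {
  cmul : A -> A -> A;
  star : A -> A;
  cmulA : associative cmul;
  cmulDl : left_distributive cmul +%R;
  cmulDr : right_distributive cmul +%R;
  cscalerAl : forall (k : R[i]) a b, k *: cmul a b = cmul (k *: a) b;
  cscalerAr : forall (k : R[i]) a b, k *: cmul a b = cmul a (k *: b);
  starK : involutive star;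
  starD : {morph star : a b / a + b};
  starZ : forall (k : R[i]) a, star (k *: a) = conjc k *: star a;
  starM : forall a b, star (cmul a b) = cmul (star b) (star a);
  normcM_le : forall a b, `|cmul a b| <= `|a| * `|b|;
  normc_star : forall a, `|cmul (star a) a| = `|a| ^+ 2
}.

#[short(type="cstarAlgType")]
HB.structure Definition CStarAlgebra (R : realType) :=
  {A of CompleteNormedModule R[i] A & isCStarAlgebra R A}.

Notation "a ** b" := (cmul a b) : cstar_scope.

Definition cnorm {R : realType} {V : normedModType R[i]} (a : V) : R :=
  complex.Re `|a|.


Section CStarTheory.
Context {R : realType} (A : cstarAlgType R).
Implicit Types (a b : A) (k : R[i]).

Lemma cnormE (V : normedModType R[i]) (v : V) : `|v| = (cnorm v)%:C.
Proof. by rewrite /cnorm RRe_real// normr_real. Qed.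

Lemma cnorm_ge0 (V : normedModType R[i]) (v : V) : 0 <= cnorm v.
Proof. by rewrite -ler0c -cnormE. Qed.

Lemma cnorm0 (V : normedModType R[i]) : cnorm (0 : V) = 0.
Proof. by rewrite /cnorm normr0. Qed.

Lemma cnorm0_eq0 (V : normedModType R[i]) (v : V) : cnorm v = 0 -> v = 0.
Proof. by move=> v0; apply/normr0_eq0; rewrite cnormE v0. Qed.

Lemma cnormN (V : normedModType R[i]) (v : V) : cnorm (- v) = cnorm v.
Proof. by rewrite /cnorm normrN. Qed.

Lemma cnormB (V : normedModType R[i]) (u v : V) : cnorm (u - v) = cnorm (v - u).
Proof. by rewrite -cnormN opprB. Qed.

Lemma cnormD (V : normedModType R[i]) (u v : V) :
  cnorm (u + v) <= cnorm u + cnorm v.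
Proof. by rewrite -lecR rmorphD/= -!cnormE ler_normD. Qed.

Lemma cnormZ (V : normedModType R[i]) k (v : V) :
  cnorm (k *: v) = complex.Re `|k| * cnorm v.
Proof. by apply: complexI; rewrite rmorphM/= -!cnormE normrZ. Qed.

Lemma cmul0l b : 0 ** b = 0.
Proof. by rewrite -[in LHS](scale0r (0 : A)) -cscalerAl scale0r. Qed.

Lemma cmul0r a : a ** 0 = 0.
Proof. by rewrite -[in LHS](scale0r (0 : A)) -cscalerAr scale0r. Qed.

Lemma cmulNl a b : (- a) ** b = - (a ** b).
Proof. by rewrite -scaleN1r -cscalerAl scaleN1r. Qed.

Lemma cmulNr a b : a ** (- b) = - (a ** b).
Proof. by rewrite -[- b]scaleN1r -cscalerAr scaleN1r. Qed.

Lemma star0 : star (0 : A) = 0.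
Proof. by rewrite -[in LHS](scale0r (0 : A)) starZ conjc0 scale0r. Qed.

Lemma starN a : star (- a) = - star a.
Proof. by rewrite -scaleN1r starZ rmorphN rmorph1 scaleN1r. Qed.

Lemma cnormM a b : cnorm (a ** b) <= cnorm a * cnorm b.
Proof. by rewrite -lecR rmorphM/= -!cnormE normcM_le. Qed.

Lemma cnorm_starM a : cnorm (star a ** a) = cnorm a ^+ 2.
Proof. by apply: complexI; rewrite rmorphXn/= -!cnormE normc_star. Qed.

Lemma cnorm_star a : cnorm (star a) = cnorm a.
Proof.
have le b : cnorm b <= cnorm (star b).
  have [->|b0] := eqVneq (cnorm b) 0; first exact: cnorm_ge0.
  have b_gt0 : 0 < cnorm b by rewrite lt_neqAle eq_sym b0 cnorm_ge0.
  by rewrite -(ler_pM2r b_gt0) -expr2 -cnorm_starM cnormM.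
by apply/eqP; rewrite eq_le le -{2}[a]starK le.
Qed.

End CStarTheory.

(* The unitization A (+) C of A, formed whether or not A has a unit. *)
Record unitization (R : realType) (A : cstarAlgType R) :=
  Unitization { upart : A; uscal : R[i] }.
Arguments Unitization {R A}.

Section UnitizationAlgebra.
Context {R : realType} (A : cstarAlgType R).
Local Notation U := (unitization A).
Implicit Types x y z : U.

Definition pair_of_unitization x := (upart x, uscal x).
Definition unitization_of_pair (p : A * R[i]) : U := Unitization p.1 p.2.
Lemma pair_of_unitizationK : cancel pair_of_unitization unitization_of_pair.
Proof. by case. Qed.
HB.instance Definition _ := Choice.copy U (can_type pair_of_unitizationK).

Definition addu x y : U :=
  Unitization (upart x + upart y) (uscal x + uscal y).
Definition oppu x : U := Unitization (- upart x) (- uscal x).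
Lemma adduA : associative addu.
Proof. by move=> x y z; congr Unitization; rewrite /= addrA. Qed.
Lemma adduC : commutative addu.
Proof. by move=> x y; rewrite /addu addrC [uscal x + _]addrC. Qed.
Lemma add0u : left_id (Unitization 0 0) addu.
Proof. by case=> a k; rewrite /addu/= !add0r. Qed.
Lemma addNu : left_inverse (Unitization 0 0) oppu addu.
Proof. by case=> a k; rewrite /addu/= !addNr. Qed.
HB.instance Definition _ := GRing.isZmodule.Build U adduA adduC add0u addNu.

Definition mulu x y : U :=
  Unitization (upart x ** upart y + (uscal x *: upart y + uscal y *: upart x))
    (uscal x * uscal y).
Lemma muluA : associative mulu.
Proof.
case=> [a k] [b l] [c m]; rewrite /mulu/= mulrA; congr Unitization.
rewrite !cmulDl !cmulDr !scalerDr -!cscalerAl -!cscalerAr !scalerA cmulA.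
rewrite -!addrA; congr (_ + _).
rewrite [m * k]mulrC [m * l]mulrC [RHS]addrCA; congr (_ + _).
by rewrite [LHS]addrCA; congr (_ + _); rewrite [LHS]addrCA.
Qed.
Lemma mul1u : left_id (Unitization 0 1) mulu.
Proof.
by case=> a k; rewrite /mulu/= cmul0l scale1r scaler0 add0r addr0 mul1r.
Qed.
Lemma mulu1 : right_id (Unitization 0 1) mulu.
Proof.
by case=> a k; rewrite /mulu/= cmul0r scale1r scaler0 !add0r mulr1.
Qed.
Lemma muluDl : left_distributive mulu addu.
Proof.
case=> [a k] [b l] [c m]; rewrite /mulu /addu/= mulrDl; congr Unitization.
rewrite cmulDl scalerDl scalerDr [RHS]addrACA; congr (_ + _).
by rewrite [RHS]addrACA.
Qed.
Lemma muluDr : right_distributive mulu addu.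
Proof.
case=> [a k] [b l] [c m]; rewrite /mulu /addu/= mulrDr; congr Unitization.
rewrite cmulDr scalerDl scalerDr [RHS]addrACA; congr (_ + _).
by rewrite [RHS]addrACA.
Qed.
Lemma oneu_neq0 : Unitization 0 1 != (0 : U).
Proof. by apply/eqP => -[]/eqP; rewrite oner_eq0. Qed.
HB.instance Definition _ := GRing.Zmodule_isNzRing.Build U
  muluA mul1u mulu1 muluDl muluDr oneu_neq0.

Definition scaleu (k : R[i]) x : U := Unitization (k *: upart x) (k * uscal x).
Lemma scaleuA k l x : scaleu k (scaleu l x) = scaleu (k * l) x.
Proof. by rewrite /scaleu/= scalerA mulrA. Qed.
Lemma scale1u : left_id 1 scaleu.
Proof. by case=> a k; rewrite /scaleu/= scale1r mul1r. Qed.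
Lemma scaleuDr : right_distributive scaleu +%R.
Proof. by move=> k x y; congr Unitization; rewrite /= (scalerDr, mulrDr). Qed.
Lemma scaleuDl x : {morph scaleu^~ x : k l / k + l}.
Proof. by move=> k l; congr Unitization; rewrite /= (scalerDl, mulrDl). Qed.
HB.instance Definition _ := GRing.Zmodule_isLmodule.Build R[i] U
  scaleuA scale1u scaleuDr scaleuDl.

Lemma scaleuAl (k : R[i]) x y : k *: (x * y) = (k *: x) * y.
Proof.
case: x y => [a l] [b m]; congr Unitization => /=; last by rewrite mulrA.
by rewrite !scalerDr cscalerAl !scalerA [k * m]mulrC.
Qed.
HB.instance Definition _ := GRing.Lmodule_isLalgebra.Build R[i] U scaleuAl.
Lemma scaleuAr (k : R[i]) x y : k *: (x * y) = x * (k *: y).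
Proof.
case: x y => [a l] [b m]; congr Unitization => /=; last by rewrite mulrCA.
by rewrite !scalerDr cscalerAr !scalerA [k * l]mulrC.
Qed.
HB.instance Definition _ := GRing.Lalgebra_isAlgebra.Build R[i] U scaleuAr.

Definition staru x : U := Unitization (star (upart x)) (conjc (uscal x)).

(* For non-unital A this is the unique C*-norm of A (+) C: the operator norm of
   z acting on A by left multiplication. *)
Definition unorm (z : U) : R :=
  sup [set cnorm (upart z ** x + uscal z *: x) | x in [set x | cnorm x <= 1]].

Definition inu (a : A) : U := Unitization a 0.

End UnitizationAlgebra.

Definition is_invertible (S : nzRingType) (x : S) :=
  exists y, y * x = 1 /\ x * y = 1.

Section Elements.
Context {R : realType} {A : cstarAlgType R}.
Implicit Types a b c d : A.

Definition selfadjoint a := star a = a.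

Definition is_projection a := selfadjoint a /\ a ** a = a.

(* Computed in A (+) C, hence always containing 0; for unital A this is the
   spectrum relative to the unit of A with 0 adjoined, which affects neither
   positivity nor the calculus for functions vanishing at 0. *)
Definition spectrum a : set R[i] :=
  [set z | ~ is_invertible (inu a - z%:A)].

Definition is_positive a := selfadjoint a /\ (forall z, spectrum a z -> 0 <= z).

Definition contractive a := cnorm a <= 1.

(* p(a) for p in R[t] with p(0) = 0. *)
Definition polyval (p : {poly R}) a : A :=
  upart (horner_alg (inu a) (map_poly (real_complex R) p)).

(* d = f(a), for a self-adjoint and f continuous on the spectrum of a with
   f 0 = 0: p(a) tends to d as the polynomials p without constant term tend to
   f uniformly on the spectrum. *)
Definition is_fcalc (f : R -> R) a d :=
  forall eps : R, 0 < eps -> exists2 delta : R, 0 < delta &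
    forall p : {poly R}, p.[0] = 0 ->
      (forall t : R, spectrum a t%:C -> `|p.[t] - f t| < delta) ->
      cnorm (polyval p a - d) < eps.

Definition fcalc (f : R -> R) a : A := xget 0 [set d | is_fcalc f a d].

Definition cutdown (eps : R) a : A := fcalc (fun t => Num.max (t - eps) 0) a.

Definition cuntz_sub a b :=
  exists v : nat -> A,
    cnorm (a - v n ** b ** star (v n)) @[n --> \oo] --> (0 : R).

End Elements.

Definition simple_cstar (R : realType) (A : cstarAlgType R) :=
  forall I : set A, I 0 -> (forall a b, I a -> I b -> I (a + b)) ->
    (forall (k : R[i]) a, I a -> I (k *: a)) ->
    (forall a b, I b -> I (a ** b) /\ I (b ** a)) -> closed I ->
  I = [set 0] \/ I = setT.

Definition separable_space (T : topologicalType) :=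
  exists D : set T, countable D /\ dense D.

Section RealRankZero.
Context {R : realType}.

Definition is_unit (B : cstarAlgType R) (e : B) :=
  forall x, e ** x = x /\ x ** e = x.

Definition unital (B : cstarAlgType R) := exists e : B, is_unit e.

(* B~ is B itself when B is unital and B (+) C otherwise. *)
Definition real_rank_zero (B : cstarAlgType R) :=
  (forall e : B, is_unit e ->
    forall (x : B) (eps : R), selfadjoint x -> 0 < eps ->
    exists y, [/\ selfadjoint y, exists z, z ** y = e /\ y ** z = e &
      cnorm (x - y) < eps]) /\
  (~ unital B ->
    forall (x : unitization B) (eps : R), staru x = x -> 0 < eps ->
    exists y, [/\ staru y = y, is_invertible y & unorm (x - y) < eps]).

End RealRankZero.

Record cstarSub (R : realType) (A : cstarAlgType R) := CStarSub {
  csub_pred :> {pred A};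
  csub_submod : submod_closed csub_pred;
  csubM : forall a b, a \in csub_pred -> b \in csub_pred ->
    a ** b \in csub_pred;
  csub_star : forall a, a \in csub_pred -> star a \in csub_pred;
  csub_closed : closed [set x | x \in csub_pred]
}.

Section SubAlgebra.
Context {R : realType} {A : cstarAlgType R} (S : cstarSub A).

HB.instance Definition _ :=
  GRing.isSubmodClosed.Build R[i] A (csub_pred S) (csub_submod S).

Record subcstar := SubCStar { subcstar_val :> A; _ : subcstar_val \in S }.
HB.instance Definition _ := [isSub for subcstar_val].
HB.instance Definition _ := [Choice of subcstar by <:].
HB.instance Definition _ := [SubChoice_isSubLmodule of subcstar by <:].

Local Notation nrm := (fun x : subcstar => `|val x|).
Lemma sub_ler_normD x y : nrm (x + y) <= nrm x + nrm y.
Proof. exact: ler_normD. Qed.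
Lemma sub_normrZ (k : R[i]) x : nrm (k *: x) = `|k| * nrm x.
Proof. exact: normrZ. Qed.
Lemma sub_normr0_eq0 x : nrm x = 0 -> x = 0.
Proof. by move=> /normr0_eq0 x0; apply: val_inj. Qed.
HB.instance Definition _ := Lmodule_isNormed.Build R[i] subcstar
  sub_ler_normD sub_normrZ sub_normr0_eq0.

Lemma sub_ballE (x y : subcstar) (e : R[i]) :
  ball x e y = ball (val x) e (val y).
Proof. by rewrite -!ball_normE. Qed.

Lemma sub_complete (F : set_system subcstar) :
  ProperFilter F -> cauchy F -> cvg F.
Proof.
move=> FF /cauchyP Fc.
have GF : ProperFilter (val @ F) := fmap_proper_filter _ _.
have : cauchy (val @ F).
  apply: cauchy_exP => e e0; have [x Fx] := Fc _ e0.
  exists (val x); rewrite /fmap/=; apply: filterS Fx => y.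
  by rewrite sub_ballE.
move=> /cauchy_cvg/cvg_ex[l Fl].
have lS : l \in S.
  have := csub_closed (c := S); apply => B /Fl FB.
  have [y By] := @filter_ex _ F FF _ FB; exists (val y); split => //.
  exact: valP.
apply/cvg_ex; exists (SubCStar lS).
apply/cvg_ballP => e e0.
have : \forall y \near val @ F, ball l e y by apply: (cvg_ballP _ _).1.
by rewrite !near_simpl; apply: filterS => y; rewrite sub_ballE.
Qed.
HB.instance Definition _ := Uniform_isComplete.Build subcstar sub_complete.

Definition sub_mul (x y : subcstar) :=
  SubCStar (csubM (valP x) (valP y)).
Definition sub_star (x : subcstar) := SubCStar (csub_star (valP x)).
Program Definition sub_isCStar := @isCStarAlgebra.Build R subcstar
  sub_mul sub_star _ _ _ _ _ _ _ _ _ _ _.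
Next Obligation. by move=> x y z; apply: val_inj; rewrite /= cmulA. Qed.
Next Obligation. by move=> x y z; apply: val_inj; rewrite /= cmulDl. Qed.
Next Obligation. by move=> x y z; apply: val_inj; rewrite /= cmulDr. Qed.
Next Obligation. by move=> *; apply: val_inj; rewrite /= cscalerAl. Qed.
Next Obligation. by move=> *; apply: val_inj; rewrite /= cscalerAr. Qed.
Next Obligation. by move=> x; apply: val_inj; rewrite /= starK. Qed.
Next Obligation. by move=> x y; apply: val_inj; rewrite /= starD. Qed.
Next Obligation. by move=> *; apply: val_inj; rewrite /= starZ. Qed.
Next Obligation. by move=> *; apply: val_inj; rewrite /= starM. Qed.
Next Obligation. by move=> x y; apply: normcM_le. Qed.
Next Obligation. by move=> x; apply: normc_star. Qed.
HB.instance Definition _ := sub_isCStar.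

End SubAlgebra.

Record free_ultrafilter := FreeUltrafilter {
  fu_sets :> set_system nat;
  fu_ultra : UltraFilter fu_sets;
  fu_free : forall n, ~ fu_sets [set n]
}.
#[global] Existing Instance fu_ultra.

Lemma fmap_ultra T U (f : T -> U) (F : set_system T) :
  UltraFilter F -> UltraFilter (f @ F).
Proof.
move=> FU; split=> [|G GF FG]; first exact: fmap_proper_filter.
rewrite predeqE => B; split; last exact: FG.
move=> GB; have [//|FNB] := in_ultra_setVsetC (f @^-1` B) FU.
have /filter_ex[x [Bx]] : G (B `&` ~` B) by apply: filterI => //; exact: FG.
exact.
Qed.

Section LInfinity.
Context {R : realType} (A : cstarAlgType R).

Definition bounded_seq : {pred nat -> A} :=
  fun a => `[< exists M : R, forall n, cnorm (a n) <= M >].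

Lemma bounded_seqP (a : nat -> A) :
  reflect (exists M : R, forall n, cnorm (a n) <= M) (a \in bounded_seq).
Proof. exact: asboolP. Qed.

Lemma bounded_seq_submod : submod_closed bounded_seq.
Proof.
split; first by apply/bounded_seqP; exists 0 => n; rewrite cnorm0.
move=> k a b /bounded_seqP[M aM] /bounded_seqP[N bN].
apply/bounded_seqP; exists (complex.Re `|k| * M + N) => n.
rewrite (le_trans (cnormD _ _))// lerD// cnormZ ler_wpM2l//.
exact: (@cnorm_ge0 R R[i]^o).
Qed.
HB.instance Definition _ :=
  GRing.isSubmodClosed.Build R[i] (nat -> A) bounded_seq bounded_seq_submod.

Record linf := LInf { linf_val :> nat -> A; _ : linf_val \in bounded_seq }.
HB.instance Definition _ := [isSub for linf_val].
HB.instance Definition _ := [Choice of linf by <:].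
HB.instance Definition _ := [SubChoice_isSubLmodule of linf by <:].

Lemma linf_bounded (a : linf) : exists M : R, forall n, cnorm (a n) <= M.
Proof. exact/bounded_seqP/(valP a). Qed.

Lemma linf_mul_subproof (a b : linf) :
  (fun n => a n ** b n) \in bounded_seq.
Proof.
have [[M aM] [N bN]] := (linf_bounded a, linf_bounded b).
apply/bounded_seqP; exists (M * N) => n.
by rewrite (le_trans (cnormM _ _))// ler_pM// cnorm_ge0.
Qed.
Definition linf_mul a b := LInf (linf_mul_subproof a b).

Lemma linf_star_subproof (a : linf) : (fun n => star (a n)) \in bounded_seq.
Proof.
have [M aM] := linf_bounded a; apply/bounded_seqP; exists M => n.
by rewrite cnorm_star.
Qed.
Definition linf_star a := LInf (linf_star_subproof a).

Lemma linf_const_subproof (a : A) : (fun=> a) \in bounded_seq.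
Proof. by apply/bounded_seqP; exists (cnorm a). Qed.
Definition linf_const a := LInf (linf_const_subproof a).

Definition linf_norm (a : linf) : R := sup (range (fun n => cnorm (a n))).

Context (omega : free_ultrafilter).
Implicit Types a b : linf.

Definition ulim (a : linf) : R := lim (cnorm (a n) @[n --> fu_sets omega]).

Lemma ulim_cvg a : cnorm (a n) @[n --> fu_sets omega] --> ulim a.
Proof.
have [M aM] := linf_bounded a.
have := @segment_compact R 0 M; rewrite compact_ultra => cp.
have fu : UltraFilter (cnorm (a n) @[n --> fu_sets omega]) :=
  fmap_ultra _ (fu_ultra omega).
have [|l [_ al]] := cp _ fu.
  have : \forall n \near fu_sets omega, `[0, M]%classic (cnorm (a n)).
    by apply: nearW => n; rewrite /= in_itv/= cnorm_ge0 aM.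
  exact.
exact: cvgP al.
Qed.
Arguments ulim_cvg : clear implicits.

Lemma ulim_eq a (l : R) :
  cnorm (a n) @[n --> fu_sets omega] --> l -> ulim a = l.
Proof. exact: cvg_lim. Qed.

Lemma ulim_ge0 a : 0 <= ulim a.
Proof.
apply: (ler_cvg_to (cvg_cst _) (ulim_cvg a)).
by apply: nearW => n; exact: cnorm_ge0.
Qed.

Lemma ulim_le a (r : R) :
  (\forall n \near fu_sets omega, cnorm (a n) <= r) -> ulim a <= r.
Proof. exact: (ler_cvg_to (ulim_cvg a) (cvg_cst _)). Qed.

Lemma ulim_lt a (r : R) :
  ulim a < r -> \forall n \near fu_sets omega, cnorm (a n) < r.
Proof.
rewrite -subr_gt0 => ar; have /cvgrPdist_lt/(_ _ ar) := ulim_cvg a.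
apply: filterS => n; rewrite ltr_distlC => /andP[_].
by rewrite addrCA subrr addr0.
Qed.

Lemma ulimD a b : ulim (a + b) <= ulim a + ulim b.
Proof.
apply: (ler_cvg_to (ulim_cvg _) (cvgD (ulim_cvg a) (ulim_cvg b))).
by apply: nearW => n; exact: cnormD.
Qed.

Lemma ulimZ (k : R[i]) a : ulim (k *: a) = complex.Re `|k| * ulim a.
Proof.
apply: ulim_eq.
under eq_cvg do rewrite cnormZ.
exact: cvgMr (ulim_cvg a).
Qed.

Lemma ulimN a : ulim (- a) = ulim a.
Proof. by apply: ulim_eq; under eq_cvg do rewrite cnormN; exact: ulim_cvg. Qed.

Lemma ulimM a b : ulim (linf_mul a b) <= ulim a * ulim b.
Proof.
apply: (ler_cvg_to (ulim_cvg _) (cvgM (ulim_cvg a) (ulim_cvg b))).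
by apply: nearW => n; exact: cnormM.
Qed.

Lemma ulim_star a : ulim (linf_star a) = ulim a.
Proof.
by apply: ulim_eq; under eq_cvg do rewrite cnorm_star; exact: ulim_cvg.
Qed.

Lemma ulim_starM a : ulim (linf_mul (linf_star a) a) = ulim a ^+ 2.
Proof.
apply: ulim_eq; under eq_cvg do rewrite cnorm_starM.
by rewrite expr2; exact: cvgM (ulim_cvg a) (ulim_cvg a).
Qed.

Definition c_omega : {pred linf} :=
  fun a => `[< cnorm (a n) @[n --> fu_sets omega] --> (0 : R) >].

Lemma c_omegaE a : (a \in c_omega) = (ulim a == 0).
Proof.
apply/asboolP/eqP => [/ulim_eq//|a0].
by rewrite -a0; exact: ulim_cvg.
Qed.

Lemma c_omega_zmod : zmod_closed c_omega.
Proof.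
split=> [|a b]; first by rewrite c_omegaE -(scale0r 0) ulimZ normr0 mul0r.
rewrite !c_omegaE => /eqP a0 /eqP b0; rewrite eq_le ulim_ge0 andbT.
by rewrite (le_trans (ulimD _ _))// ulimN a0 b0 addr0.
Qed.
HB.instance Definition _ := GRing.isZmodClosed.Build linf c_omega c_omega_zmod.

Definition ultrapower := {ideal_quot c_omega}.
HB.instance Definition _ := GRing.Zmodule.on ultrapower.

Definition uclass (a : linf) : ultrapower := (\pi_{ideal_quot c_omega} a)%qT.

Definition urepr (x : ultrapower) : linf := repr (x : {ideal_quot c_omega}).

Lemma ureprK : cancel urepr uclass.
Proof. exact: reprK. Qed.

Lemma uclass_eq a b : uclass a = uclass b <-> a - b \in c_omega.
Proof. by rewrite (Quotient.idealrBE c_omega); split=> /eqP. Qed.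

Lemma uclassD a b : uclass (a + b) = uclass a + uclass b.
Proof. exact: Quotient.pi_add. Qed.

Lemma uclassN a : uclass (- a) = - uclass a.
Proof. exact: Quotient.pi_opp. Qed.

Lemma uclassP (x : ultrapower) : exists a, x = uclass a.
Proof. by exists (urepr x); rewrite ureprK. Qed.

Lemma urepr_uclass a : ulim (urepr (uclass a) - a) = 0.
Proof. by apply/eqP; rewrite -c_omegaE; apply/uclass_eq; rewrite ureprK. Qed.

Definition uscale (k : R[i]) (x : ultrapower) := uclass (k *: urepr x).
Definition umul (x y : ultrapower) := uclass (linf_mul (urepr x) (urepr y)).
Definition ustar (x : ultrapower) := uclass (linf_star (urepr x)).

Lemma uscaleE k a : uscale k (uclass a) = uclass (k *: a).
Proof.
by apply/uclass_eq; rewrite -scalerBr c_omegaE ulimZ urepr_uclass mulr0.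
Qed.

Lemma umulE a b : umul (uclass a) (uclass b) = uclass (linf_mul a b).
Proof.
apply/uclass_eq; set a' := urepr _; set b' := urepr _.
have -> : linf_mul a' b' - linf_mul a b =
    linf_mul (a' - a) b' + linf_mul a (b' - b).
  apply: val_inj; apply/funext => n /=.
  rewrite /GRing.add/= cmulDl cmulDr cmulNl cmulNr.
  by rewrite addrA subrK.
rewrite c_omegaE eq_le ulim_ge0 andbT (le_trans (ulimD _ _))//.
rewrite -[leRHS]addr0 lerD// (le_trans (ulimM _ _))// urepr_uclass.
  by rewrite mul0r.
by rewrite mulr0.
Qed.

Lemma ustarE a : ustar (uclass a) = uclass (linf_star a).
Proof.
apply/uclass_eq; rewrite c_omegaE -(urepr_uclass a) -ulim_star; apply/eqP.
congr ulim; apply: val_inj; apply/funext => n /=.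
rewrite -[LHS]/(star (star (urepr (uclass a) n) - star (a n))).
by rewrite starD starN !starK.
Qed.

Lemma uscaleA k l x : uscale k (uscale l x) = uscale (k * l) x.
Proof. by have [a ->] := uclassP x; rewrite !uscaleE scalerA. Qed.
Lemma uscale1 : left_id 1 uscale.
Proof. by move=> x; have [a ->] := uclassP x; rewrite !uscaleE scale1r. Qed.
Lemma uscaleDr : right_distributive uscale +%R.
Proof.
move=> k x y; have [[a ->] [b ->]] := (uclassP x, uclassP y).
by rewrite -uclassD !uscaleE scalerDr uclassD.
Qed.
Lemma uscaleDl x : {morph uscale^~ x : k l / k + l}.
Proof.
by move=> k l; have [a ->] := uclassP x; rewrite !uscaleE scalerDl uclassD.
Qed.
HB.instance Definition _ := GRing.Zmodule_isLmodule.Build R[i] ultrapower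
  uscaleA uscale1 uscaleDr uscaleDl.

Lemma uclassZ (k : R[i]) a : uclass (k *: a) = k *: uclass a.
Proof. by rewrite -uscaleE. Qed.

Definition ultra_norm (x : ultrapower) : R :=
  inf [set linf_norm a | a in [set a | uclass a = x]].

Lemma linf_norm_ub a n : cnorm (a n) <= linf_norm a.
Proof.
have [M aM] := linf_bounded a; apply: ub_le_sup; last by exists n.
by exists M => _ [m _ <-].
Qed.

Lemma linf_norm_le a (r : R) : (forall n, cnorm (a n) <= r) -> linf_norm a <= r.
Proof.
move=> ar; apply: ge_sup; first by exists (cnorm (a 0%N)), 0%N.
by move=> _ [m _ <-].
Qed.

Lemma unrmE a : ultra_norm (uclass a) = ulim a.
Proof.
have lb :
    lbound [set linf_norm b | b in [set b | uclass b = uclass a]] (ulim a).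
  move=> _ [b /uclass_eq ba <-].
  have -> : a = b - (b - a) by rewrite subKr.
  rewrite (le_trans (ulimD _ _))// ulimN; move: ba; rewrite c_omegaE => /eqP ->.
  rewrite addr0 ulim_le//; apply: nearW => n.
  exact: linf_norm_ub.
apply/eqP; rewrite eq_le; apply/andP; split; last first.
  by apply: lb_le_inf => //; exists (linf_norm a), a.
apply/ler_addgt0Pr => e e0.
have ae : ulim a < ulim a + e by rewrite ltrDl.
pose b0 n := if cnorm (a n) < ulim a + e then a n else 0.
have b0e n : cnorm (b0 n) <= ulim a + e.
  rewrite /b0; case: ifPn => [/ltW//|_].
  by rewrite cnorm0 addr_ge0 ?ulim_ge0 ?ltW.
have bb : b0 \in bounded_seq by apply/bounded_seqP; exists (ulim a + e).
apply: (@le_trans _ _ (linf_norm (LInf bb))); last exact: linf_norm_le.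
apply: ge_inf; first by exists (ulim a).
exists (LInf bb) => //=; apply/uclass_eq.
rewrite c_omegaE eq_le ulim_ge0 andbT ulim_le//.
apply: filterS (ulim_lt ae) => n an /=.
by rewrite /GRing.add/= /b0 an subrr cnorm0.
Qed.

Local Notation nrm := (fun x : ultrapower => (ultra_norm x)%:C).
Lemma unrmD x y : nrm (x + y) <= nrm x + nrm y.
Proof.
have [[a ->] [b ->]] := (uclassP x, uclassP y).
by rewrite -rmorphD/= lecR -uclassD !unrmE ulimD.
Qed.
Lemma unrmZ (k : R[i]) x : nrm (k *: x) = `|k| * nrm x.
Proof.
have [a ->] := uclassP x; rewrite -uclassZ !unrmE ulimZ rmorphM/=.
by congr (_ * _); rewrite [RHS]cnormE.
Qed.
Lemma unrm0_eq0 x : nrm x = 0 -> x = 0.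
Proof.
have [a ->] := uclassP x; rewrite unrmE => /complexI a0.
rewrite -[RHS](subrr (uclass 0)) -uclassN -uclassD subrr.
by apply/uclass_eq; rewrite subr0 c_omegaE a0.
Qed.
HB.instance Definition _ := Lmodule_isNormed.Build R[i] ultrapower
  unrmD unrmZ unrm0_eq0.

Lemma ucnormE a : cnorm (uclass a) = ulim a.
Proof. by rewrite -unrmE. Qed.

Lemma uballE (x y : ultrapower) (e : R) :
  ball x e%:C y <-> cnorm (x - y) < e.
Proof. by rewrite -ball_normE /ball_/= cnormE ltcR. Qed.

Lemma fu_ge k : \forall n \near fu_sets omega, (k <= n)%N.
Proof.
elim: k => [|k IH]; first exact: nearW.
have [/fu_free//|Nk] := in_ultra_setVsetC [set k] (fu_ultra omega).
apply: filterS2 IH Nk => n /= kn nk.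
by rewrite ltn_neqAle kn andbT; apply/eqP => kn'; apply: nk.
Qed.

(* Diagonal argument: this is where freeness of omega is used. *)
Lemma ultra_seq_complete (x : nat -> ultrapower) :
  (forall i j, cnorm (x i - x j) < i.+1%:R^-1 + j.+1%:R^-1) ->
  exists y, forall k, cnorm (x k - y) <= k.+1%:R^-1 + k.+1%:R^-1.
Proof.
move=> xij; pose a k := urepr (x k).
have aij i j : \forall n \near fu_sets omega,
    cnorm (a i n - a j n) < i.+1%:R^-1 + j.+1%:R^-1.
  by apply: (@ulim_lt (a i - a j)); rewrite -ucnormE uclassD uclassN !ureprK.
pose P n k := [forall i : 'I_k.+1, forall j : 'I_k.+1,
  cnorm (a i n - a j n) < i.+1%:R^-1 + j.+1%:R^-1].
have Pk k : \forall n \near fu_sets omega, P n k.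
  have : \forall n \near fu_sets omega, forall i j : 'I_k.+1,
      cnorm (a i n - a j n) < i.+1%:R^-1 + j.+1%:R^-1.
    apply: filter_forall => i; apply: filter_forall => j; exact: aij.
  by apply: filterS => n h; apply/forallP => i; apply/forallP => j.
have P0 n : P n 0%N.
  apply/forallP => i; apply/forallP => j; rewrite !ord1 subrr cnorm0.
  by rewrite addr_gt0// invr_gt0.
pose m n := val [arg max_(k > @ord0 n | P n k) (k : nat)].
have mP n : P n (m n) by rewrite /m; case: arg_maxnP.
have mge n k : (k <= n)%N -> P n k -> (k <= m n)%N.
  move=> kn; rewrite -ltnS in kn => pk; rewrite /m.
  by case: arg_maxnP => // i _ /(_ (Ordinal kn) pk).
pose b0 n := a (m n) n.
have b0k n k : (k <= m n)%N ->
    cnorm (a k n - b0 n) < k.+1%:R^-1 + (m n).+1%:R^-1.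
  rewrite -ltnS => km; have /forallP/(_ (Ordinal km))/forallP := mP n.
  by move=> /(_ ord_max).
have b0le n k : (k <= m n)%N -> cnorm (a k n - b0 n) <= k.+1%:R^-1 + k.+1%:R^-1.
  move=> km; rewrite (le_trans (ltW (b0k n k km)))// lerD2l.
  by rewrite lef_pV2 ?posrE// ler_nat ltnS.
have bb : b0 \in bounded_seq.
  have [M aM] := linf_bounded (a 0%N); apply/bounded_seqP.
  exists (M + (1^-1 + 1^-1)) => n.
  rewrite -[b0 n](subKr (a 0%N n)) (le_trans (cnormD _ _))// lerD// cnormN.
  exact: b0le.
exists (uclass (LInf bb)) => k.
rewrite -[x k]ureprK -uclassN -uclassD ucnormE; apply: ulim_le.
apply: filterS2 (fu_ge k) (Pk k) => n kn pk.
by apply: b0le; apply: mge.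
Qed.

Lemma ultra_complete (F : set_system ultrapower) :
  ProperFilter F -> cauchy F -> cvg F.
Proof.
move=> FF /cauchyP Fc.
have e0 k : 0 < (k.+1%:R^-1 : R) by rewrite invr_gt0.
have /choice[x Fx] : forall k : nat, exists x, F (ball x (k.+1%:R^-1 : R)%:C).
  by move=> k; apply: Fc; rewrite ltcR.
have [i j|y xy] := @ultra_seq_complete x.
  have [z [/uballE iz /uballE jz]] := filter_ex (filterI (Fx i) (Fx j)).
  rewrite -(subrKA z) (le_lt_trans (cnormD _ _))// ltrD//.
  by rewrite cnormB.
apply/cvg_ex; exists y; apply/cvg_ballP => e.
rewrite ltcE/= => /andP[/eqP ime ree].
have {ime} -> : e = (complex.Re e)%:C by case: e ime {ree} => /= ? ? ->.
move: (complex.Re e) ree => {}e e_gt0.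
have [k ke] : exists k : nat, k.+1%:R^-1 < e / 3.
  have e3 : 0 < e / 3 by rewrite divr_gt0.
  by have [k] := ltr_add_invr e3; rewrite add0r; exists k.
apply: filterS (Fx k) => z /uballE kz; apply/uballE.
rewrite -(subrKA (x k)) (le_lt_trans (cnormD _ _))// cnormB.
rewrite (le_lt_trans (lerD (xy k) (ltW kz)))//.
have -> : e = e / 3 + e / 3 + e / 3 by lra.
by rewrite !ltrD.
Qed.
HB.instance Definition _ := Uniform_isComplete.Build ultrapower ultra_complete.

Lemma umulA : associative umul.
Proof.
move=> x y z.
have [[[a ->] [b ->]] [c ->]] := (uclassP x, uclassP y, uclassP z).
rewrite !umulE; congr uclass; apply: val_inj; apply/funext => n /=.
by rewrite cmulA.
Qed.
Lemma umulDl : left_distributive umul +%R.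
Proof.
move=> x y z.
have [[[a ->] [b ->]] [c ->]] := (uclassP x, uclassP y, uclassP z).
rewrite -uclassD !umulE -uclassD; congr uclass.
by apply: val_inj; apply/funext => n; exact: cmulDl.
Qed.
Lemma umulDr : right_distributive umul +%R.
Proof.
move=> x y z.
have [[[a ->] [b ->]] [c ->]] := (uclassP x, uclassP y, uclassP z).
rewrite -uclassD !umulE -uclassD; congr uclass.
by apply: val_inj; apply/funext => n; exact: cmulDr.
Qed.
Lemma uscaleAl (k : R[i]) (x y : ultrapower) :
  k *: umul x y = umul (k *: x) y.
Proof.
have [[a ->] [b ->]] := (uclassP x, uclassP y).
rewrite -uclassZ !umulE -uclassZ; congr uclass.
by apply: val_inj; apply/funext => n; exact: cscalerAl.
Qed.
Lemma uscaleAr (k : R[i]) (x y : ultrapower) :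
  k *: umul x y = umul x (k *: y).
Proof.
have [[a ->] [b ->]] := (uclassP x, uclassP y).
rewrite -uclassZ !umulE -uclassZ; congr uclass.
by apply: val_inj; apply/funext => n; exact: cscalerAr.
Qed.
Lemma ustarK : involutive ustar.
Proof.
move=> x; have [a ->] := uclassP x; rewrite !ustarE; congr uclass.
by apply: val_inj; apply/funext => n; exact: starK.
Qed.
Lemma ustarD : {morph ustar : x y / x + y}.
Proof.
move=> x y; have [[a ->] [b ->]] := (uclassP x, uclassP y).
rewrite -uclassD !ustarE -uclassD; congr uclass.
by apply: val_inj; apply/funext => n; exact: starD.
Qed.
Lemma ustarZ (k : R[i]) (x : ultrapower) : ustar (k *: x) = conjc k *: ustar x.
Proof.
have [a ->] := uclassP x; rewrite -uclassZ !ustarE -uclassZ; congr uclass.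
by apply: val_inj; apply/funext => n; exact: starZ.
Qed.
Lemma ustarM x y : ustar (umul x y) = umul (ustar y) (ustar x).
Proof.
have [[a ->] [b ->]] := (uclassP x, uclassP y).
rewrite [ustar (uclass a)]ustarE [ustar (uclass b)]ustarE !umulE ustarE.
congr uclass.
by apply: val_inj; apply/funext => n; exact: starM.
Qed.
Lemma unormcM_le (x y : ultrapower) : `|umul x y| <= `|x| * `|y|.
Proof.
have [[a ->] [b ->]] := (uclassP x, uclassP y).
by rewrite !cnormE umulE !ucnormE -rmorphM/= lecR ulimM.
Qed.
Lemma unormc_star (x : ultrapower) : `|umul (ustar x) x| = `|x| ^+ 2.
Proof.
have [a ->] := uclassP x.
by rewrite !cnormE ustarE umulE !ucnormE -rmorphXn/= ulim_starM.
Qed.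
HB.instance Definition _ := isCStarAlgebra.Build R ultrapower
  umulA umulDl umulDr uscaleAl uscaleAr ustarK ustarD ustarZ ustarM
  unormcM_le unormc_star.

Definition uconst (a : A) : ultrapower := uclass (linf_const a).

Definition commutes_with_A : {pred ultrapower} :=
  fun x => `[< forall a : A, x ** uconst a = uconst a ** x >].

Lemma commutes_submod : submod_closed commutes_with_A.
Proof.
split; first by apply/asboolP => a; rewrite cmul0l cmul0r.
move=> k x y /asboolP xA /asboolP yA; apply/asboolP => a.
by rewrite cmulDl cmulDr -cscalerAl -cscalerAr xA yA.
Qed.

Lemma commutesM x y : x \in commutes_with_A -> y \in commutes_with_A ->
  x ** y \in commutes_with_A.
Proof.
move=> /asboolP xA /asboolP yA; apply/asboolP => a.
by rewrite -cmulA yA cmulA xA cmulA.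
Qed.

Lemma star_uconst (a : A) : star (uconst a) = uconst (star a).
Proof.
rewrite [LHS]ustarE; congr uclass.
by apply: val_inj; apply/funext.
Qed.

Lemma commutes_star x :
  x \in commutes_with_A -> star x \in commutes_with_A.
Proof.
move=> /asboolP xA; apply/asboolP => a.
by rewrite -[a]starK -star_uconst -!starM xA.
Qed.

Lemma commutes_closed : closed [set x | x \in commutes_with_A].
Proof.
move=> x xcl; apply/asboolP => a; apply/eqP; rewrite -subr_eq0; apply/eqP.
apply: (@cnorm0_eq0 R); apply/eqP; rewrite eq_le cnorm_ge0 andbT.
apply/ler_addgt0Pr => e e0; rewrite add0r.
pose M := cnorm (uconst a) + 1.
have M0 : 0 < M by rewrite ltr_pwDr ?cnorm_ge0.
have d0 : 0 < e / (2 * M) by rewrite divr_gt0// mulr_gt0.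
have [|y [/asboolP yA /uballE xy]] := xcl (ball x (e / (2 * M))%:C).
  by apply: nbhsx_ballx; rewrite ltcR.
have -> : x ** uconst a - uconst a ** x =
    (x - y) ** uconst a - uconst a ** (x - y).
  by rewrite cmulDl cmulDr cmulNl cmulNr yA opprD addrACA subrr addr0.
rewrite (le_trans (cnormD _ _))// cnormN.
have aM : cnorm (uconst a) <= M by rewrite lerDl.
have le1 : cnorm ((x - y) ** uconst a) <= e / (2 * M) * M.
  by rewrite (le_trans (cnormM _ _))// ler_pM ?cnorm_ge0// ltW.
have le2 : cnorm (uconst a ** (x - y)) <= M * (e / (2 * M)).
  by rewrite (le_trans (cnormM _ _))// ler_pM ?cnorm_ge0// ltW.
rewrite (le_trans (lerD le1 le2))// le_eqVlt; apply/orP; left; apply/eqP.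
by field; rewrite gt_eqF.
Qed.

Definition central_sub : cstarSub ultrapower :=
  CStarSub commutes_submod commutesM commutes_star commutes_closed.

Definition central_seq_algebra : cstarAlgType R := subcstar central_sub.

End LInfinity.

Section Actions.
Context {R : realType} {A : cstarAlgType R} {G : finGroupType}.

Definition star_automorphism (f : A -> A) :=
  [/\ bijective f, linear f, {morph f : a b / a ** b} &
      {morph f : a / star a}].

Definition cstar_action (alpha : G -> A -> A) :=
  (forall g, star_automorphism (alpha g)) /\
  (forall (g h : G) a, alpha (g * h)%g a = alpha g (alpha h a)).

(* The common form of the two Rokhlin properties; Q is the condition imposed on
   each p_g. *)
Definition rokhlin_with (Q : A -> Prop) (alpha : G -> A -> A) :=
  forall (F : set A) (eps : R) (x y : A),
    finite_set F -> 0 < eps -> is_positive x -> is_positive y -> cnorm x = 1 ->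
  exists p : G -> A,
    let P := \sum_(g : G) p g in
    [/\ forall g, Q (p g),
        forall g h, g != h -> p g ** p h = 0,
        forall a g, F a -> cnorm (p g ** a - a ** p g) < eps &
        [/\ forall g h, cnorm (alpha g (p h) - p (g * h)%g) < eps,
            cuntz_sub (cutdown eps (y ** y - y ** P ** y)) x &
            cnorm (P ** x ** P) > 1 - eps]].

Definition tracial_rokhlin := rokhlin_with (@is_projection R A).

Definition weak_tracial_rokhlin :=
  rokhlin_with (fun a => is_positive a /\ contractive a).

End Actions.

(* Main.v *)
Require Import Defs.
From HB Require Import structures.
From mathcomp Require Import all_boot all_order all_algebra all_fingroup.
From mathcomp Require Import all_classical all_reals topology normedtype.
From mathcomp Require Import sequences derive realfun.
From mathcomp Require Import complex ring lra.
Set Implicit Arguments.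
Unset Strict Implicit.
Unset Printing Implicit Defensive.
Import Order.TTheory GRing.Theory Num.Theory.
Import numFieldNormedType.Exports.
Local Open Scope classical_set_scope.
Local Open Scope ring_scope.
Local Open Scope complex_scope.
Local Open Scope cstar_scope.

(** Take towers of orthogonal positive contractions from the weak property for
    finite sets that exhaust a countable dense subset and tolerances tending to
    zero. Their members indexed by the neutral element of [G] form a sequence
    whose class [e] lies in the central sequence algebra. Real rank zero provides
    there an element [q = e r e] which is almost a projection and almost
    satisfies [q e = e] ([rr0_almost_projection]): perturb [e^2 - d] to an
    invertible element and take the spectral projection of its positive part.
    Representing [r] by a sequence and going far enough along the ultrafilter
    gives such an element in [A] itself, almost commuting with prescribed
    elements ([lift_almost_projection]).

    Because [q] has [e] as a factor on both sides, its translates [alpha g q] are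
    almost orthogonal, like the members [p g] of the tower, and are perturbed to
    orthogonal projections [P g] ([rokhlin_projections]). Almost commutation and
    almost equivariance are inherited from [q]. With [Q] the sum of the [P g] and
    [P] that of the [p g], [Q P] is close to [P]. Hence [P x P] is close to
    [P Q x Q P], so that [Q x Q] has almost norm one. Moreover [y] may be included
    among the elements almost commuting with [Q], and then [y^2 - y Q y] is close
    to the compression of [y^2 - y P y] by [1 - Q]; a cutdown of the former is
    therefore Cuntz below a cutdown of the latter ([cuntz_sub_absorb]).

    These steps use the continuous functional calculus and positivity, which are
    developed in the unitization of an arbitrary C*-algebra. The main point is
    that the norm of a self-adjoint element is attained on its spectrum
    ([nrm_peval_attained]); it rests on the square root of [1 - c] for [c] a
    self-adjoint strict contraction, and on the factorization of complex
    polynomials. Positivity of [x^* x] ([pos_starM]) then yields the order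
    properties behind Cuntz comparison. *)

(** * The C*-norm of the unitization *)

Section UnitizationNorm.
Context {R : realType} {A : cstarAlgType R}.
Local Notation U := (unitization A).
Implicit Types (z w : U) (a b x : A) (k : R[i]) (r : R).

Definition cmod k : R := complex.Re `|k|.

Lemma cmodE k : `|k| = (cmod k)%:C.
Proof. by rewrite /cmod RRe_real// normr_real. Qed.

Lemma cmod_ge0 k : 0 <= cmod k.
Proof. by rewrite -ler0c -cmodE. Qed.

Lemma cmodD k l : cmod (k + l) <= cmod k + cmod l.
Proof. by rewrite -lecR rmorphD/= -!cmodE ler_normD. Qed.

Lemma cmodM k l : cmod (k * l) = cmod k * cmod l.
Proof. by apply: complexI; rewrite rmorphM/= -!cmodE normrM. Qed.

Lemma cmod_conj k : cmod (conjc k) = cmod k.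
Proof. by case: k => a b; rewrite /cmod /conjc !normc_def/= sqrrN. Qed.

Lemma cmod_real r : cmod r%:C = `|r|.
Proof. by rewrite /cmod normc_def/= expr0n/= addr0 sqrtr_sqr. Qed.

Lemma cmod1 : cmod 1 = 1.
Proof. by rewrite -[1 in LHS]/(1%:C) cmod_real normr1. Qed.

Lemma cmod0 : cmod 0 = 0.
Proof. by rewrite -[0 in LHS]/(0%:C) cmod_real normr0. Qed.

Lemma cmod_eq0 k : cmod k = 0 -> k = 0.
Proof. by move=> k0; apply/normr0_eq0; rewrite cmodE k0. Qed.

Definition act z x : A := upart z ** x + uscal z *: x.

Lemma actM z w x : act (z * w) x = act z (act w x).
Proof.
rewrite /act /= !cmulDl !cmulDr !scalerDr !scalerA -!cscalerAr -!cscalerAl.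
by rewrite -cmulA -!addrA; congr (_ + _); rewrite addrCA.
Qed.

Lemma actD z w x : act (z + w) x = act z x + act w x.
Proof. by rewrite /act /= cmulDl scalerDl addrACA. Qed.

Lemma actZ k z x : act (k *: z) x = k *: act z x.
Proof. by rewrite /act /= -cscalerAl scalerDr scalerA. Qed.

Lemma act1 x : act 1 x = x.
Proof. by rewrite /act /= cmul0l add0r scale1r. Qed.

Lemma act_scale k z x : act z (k *: x) = k *: act z x.
Proof. by rewrite /act scalerDr -cscalerAr !scalerA mulrC. Qed.

Lemma act_inu a x : act (inu a) x = a ** x.
Proof. by rewrite /act /= scale0r addr0. Qed.

(** [staru z] is adjoint to [z] for the [A]-valued inner product [star x ** y];
    the C*-inequality for the operator norm follows as for Hilbert space operators. *)
Lemma act_adj z x y : star (act z x) ** y = star x ** act (staru z) y.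
Proof.
rewrite /act starD starM starZ cmulDl cmulDr /= -cmulA -cscalerAl -cscalerAr.
by [].
Qed.

Lemma act_bounded z x :
  cnorm (act z x) <= (cnorm (upart z) + cmod (uscal z)) * cnorm x.
Proof.
by rewrite (le_trans (cnormD _ _))// cnormZ mulrDl lerD// cnormM.
Qed.

Lemma unorm_has_sup z :
  has_sup [set cnorm (upart z ** x + uscal z *: x) | x in [set x | cnorm x <= 1]].
Proof.
split; first by exists (cnorm (act z 0)), 0 => //=; rewrite cnorm0 ler01.
exists (cnorm (upart z) + cmod (uscal z)) => _ [x /= x1 <-].
rewrite (le_trans (act_bounded z x))// ler_piMr// addr_ge0 ?cnorm_ge0//.
exact: cmod_ge0.
Qed.

Lemma unorm_ge0 z : 0 <= unorm z.
Proof.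
apply: le_trans (cnorm_ge0 (act z 0)) _; apply: ub_le_sup.
  by case: (unorm_has_sup z).
by exists 0 => //=; rewrite cnorm0 ler01.
Qed.

Lemma cnorm_act z x : cnorm (act z x) <= unorm z * cnorm x.
Proof.
have [/cnorm0_eq0 ->|x0] := eqVneq (cnorm x) 0.
  by rewrite /act cmul0r scaler0 addr0 cnorm0 mulr0.
have xp : 0 < cnorm x by rewrite lt_neqAle eq_sym x0 cnorm_ge0.
rewrite -ler_pdivrMr//.
have -> : cnorm (act z x) / cnorm x = cnorm (act z ((cnorm x)^-1%:C *: x)).
  rewrite act_scale cnormZ -/(cmod _) cmod_real ger0_norm ?invr_ge0 ?cnorm_ge0//.
  by rewrite mulrC.
apply: ub_le_sup; first by case: (unorm_has_sup z).
exists ((cnorm x)^-1%:C *: x) => //=.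
by rewrite cnormZ -/(cmod _) cmod_real ger0_norm ?invr_ge0 ?cnorm_ge0// mulVf.
Qed.

Lemma unorm_le z r : 0 <= r -> (forall x, cnorm (act z x) <= r * cnorm x) ->
  unorm z <= r.
Proof.
move=> r0 zr; apply: ge_sup; first by case: (unorm_has_sup z).
by move=> _ [x /= x1 <-]; rewrite (le_trans (zr x))// ler_piMr.
Qed.

Lemma staruK z : staru (staru z) = z.
Proof. by case: z => a k; rewrite /staru/= starK conjcK. Qed.

Lemma staruM z w : staru (z * w) = staru w * staru z.
Proof.
case: z w => [a k] [b l]; congr Unitization => /=; last first.
  by rewrite rmorphM mulrC.
by rewrite !starD !starZ starM [X in _ + X]addrC.
Qed.

Lemma staruD z w : staru (z + w) = staru z + staru w.
Proof. by rewrite /staru /= starD rmorphD. Qed.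

Lemma staruN z : staru (- z) = - staru z.
Proof. by rewrite /staru /= starN rmorphN. Qed.

Lemma staruB z w : staru (z - w) = staru z - staru w.
Proof. by rewrite staruD staruN. Qed.

Lemma staruZ k z : staru (k *: z) = conjc k *: staru z.
Proof. by rewrite /staru /= starZ rmorphM. Qed.

Lemma staru1 : staru (1 : U) = 1.
Proof. by congr Unitization; [exact: star0 | exact: conjc1]. Qed.

Lemma staru0 : staru (0 : U) = 0.
Proof. by congr Unitization; [exact: star0 | exact: conjc0]. Qed.

Lemma staruX z n : staru (z ^+ n) = staru z ^+ n.
Proof.
by elim: n => [|n IH]; rewrite ?staru1// exprS staruM IH exprSr.
Qed.

Lemma inuM a b : inu (a ** b) = inu a * inu b.
Proof. by congr Unitization; rewrite /= ?mulr0// !scale0r !addr0. Qed.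
Lemma inuD a b : inu (a + b) = inu a + inu b.
Proof. by congr Unitization; rewrite /= addr0. Qed.
Lemma inuN a : inu (- a) = - inu a.
Proof. by congr Unitization; rewrite /= oppr0. Qed.
Lemma inuB a b : inu (a - b) = inu a - inu b.
Proof. by rewrite inuD inuN. Qed.
Lemma inuZ k a : inu (k *: a) = k *: inu a.
Proof. by congr Unitization; rewrite /= mulr0. Qed.
Lemma inu_star a : staru (inu a) = inu (star a).
Proof. by congr Unitization; exact: conjc0. Qed.
Lemma inuK z : uscal z = 0 -> inu (upart z) = z.
Proof. by case: z => a k /= ->. Qed.
Lemma inu_inj : injective (@inu R A).
Proof. by move=> a b []. Qed.

Lemma unorm_star_le z : unorm z ^+ 2 <= unorm (staru z * z).
Proof.
rewrite -[leRHS]sqr_sqrtr ?unorm_ge0// ler_pXn2r ?nnegrE ?unorm_ge0 ?sqrtr_ge0//.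
apply: unorm_le => [|x]; first exact: sqrtr_ge0.
rewrite -(@ler_pXn2r _ 2%N) ?nnegrE ?mulr_ge0 ?sqrtr_ge0 ?cnorm_ge0//.
rewrite exprMn sqr_sqrtr ?unorm_ge0// -cnorm_starM act_adj -actM.
rewrite (le_trans (cnormM _ _))// cnorm_star mulrC expr2 mulrA.
by rewrite ler_wpM2r ?cnorm_ge0// cnorm_act.
Qed.

Lemma unormM z w : unorm (z * w) <= unorm z * unorm w.
Proof.
apply: unorm_le => [|x]; first by rewrite mulr_ge0 ?unorm_ge0.
by rewrite actM (le_trans (cnorm_act _ _))// -mulrA ler_wpM2l ?unorm_ge0 ?cnorm_act.
Qed.

Lemma unorm_star z : unorm (staru z) = unorm z.
Proof.
have le w : unorm w <= unorm (staru w).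
  have [->|w0] := eqVneq (unorm w) 0; first exact: unorm_ge0.
  have wp : 0 < unorm w by rewrite lt_neqAle eq_sym w0 unorm_ge0.
  by rewrite -(ler_pM2r wp) -expr2 (le_trans (unorm_star_le w))// unormM.
by apply/eqP; rewrite eq_le le -{2}[z]staruK le.
Qed.

(** The operator norm degenerates when [A] has a unit [e], since [1 - e] acts
    as [0]; its maximum with the modulus of the scalar part is a C*-norm on
    [A (+) C] in all cases. *)
Definition nrm z : R := Num.max (unorm z) (cmod (uscal z)).

Lemma nrm_ge0 z : 0 <= nrm z.
Proof. by rewrite le_max unorm_ge0. Qed.

Lemma nrm_unorm z : unorm z <= nrm z.
Proof. by rewrite le_max lexx. Qed.

Lemma nrm_scal z : cmod (uscal z) <= nrm z.
Proof. by rewrite le_max lexx orbT. Qed.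

Lemma nrmD z w : nrm (z + w) <= nrm z + nrm w.
Proof.
rewrite ge_max; apply/andP; split; last first.
  by rewrite (le_trans (cmodD _ _))// lerD ?nrm_scal.
apply: unorm_le => [|x]; first by rewrite addr_ge0 ?nrm_ge0.
rewrite actD (le_trans (cnormD _ _))// mulrDl lerD//;
by rewrite (le_trans (cnorm_act _ _))// ler_wpM2r ?cnorm_ge0 ?nrm_unorm.
Qed.

Lemma nrmM z w : nrm (z * w) <= nrm z * nrm w.
Proof.
rewrite ge_max; apply/andP; split; last first.
  by rewrite /= cmodM ler_pM ?cmod_ge0 ?nrm_scal.
by rewrite (le_trans (unormM _ _))// ler_pM ?unorm_ge0 ?nrm_unorm.
Qed.

Lemma nrm_star z : nrm (staru z) = nrm z.
Proof. by rewrite /nrm unorm_star /= cmod_conj. Qed.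

Lemma nrm_starM z : nrm (staru z * z) = nrm z ^+ 2.
Proof.
apply/eqP; rewrite eq_le; apply/andP; split.
  by rewrite (le_trans (nrmM _ _))// nrm_star.
have [->|->] : nrm z = cmod (uscal z) \/ nrm z = unorm z.
- by rewrite /nrm; case: leP => _; [left | right].
- by rewrite (le_trans _ (nrm_scal _))//= cmodM cmod_conj.
- by rewrite (le_trans (unorm_star_le _))// nrm_unorm.
Qed.

Lemma nrmZ k z : nrm (k *: z) = cmod k * nrm z.
Proof.
have le l w : nrm (l *: w) <= cmod l * nrm w.
  rewrite ge_max; apply/andP; split; last by rewrite /= cmodM ler_wpM2l ?cmod_ge0 ?nrm_scal.
  apply: unorm_le => [|x]; first by rewrite mulr_ge0 ?cmod_ge0 ?nrm_ge0.
  rewrite actZ cnormZ -mulrA ler_wpM2l ?cmod_ge0//.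
  by rewrite (le_trans (cnorm_act _ _))// ler_wpM2r ?cnorm_ge0 ?nrm_unorm.
have [->|k0] := eqVneq k 0.
  rewrite scale0r cmod0 mul0r; apply/eqP; rewrite eq_le nrm_ge0 andbT.
  by rewrite -(scale0r (0 : U)) (le_trans (le _ _))// cmod0 mul0r.
apply/eqP; rewrite eq_le le/=.
have kp : 0 < cmod k.
  by rewrite lt_neqAle cmod_ge0 andbT eq_sym; apply: contra_neq k0; exact: cmod_eq0.
rewrite mulrC -ler_pdivlMr// mulrC -{1}[z](scalerK k0).
apply: (le_trans (le _ _)); rewrite ler_wpM2r ?nrm_ge0//.
rewrite -(ler_pM2r kp) -cmodM !mulVf ?cmod1// gt_eqF//.
Qed.

Lemma nrmN z : nrm (- z) = nrm z.
Proof.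
have N1 : (-1 : R[i]) = (-1)%:C by rewrite rmorphN1.
by rewrite -scaleN1r nrmZ N1 cmod_real normrN1 mul1r.
Qed.

Lemma nrmB z w : nrm (z - w) = nrm (w - z).
Proof. by rewrite -nrmN opprB. Qed.

Lemma nrm0 : nrm 0 = 0.
Proof. by rewrite -(scale0r (0 : U)) nrmZ cmod0 mul0r. Qed.

Lemma nrm_inu a : nrm (inu a) = cnorm a.
Proof.
apply/eqP; rewrite eq_le; apply/andP; split.
  rewrite ge_max /= cmod0 cnorm_ge0 andbT; apply: unorm_le => [|x]; rewrite ?cnorm_ge0//.
  by rewrite act_inu cnormM.
rewrite (le_trans _ (nrm_unorm _))//.
have [->|a0] := eqVneq (cnorm a) 0; first exact: unorm_ge0.
have ap : 0 < cnorm a by rewrite lt_neqAle eq_sym a0 cnorm_ge0.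
rewrite -(ler_pM2r ap); have := cnorm_act (inu a) (star a).
by rewrite act_inu -{1}[a]starK cnorm_starM !cnorm_star expr2.
Qed.

Lemma nrm1 : nrm 1 = 1.
Proof.
apply/eqP; rewrite eq_le; apply/andP; split; last first.
  by rewrite (le_trans _ (nrm_scal _))//= cmod1.
rewrite ge_max /= cmod1 lexx andbT; apply: unorm_le => // x.
by rewrite act1 mul1r.
Qed.

Lemma nrm_real r : nrm r%:C%:A = `|r|.
Proof. by rewrite nrmZ nrm1 mulr1 cmod_real. Qed.

Lemma nrm_eq0 z : nrm z = 0 -> z = 0.
Proof.
move=> z0; have k0 : uscal z = 0.
  by apply: cmod_eq0; apply/eqP; rewrite eq_le cmod_ge0 andbT -z0 nrm_scal.
by rewrite -(inuK k0) in z0 *; rewrite nrm_inu in z0; rewrite (cnorm0_eq0 z0).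
Qed.

Lemma nrm_upart z : cnorm (upart z) <= 2 * nrm z.
Proof.
have zE : z = inu (upart z) + (uscal z)%:A.
  case: z => a k; congr Unitization; rewrite /= ?scaler0 ?addr0 ?add0r ?mulr1//.
have h : inu (upart z) = z - (uscal z)%:A by rewrite {2}zE addrK.
rewrite -nrm_inu h (le_trans (nrmD _ _))// nrmN nrmZ nrm1 mulr1 mulr2n mulrDl mul1r.
by rewrite lerD// nrm_scal.
Qed.

Lemma nrmX z n : nrm (z ^+ n) <= nrm z ^+ n.
Proof.
elim: n => [|n IH]; first by rewrite !expr0 nrm1.
by rewrite !exprS (le_trans (nrmM _ _))// ler_wpM2l ?nrm_ge0.
Qed.

Lemma nrm_sa z : staru z = z -> nrm (z * z) = nrm z ^+ 2.
Proof. by move=> zs; rewrite -nrm_starM zs. Qed.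

End UnitizationNorm.

(** * Completeness of the unitization *)

Section UnitizationLimits.
Context {R : realType} {A : cstarAlgType R}.
Local Notation U := (unitization A).
Implicit Types (z w l : U) (u v : nat -> U) (e r : R).

Definition converges u l :=
  forall e, 0 < e -> \forall n \near \oo, nrm (u n - l) < e.

Lemma ball_cnorm (x y : A) e : ball x e%:C y <-> cnorm (x - y) < e.
Proof. by rewrite -ball_normE /ball_/= cnormE ltcR. Qed.

Lemma cstar_complete (a : nat -> A) :
  (forall e, 0 < e -> exists n, forall m, (n <= m)%N -> cnorm (a n - a m) < e) ->
  exists l : A, forall e, 0 < e -> \forall n \near \oo, cnorm (a n - l) < e.
Proof.
have realE (e : R[i]) : 0 < e -> exists2 r, 0 < r & e = r%:C.
  rewrite ltcE/= => /andP[/eqP ime ree]; exists (complex.Re e) => //.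
  by case: e ime {ree} => /= ? ? ->.
move=> aC; have : cauchy (a n @[n --> \oo]).
  apply/cauchyP => e /realE[r r0 ->]; have [n an] := aC r r0.
  exists (a n); exists n => // m /= nm.
  by apply/ball_cnorm; exact: an.
move=> /cauchy_cvg/cvg_ex[l al]; exists l => e e0.
have := (cvg_ballP _ _).1 al e%:C; rewrite ltcR => /(_ _ e0).
by apply: filterS => n /ball_cnorm; rewrite cnormB.
Qed.

(** The norm dominates the scalar part and half of the [A]-part, so a Cauchy
    sequence converges in both coordinates. *)
Lemma nrm_complete u :
  (forall e, 0 < e -> exists n, forall m, (n <= m)%N -> nrm (u n - u m) < e) ->
  exists l, converges u l.
Proof.
move=> uC.
have uniE z : z = inu (upart z) + uscal z *: 1.
  by case: z => a k; congr Unitization; rewrite /= ?scaler0 ?addr0 ?add0r ?mulr1.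
have [e e0|a al] := @cstar_complete (fun n => upart (u n)).
  have [|n un] := uC (e / 2); first by rewrite divr_gt0.
  exists n => m /un/= unm; have /= := nrm_upart (u n - u m); lra.
have [k kl] : exists k, forall e, 0 < e ->
    \forall n \near \oo, cmod (uscal (u n) - k) < e.
  have ReC (f : R[i] -> R) : {morph f : k l / k - l} ->
      (forall k, `|f k| <= cmod k) -> exists l : R, forall e, 0 < e ->
      \forall n \near \oo, `|f (uscal (u n)) - l| < e.
    move=> fB fle; have : cauchy (f (uscal (u n)) @[n --> \oo]).
      apply/cauchyP => e e0; have [n un] := uC _ e0.
      exists (f (uscal (u n))); exists n => // m /= /un unm.
      rewrite -ball_normE /ball_/= -fB (le_lt_trans _ unm)//.
      by rewrite (le_trans (fle _))// (le_trans _ (nrm_scal _)).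
    move=> /cauchy_cvg/cvg_ex[l ul]; exists l => e e0.
    have /cvgrPdist_lt/(_ _ e0) := ul.
    by apply: filterS => n; rewrite distrC.
  have [|z|a' ua'] := ReC (@complex.Re R).
  - by move=> [? ?] [? ?].
  - rewrite -lecR -cmodE; case: z => x y; rewrite normc_def lecR/=.
    by rewrite -sqrtr_sqr ler_wsqrtr// lerDl sqr_ge0.
  have [|z|b ub] := ReC (@complex.Im R).
  - by move=> [? ?] [? ?].
  - rewrite -lecR -cmodE; case: z => x y; rewrite normc_def lecR/=.
    by rewrite -sqrtr_sqr ler_wsqrtr// lerDr sqr_ge0.
  exists (Complex a' b) => e e0; have e2 : 0 < e / 2 by rewrite divr_gt0.
  apply: filterS2 (ua' _ e2) (ub _ e2) => n /= an bn.
  set z := uscal (u n) in an bn *.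
  have -> : z - Complex a' b = (complex.Re z - a')%:C + 'i * (complex.Im z - b)%:C.
    by case: (z) => x y /=; simpc.
  have cmodi : cmod 'i = 1 :> R by rewrite /cmod normc_def /= expr0n add0r expr1n sqrtr1.
  rewrite (le_lt_trans (cmodD _ _))// cmodM cmodi mul1r !cmod_real; lra.
exists (inu a + k *: 1) => e e0.
have e2 : 0 < e / 2 by rewrite divr_gt0.
apply: filterS2 (al _ e2) (kl _ e2) => n /= an kn.
rewrite [u n]uniE opprD addrACA -inuB -scalerBl (le_lt_trans (nrmD _ _))//.
by rewrite nrm_inu nrmZ nrm1 mulr1; lra.
Qed.

Lemma converges_cst z : converges (fun=> z) z.
Proof. by move=> e e0; apply: nearW => n; rewrite subrr nrm0. Qed.

Lemma converges_le u l r : (\forall n \near \oo, nrm (u n) <= r) ->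
  converges u l -> nrm l <= r.
Proof.
move=> ur ul; apply/ler_addgt0Pr => e e0.
have [n [un]] := filter_ex (filterI ur (ul e e0)).
rewrite nrmB => ln; rewrite -(subrK (u n) l) (le_trans (nrmD _ _))//; lra.
Qed.

Lemma convergesD u v l l' : converges u l -> converges v l' ->
  converges (fun n => u n + v n) (l + l').
Proof.
move=> ul vl e e0; have e2 : 0 < e / 2 by rewrite divr_gt0.
apply: filterS2 (ul _ e2) (vl _ e2) => n un vn.
by rewrite opprD addrACA (le_lt_trans (nrmD _ _))//; lra.
Qed.

Lemma convergesN u l : converges u l -> converges (fun n => - u n) (- l).
Proof.
by move=> ul e e0; apply: filterS (ul _ e0) => n; rewrite -opprD nrmN.
Qed.

Lemma converges_star u l : converges u l ->
  converges (fun n => staru (u n)) (staru l).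
Proof.
by move=> ul e e0; apply: filterS (ul _ e0) => n; rewrite -staruB nrm_star.
Qed.

Lemma convergesM u v l l' : converges u l -> converges v l' ->
  converges (fun n => u n * v n) (l * l').
Proof.
move=> ul vl e e0; pose M := nrm l + nrm l' + 1.
have M0 : 0 < M by rewrite ltr_wpDl// addr_ge0 ?nrm_ge0.
pose d := Num.min 1 (e / (2 * M)).
have d0 : 0 < d by rewrite lt_min ltr01 divr_gt0// mulr_gt0.
apply: filterS2 (ul _ d0) (vl _ d0) => n un vn.
have -> : u n * v n - l * l' = (u n - l) * v n + l * (v n - l').
  by rewrite mulrBl mulrBr addrA subrK.
have vM : nrm (v n) <= nrm l' + 1.
  rewrite -(subrK l' (v n)) (le_trans (nrmD _ _))// addrC lerD2l.
  by rewrite (le_trans (ltW vn))// ge_min lexx.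
have dM : d * (nrm l' + 1) + nrm l * d <= e / 2.
  have -> : d * (nrm l' + 1) + nrm l * d = d * M by rewrite /M; ring.
  rewrite -ler_pdivlMr// (le_trans (y := e / (2 * M)))// ?ge_min ?lexx ?orbT//.
  by rewrite invfM mulrA.
rewrite (le_lt_trans (nrmD _ _))//.
apply: (@le_lt_trans _ _ (d * (nrm l' + 1) + nrm l * d)); last lra.
rewrite lerD// (le_trans (nrmM _ _))//.
  by rewrite ler_pM ?nrm_ge0// ltW.
by rewrite ler_wpM2l ?nrm_ge0// ltW.
Qed.

Lemma convergesS u l : converges u l -> converges (fun n => u n.+1) l.
Proof.
move=> ul e e0; have [N _ uN] := ul e e0; exists N => // n /= Nn.
by apply: uN; exact: leqW.
Qed.

Lemma converges_uniq u l l' : converges u l -> converges u l' -> l = l'.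
Proof.
move=> ul ul'; apply/eqP; rewrite -subr_eq0; apply/eqP/nrm_eq0/eqP.
rewrite eq_le nrm_ge0 andbT.
apply: converges_le (convergesD ul (convergesN ul')).
by apply: nearW => n; rewrite subrr nrm0.
Qed.

Lemma converges_eq u v l : u =1 v -> converges u l -> converges v l.
Proof. by move=> /funext ->. Qed.

Lemma converges_geometric u (C rho : R) : 0 <= rho < 1 ->
  (forall n, nrm (u n.+1 - u n) <= C * rho ^+ n) -> exists l, converges u l.
Proof.
move=> /andP[r0 r1] uC; have r1' : 0 < 1 - rho by rewrite subr_gt0.
have C0 : 0 <= C by have := uC 0%N; rewrite expr0 mulr1; apply: le_trans; exact: nrm_ge0.
have tail n k : nrm (u (n + k)%N - u n) <= C * rho ^+ n * ((1 - rho ^+ k) / (1 - rho)).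
  elim: k => [|k IH]; first by rewrite addn0 subrr nrm0 expr0 subrr mul0r mulr0.
  rewrite addnS -(subrKA (u (n + k)%N)) (le_trans (nrmD _ _))//.
  rewrite (le_trans (lerD (uC _) IH))// exprD exprS le_eqVlt; apply/orP; left.
  by apply/eqP; field; rewrite gt_eqF.
apply: nrm_complete => e e0.
have : (fun n => C * rho ^+ n * (1 - rho)^-1) @ \oo --> C * 0 * (1 - rho)^-1.
  apply: cvgMl; apply: cvgMr; apply: cvg_expr; rewrite ger0_norm//.
rewrite mulr0 mul0r => /cvgrPdist_lt/(_ _ e0)[N _ /(_ N (leqnn N))] /=.
rewrite sub0r normrN ger0_norm ?mulr_ge0 ?exprn_ge0 ?invr_ge0 ?(ltW r1')// => Ne.
exists N => m /subnKC <-; rewrite nrmB (le_lt_trans (tail _ _))//.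
apply: le_lt_trans Ne; rewrite mulrA ler_wpM2r ?invr_ge0 ?(ltW r1')//.
by rewrite ler_piMr ?mulr_ge0 ?exprn_ge0// gerBl exprn_ge0.
Qed.

End UnitizationLimits.

(** * Invertible elements and square roots *)

Section Invertibility.
Context {R : realType} {A : cstarAlgType R}.
Local Notation U := (unitization A).
Implicit Types (z w b c h k s : U) (e r : R).

Lemma invertible1 : is_invertible (1 : U).
Proof. by exists 1; rewrite mulr1. Qed.

Lemma invertibleM z w : is_invertible z -> is_invertible w -> is_invertible (z * w).
Proof.
move=> [z' [z'z zz']] [w' [w'w ww']]; exists (w' * z'); split.
  by rewrite -mulrA [z' * _]mulrA z'z mul1r.
by rewrite -mulrA [w * _]mulrA ww' mul1r.
Qed.

Lemma inverse_comm z y w : y * z = 1 -> z * y = 1 -> w * z = z * w -> w * y = y * w.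
Proof.
move=> yz zy wz; rewrite -[w * y]mul1r -yz -!mulrA [z * (w * y)]mulrA -wz.
by rewrite -[w * z * y]mulrA zy mulr1.
Qed.

Lemma invertible_comm z w : z * w = w * z -> is_invertible (z * w) -> is_invertible z.
Proof.
move=> zw [y [yzw zwy]]; exists (w * y); split; last by rewrite mulrA zwy.
rewrite -mulrA -(@inverse_comm (z * w) y z)//; last by rewrite -mulrA -zw.
by rewrite mulrA -zw zwy.
Qed.

Lemma inverse_uniq z y y' : y * z = 1 -> z * y' = 1 -> y = y'.
Proof. by move=> yz zy'; rewrite -[y]mulr1 -zy' mulrA yz mul1r. Qed.

Lemma inverse_star z y : staru z = z -> y * z = 1 -> z * y = 1 -> staru y = y.
Proof.
move=> zs yz zy; apply: (@inverse_uniq z); last exact: zy.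
by rewrite -[in LHS]zs -staruM zy staru1.
Qed.

Lemma invertible_scale (k : R[i]) z : k != 0 -> is_invertible (k *: z) <-> is_invertible z.
Proof.
have inv l w : l != 0 -> is_invertible w -> is_invertible (l *: w).
  move=> l0 [y [yw wy]]; exists (l^-1 *: y).
  by rewrite -!scalerAl -!scalerAr !scalerA yw wy mulVf// mulfV// scale1r.
move=> k0; split=> [|zi]; last exact: inv.
by move=> /(inv k^-1); rewrite scalerK// invr_eq0; apply.
Qed.

Lemma neumann z rho : nrm (1 - z) <= rho -> rho < 1 ->
  exists y, [/\ y * z = 1, z * y = 1 & nrm y <= (1 - rho)^-1].
Proof.
set c := 1 - z => cr r1; have r0 : 0 <= rho := le_trans (nrm_ge0 _) cr.
have r1' : 0 < 1 - rho by rewrite subr_gt0.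
have zc : z = 1 - c by rewrite /c opprB addrCA subrr addr0.
clearbody c.
pose S n := \sum_(i < n) c ^+ i.
have cX n : nrm (c ^+ n) <= rho ^+ n.
  by rewrite (le_trans (nrmX _ _))// lerXn2r ?nnegrE ?nrm_ge0.
have Sle n : nrm (S n) <= (1 - rho)^-1.
  rewrite -div1r ler_pdivlMr// (@le_trans _ _ (1 - rho ^+ n))//; last first.
    by rewrite gerBl exprn_ge0.
  rewrite /S; elim: n => [|n IH]; first by rewrite big_ord0 nrm0 mul0r expr0 subrr.
  rewrite big_ord_recr/= (le_trans (ler_wpM2r (ltW r1') (nrmD _ _)))// mulrDl.
  rewrite (le_trans (lerD IH (ler_wpM2r (ltW r1') (cX n))))// exprS.
  by rewrite le_eqVlt; apply/orP; left; apply/eqP; ring.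
have [|n|y Sy] := @converges_geometric _ _ S 1 rho.
- by rewrite r0 r1.
- by rewrite mul1r /S big_ord_recr/= addrAC subrr add0r.
have c0 : converges (fun n => 1 - c ^+ n) 1.
  move=> e e0; have : (fun n => rho ^+ n) @ \oo --> (0 : R).
    by apply: cvg_expr; rewrite ger0_norm.
  move=> /cvgrPdist_lt/(_ _ e0); apply: filterS => n.
  rewrite sub0r normrN ger0_norm ?exprn_ge0// => ne.
  by rewrite addrC addKr nrmN (le_lt_trans (cX n)).
have zS n : 1 - c ^+ n = z * S n by rewrite zc -opprB subrX1 -mulNr opprB.
have Sz n : 1 - c ^+ n = S n * z.
  rewrite zS /S mulr_suml mulr_sumr; apply: eq_bigr => i _.
  by apply/commrX; rewrite /GRing.comm zc mulrBl mulrBr mul1r mulr1.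
exists y; split.
- apply: converges_uniq (converges_eq _ (convergesM Sy (converges_cst z))) c0 => n.
  by rewrite -Sz.
- apply: converges_uniq (converges_eq _ (convergesM (converges_cst z) Sy)) c0 => n.
  by rewrite -zS.
- by apply: converges_le Sy; apply: nearW.
Qed.

Lemma neumann_invertible z : nrm (1 - z) < 1 -> is_invertible z.
Proof. by move=> /(neumann (lexx _))[y [yz zy _]]; exists y. Qed.

Lemma scale_half (V : lmodType R[i]) (z : V) : (2^-1)%:C *: (z + z) = z.
Proof.
by rewrite scalerDr -scalerDl -rmorphD/= (_ : 2^-1 + 2^-1 = 1) ?scale1r//; lra.
Qed.

(** Fixed point of the contraction [t |-> (c + t^2) / 2], written
    [(1 - t)^2 = 1 - c]. *)
Lemma sqrt_one_minus c : staru c = c -> nrm c < 1 ->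
  exists s, [/\ staru s = s, s * s = 1 - c &
    forall w, w * c = c * w -> w * s = s * w].
Proof.
move=> cs c1; pose h : R[i] := (2^-1)%:C.
have hh : cmod h = 2^-1 by rewrite cmod_real ger0_norm ?invr_ge0.
pose f (t : U) := h *: (c + t * t); pose T n := iter n f 0.
have Tle n : nrm (T n) <= nrm c.
  elim: n => [|n IH]; first by rewrite nrm0 nrm_ge0.
  rewrite [T _]/(f (T n)) nrmZ hh.
  have : nrm (T n * T n) <= nrm c.
    rewrite (le_trans (nrmM _ _))// -[leRHS]mulr1 ler_pM ?nrm_ge0//.
    exact: le_trans IH (ltW c1).
  have := nrmD c (T n * T n); lra.
have [|n|t Tt] := @converges_geometric _ _ T (nrm c) (nrm c).
- by rewrite nrm_ge0 c1.
- elim: n => [|n IH].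
    by rewrite subr0 /T/= /f mulr0 addr0 nrmZ hh mulr1; have := nrm_ge0 c; lra.
  have -> : T n.+2 - T n.+1 = h *: (T n.+1 * (T n.+1 - T n) + (T n.+1 - T n) * T n).
    transitivity (h *: (c + T n.+1 * T n.+1) - h *: (c + T n * T n)) => //.
    rewrite -scalerBr; congr (_ *: _).
    by rewrite opprD addrACA subrr add0r mulrBr mulrBl addrA subrK.
  rewrite nrmZ hh exprS; set d := nrm c ^+ n in IH *.
  have d0 : 0 <= d by rewrite exprn_ge0 ?nrm_ge0.
  have l1 : nrm (T n.+1 * (T n.+1 - T n)) <= nrm c * (nrm c * d).
    by rewrite (le_trans (nrmM _ _))// ler_pM ?nrm_ge0.
  have l2 : nrm ((T n.+1 - T n) * T n) <= nrm c * (nrm c * d).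
    by rewrite (le_trans (nrmM _ _))// mulrC ler_pM ?nrm_ge0.
  have := nrmD (T n.+1 * (T n.+1 - T n)) ((T n.+1 - T n) * T n); lra.
have Ts : staru t = t.
  apply: converges_uniq (converges_star Tt) _; apply: converges_eq Tt => n.
  elim: n => [|n IH]; first by rewrite staru0.
  by rewrite [T _]/(f (T n)) /f staruZ staruD staruM -IH cs conjc_real.
have tE : t = h *: (c + t * t).
  apply: converges_uniq (convergesS Tt) _.
  have := convergesM (converges_cst h%:A) (convergesD (converges_cst c) (convergesM Tt Tt)).
  by rewrite mulr_algl; apply: converges_eq => n; rewrite mulr_algl.
have tt : c + t * t = t + t by rewrite [in RHS]tE -scalerDr scale_half.
exists (1 - t); split.
- by rewrite staruB staru1 Ts.
- have -> : c = t + t - t * t by rewrite -tt addrK.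
  by rewrite mulrBl mul1r mulrBr mulr1 !opprB opprD -addrA [- t + _]addrCA.
move=> w wc; rewrite mulrBl mulrBr mul1r mulr1; congr (_ - _).
apply: converges_uniq (convergesM (converges_cst w) Tt) _.
apply: converges_eq (convergesM Tt (converges_cst w)) => n.
elim: n => [|n IH]; first by rewrite mulr0 mul0r.
rewrite [T _]/(f (T n)) /f -scalerAl -scalerAr mulrDl mulrDr wc.
by rewrite mulrA -IH -!mulrA IH.
Qed.

(** The element [w = h + i k] satisfies [w^* w = h^2 + k^2], and [h] is the
    average of [w] and [w^*]. *)
Lemma nrm_comm_le h k : staru h = h -> staru k = k -> h * k = k * h ->
  nrm h ^+ 2 <= nrm (h * h + k * k).
Proof.
move=> hs ks hk; pose w := h + 'i *: k.
have ws : staru w = h - 'i *: k.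
  rewrite /w staruD staruZ hs ks; congr (_ + _); rewrite -scaleNr; congr (_ *: _).
  by simpc.
have -> : h * h + k * k = staru w * w.
  rewrite ws /w mulrDr mulrBl mulrBl -!scalerAl -!scalerAr scalerA hk.
  by rewrite -[ 'i * 'i]expr2 sqr_i scaleN1r opprK addrA subrK.
rewrite nrm_starM ler_pXn2r ?nnegrE ?nrm_ge0//.
have -> : h = (2^-1)%:C *: (w + staru w).
  by rewrite ws /w addrACA subrr addr0 scale_half.
by rewrite nrmZ cmod_real ger0_norm ?invr_ge0//; have := nrmD w (staru w); rewrite nrm_star; lra.
Qed.

(** Suppose [b] has norm [1] and [1 - b^2] is invertible. For [t < 1] close to [1],
    [1 - t b^2] has a square root [s] and an inverse [q] whose norm does not
    depend on [t]; for small [d], [1 - d q] has a square root [v] as well, and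
    [t b^2 + (s v)^2 = 1 - d]. Hence [t <= 1 - d], which fails for [t = 1 - d / 2].
    So the norm of a self-adjoint element is read off its spectrum without
    complex analysis. *)
Lemma nrm_lt1 b : staru b = b -> nrm b <= 1 -> is_invertible (1 - b * b) -> nrm b < 1.
Proof.
move=> bs b1 [y [yz zy]]; set z := 1 - b * b in yz zy.
rewrite lt_neqAle b1 andbT; apply/eqP => nb.
have zs : staru z = z by rewrite staruB staru1 staruM bs.
have ys := inverse_star zs yz zy.
pose K := nrm y; have K0 : 0 <= K := nrm_ge0 _.
pose d := (2 * (K + 1))^-1.
have d0 : 0 < d by rewrite invr_gt0 mulr_gt0// ltr_wpDl.
have dK : d * K < 2^-1.
  by rewrite /d invfM -mulrA gtr_pMr ?invr_gt0// mulrC ltr_pdivrMr ?ltr_wpDl//; lra.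
pose tau := 1 - d / 2.
have d1 : d <= 2^-1.
  by rewrite /d lef_pV2 ?posrE ?mulr_gt0 ?ltr_wpDl//; lra.
have tau0 : 0 <= tau by rewrite /tau; lra.
have nbb : nrm (b * b) = 1 by rewrite nrm_sa// nb expr1n.
(* [1 - tau b^2] is within the reach of the Neumann series of [1 - b^2]. *)
pose c := tau%:C *: (b * b).
have cs : staru c = c by rewrite staruZ staruM bs conjc_real.
have cn : nrm c <= tau by rewrite nrmZ cmod_real ger0_norm// nbb mulr1.
have [|s [ss s2 scomm]] := sqrt_one_minus cs.
  by rewrite (le_lt_trans cn)// /tau; lra.
have cz : 1 - c = z * (1 + (d / 2)%:C *: (y * (b * b))).
  rewrite mulrDr mulr1 -scalerAr mulrA zy mul1r /c /z /tau.
  by rewrite rmorphB/= scalerBl scale1r opprB addrA addrAC.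
have [||y' [y'z zy' ny']] :=
  neumann (z := 1 + (d / 2)%:C *: (y * (b * b))) (rho := 2^-1).
- rewrite opprD addrA subrr add0r nrmN nrmZ cmod_real ger0_norm ?divr_ge0 ?(ltW d0)//.
  have := nrmM y (b * b); rewrite nbb mulr1 -/K => yK.
  have : d / 2 * nrm (y * (b * b)) <= d / 2 * K by rewrite ler_wpM2l ?divr_ge0 ?(ltW d0).
  lra.
- lra.
pose q := y' * y.
have qc : q * (1 - c) = 1 by rewrite cz /q mulrA -[y' * y * z]mulrA yz mulr1.
have cq : (1 - c) * q = 1 by rewrite cz /q mulrA -[z * _ * y']mulrA zy' mulr1.
have qs : staru q = q by apply: (inverse_star _ qc cq); rewrite staruB staru1 cs.
have qn : nrm (d%:C *: q) < 1.
  rewrite nrmZ cmod_real ger0_norm ?(ltW d0)//.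
  have : nrm q <= 2 * K.
    rewrite (le_trans (nrmM _ _))// ler_wpM2r// (le_trans ny')//.
    by rewrite (_ : 1 - 2^-1 = 2^-1) ?invrK//; lra.
  move=> qK; have : d * nrm q <= d * (2 * K) by rewrite ler_wpM2l ?(ltW d0).
  lra.
have [|v [vs v2 vcomm]] := sqrt_one_minus _ qn; first by rewrite staruZ conjc_real qs.
have bc : b * c = c * b by rewrite -scalerAl -scalerAr mulrA.
have comm_q w : w * c = c * w -> w * q = q * w.
  by move=> wc; apply: inverse_comm qc cq _; rewrite mulrBl mulrBr wc mul1r mulr1.
have comm_v w : w * c = c * w -> w * v = v * w.
  by move=> /comm_q wq; apply: vcomm; rewrite -scalerAl -scalerAr wq.
have sv : s * v = v * s by apply: comm_v; rewrite -scomm.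
have rs : staru (s * v) = s * v by rewrite staruM ss vs.
have r2 : (s * v) * (s * v) = 1 - c - d%:C%:A.
  have -> : (s * v) * (s * v) = (s * s) * (v * v).
    by rewrite -mulrA [v * (s * v)]mulrA -sv !mulrA.
  by rewrite s2 v2 mulrBr mulr1 -scalerAr cq.
have hs : staru ((Num.sqrt tau)%:C *: b) = (Num.sqrt tau)%:C *: b.
  by rewrite staruZ bs conjc_real.
have bsv : b * (s * v) = s * v * b by rewrite mulrA scomm// -mulrA comm_v// mulrA.
have := nrm_comm_le hs rs; rewrite -scalerAl -scalerAr bsv => /(_ erefl).
rewrite r2 -scalerAl -scalerAr scalerA -rmorphM/= -expr2 sqr_sqrtr// -/c.
rewrite addrA addrCA subrr addr0 (_ : 1 - _ = (1 - d)%:C%:A); last first.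
  by rewrite rmorphB/= scalerBl scale1r.
rewrite nrm_real nrmZ cmod_real nb mulr1 real_normK ?num_real// sqr_sqrtr//.
rewrite ger0_norm /tau; lra.
Qed.

End Invertibility.

(** * Spectra of self-adjoint elements *)

Section Spectrum.
Context {R : realType} {A : cstarAlgType R}.
Local Notation U := (unitization A).
Implicit Types (z w b : U) (r t : R) (p q : {poly R}).

Lemma not_invertible0 : ~ is_invertible (0 : U).
Proof. by move=> [y [/eqP]]; rewrite mulr0 eq_sym oner_eq0. Qed.

Definition peval p z : U := horner_alg z (map_poly (real_complex R) p).

Lemma pevalD p q z : peval (p + q) z = peval p z + peval q z.
Proof. by rewrite /peval !rmorphD. Qed.
Lemma pevalN p z : peval (- p) z = - peval p z.
Proof. by rewrite /peval !rmorphN. Qed.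
Lemma pevalM p q z : peval (p * q) z = peval p z * peval q z.
Proof. by rewrite /peval !rmorphM. Qed.
Lemma pevalC r z : peval r%:P z = r%:C%:A.
Proof. by rewrite /peval map_polyC horner_algC. Qed.
Lemma pevalX z : peval 'X z = z.
Proof. by rewrite /peval map_polyX horner_algX. Qed.

Lemma peval_comm p z w : w * z = z * w -> w * peval p z = peval p z * w.
Proof.
move=> wz; elim/poly_ind: p => [|p r IH]; first by rewrite /peval !rmorph0 mulr0 mul0r.
rewrite pevalD pevalM pevalX pevalC mulrDl mulrDr mulr_algr mulr_algl.
by rewrite mulrA IH -!mulrA wz.
Qed.

Lemma peval_star p z : staru z = z -> staru (peval p z) = peval p z.
Proof.
move=> zs; elim/poly_ind: p => [|p r IH]; first by rewrite /peval !rmorph0 staru0.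
rewrite pevalD pevalM pevalX pevalC staruD staruM staruZ staru1 zs IH conjc_real.
by rewrite peval_comm.
Qed.

(** Arens: [l - i b] has norm at most the square root of [l^2 + |b|^2], which
    is less than [1 + l] for large [l]. *)
Lemma invertible_1Di b : staru b = b -> is_invertible (1 + 'i *: b).
Proof.
move=> bs; pose l := nrm b ^+ 2; have l0 : 0 <= l by rewrite sqr_ge0.
have l1 : 0 < 1 + l by rewrite ltr_pwDl.
have k0 : (1 + l)^-1%:C != 0 :> R[i].
  by rewrite (inj_eq (@complexI R)) invr_eq0 gt_eqF.
apply/(invertible_scale _ k0)/neumann_invertible.
pose w : U := l%:C%:A - 'i *: b.
have -> : 1 - (1 + l)^-1%:C *: (1 + 'i *: b) = (1 + l)^-1%:C *: w.
  have -> : w = (1 + l)%:C%:A - (1 + 'i *: b).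
    by rewrite rmorphD scalerDl scale1r opprD addrACA subrr add0r.
  by rewrite scalerBr scalerA -rmorphM mulVf ?gt_eqF// scale1r.
rewrite nrmZ cmod_real ger0_norm ?invr_ge0 ?(ltW l1)// mulrC ltr_pdivrMr// mul1r.
rewrite -(@ltr_pXn2r _ 2%N) ?nnegrE ?nrm_ge0 ?(ltW l1)// -nrm_starM.
have -> : staru w * w = (l ^+ 2)%:C%:A + b * b.
  rewrite /w staruB !staruZ staru1 bs conjc_real mulrBl !mulrBr mulr_algl scalerA.
  rewrite -rmorphM/= -expr2 -!scalerAl -!scalerAr !mulr1 !mul1r !scalerA.
  have -> : Complex 0 (-1) = - 'i :> R[i] by simpc.
  rewrite !mulNr -!expr2 sqr_i !scaleNr opprK scale1r [l%:C * _]mulrC.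
  by rewrite opprD !opprK addrA subrK.
rewrite (le_lt_trans (nrmD _ _))// nrm_real nrm_sa// -/l ger0_norm ?sqr_ge0//; nra.
Qed.

(** The real part of the spectrum, which is all of it for a self-adjoint element
    by [spectrum_real]. *)
Definition spec z : set R := [set t | ~ is_invertible (z - t%:C%:A)].

Lemma spectrum_real z (k : R[i]) : staru z = z -> ~ is_invertible (z - k%:A) ->
  exists2 t, k = t%:C & spec z t.
Proof.
case: k => s u zs nk; have [u0|u0] := eqVneq u 0.
  by exists s; rewrite ?u0// /spec /=; move: nk; rewrite u0.
exfalso; apply: nk.
have k0 : - ('i * u%:C) != 0 :> R[i].
  by rewrite oppr_eq0 mulf_neq0 ?neq0Ci// (inj_eq (@complexI R)).
pose b := (u^-1)%:C *: (z - s%:C%:A).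
have -> : z - (Complex s u)%:A = (- ('i * u%:C)) *: (1 + 'i *: b).
  rewrite /b scalerDr !scalerA.
  have -> : - ('i * u%:C) * 'i * u^-1%:C = 1 :> R[i].
    by rewrite !mulNr [('i * u%:C) * 'i]mulrAC -expr2 sqr_i mulN1r mulNr opprK -rmorphM mulfV.
  rewrite scale1r [RHS]addrC -addrA; congr (_ + _); rewrite -scaleNr -scaleNr -scalerDl.
  by congr (_ *: _); simpc.
apply/invertible_scale/invertible_1Di => //.
by rewrite /b staruZ staruB staruZ staru1 zs !conjc_real.
Qed.

(** Over the complex numbers a polynomial splits into linear factors, and a
    product of invertible elements is invertible. *)
Lemma poly_spectrum z (q : {poly R[i]}) : q != 0 ->
  ~ is_invertible (horner_alg z q) ->
  exists2 k, root q k & ~ is_invertible (z - k%:A).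
Proof.
move=> q0 nq; apply: contrapT => nk; apply: nq.
have [s qs] := closed_field_poly_normal q.
have lq : lead_coef q != 0 by rewrite lead_coef_eq0.
rewrite qs linearZ/= mulr_algl; apply/invertible_scale => //.
have : forall k, k \in s -> root q k.
  by move=> k ks; rewrite qs rootZ// root_prod_XsubC.
elim: {qs} s => [_|k s IH sq]; first by rewrite big_nil rmorph1; exact: invertible1.
rewrite big_cons rmorphM; apply: invertibleM; last first.
  by apply: IH => l ls; apply: sq; rewrite inE ls orbT.
rewrite rmorphB/= horner_algX horner_algC.
by apply: contrapT => ni; apply: nk; exists k => //; apply: sq; rewrite mem_head.
Qed.

Lemma nrm_sq_spectrum b : staru b = b ->
  ~ is_invertible (b * b - (nrm b ^+ 2)%:C%:A).
Proof.
move=> bs; set r := nrm b; have [r0|r0] := eqVneq r 0.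
  by rewrite (nrm_eq0 r0) r0 expr0n/= mulr0 scale0r subrr; exact: not_invertible0.
have rp : 0 < r by rewrite lt_neqAle eq_sym r0 nrm_ge0.
pose c := (r^-1)%:C *: b.
have cs : staru c = c by rewrite staruZ bs conjc_real.
have nc : nrm c = 1 by rewrite nrmZ cmod_real ger0_norm ?invr_ge0 ?nrm_ge0// mulVf.
move=> inv; have := nrm_lt1 cs; rewrite nc lexx ltxx => /(_ isT) H.
suff /H : is_invertible (1 - c * c) by [].
have -> : 1 - c * c = (- (r ^- 2))%:C *: (b * b - (r ^+ 2)%:C%:A).
  rewrite scalerBr scalerA -rmorphM mulNr mulVf ?expf_neq0// rmorphN rmorph1.
  rewrite scaleN1r opprK addrC; congr (_ + _).
  by rewrite /c -scalerAl -scalerAr scalerA -rmorphM -expr2 exprVn rmorphN scaleNr.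
apply/invertible_scale => //.
by rewrite (inj_eq (@complexI R)) oppr_eq0 invr_eq0 expf_neq0.
Qed.

Lemma spec_attains_nonconst p z : staru z = z ->
  p * p - (nrm (peval p z) ^+ 2)%:P != 0 ->
  exists2 t, spec z t & `|p.[t]| = nrm (peval p z).
Proof.
move=> zs; set r := nrm (peval p z) => q0.
have [||k] := @poly_spectrum z (map_poly (real_complex R) (p * p - (r ^+ 2)%:P)).
- by rewrite map_poly_eq0.
- rewrite -/(peval _ _) pevalD pevalN pevalM pevalC.
  exact/nrm_sq_spectrum/peval_star.
move=> + /(spectrum_real zs)[t kt zt]; rewrite kt fmorph_root => tr.
exists t => //; apply/eqP; rewrite -(@eqrXn2 _ 2%N) ?nrm_ge0// real_normK ?num_real//.
by move: tr; rewrite /root !hornerE subr_eq0 expr2.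
Qed.

Lemma spec_nonempty z : staru z = z -> exists t, spec z t.
Proof.
move=> zs; have [|t zt _] := @spec_attains_nonconst 'X z zs; last by exists t.
rewrite -size_poly_gt0 -expr2 size_addl ?size_polyXn// size_opp size_polyC.
by case: (_ != 0).
Qed.

(** With [r] the norm of [p(z)], the element [p(z)^2 - r^2] is not invertible,
    so some root of [p^2 - r^2] belongs to the spectrum of [z], hence is real.
    When [p^2 - r^2] is the zero polynomial, any spectral value will do. *)
Theorem nrm_peval_attained p z : staru z = z ->
  exists2 t, spec z t & `|p.[t]| = nrm (peval p z).
Proof.
move=> zs; have [|q0] := eqVneq (p * p - (nrm (peval p z) ^+ 2)%:P) 0; last first.
  exact: spec_attains_nonconst.
move=> /eqP; rewrite subr_eq0 => /eqP pE; have [t zt] := spec_nonempty zs.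
exists t => //; apply/eqP; rewrite -(@eqrXn2 _ 2%N) ?nrm_ge0// real_normK ?num_real//.
by rewrite expr2 -hornerM pE hornerC.
Qed.

Lemma spec_bound z t : spec z t -> `|t| <= nrm z.
Proof.
move=> zt; rewrite leNgt; apply/negP => nt; apply: zt.
have t0 : t != 0 by rewrite -normr_gt0 (le_lt_trans (nrm_ge0 z)).
have k0 : (- t^-1)%:C != 0 :> R[i] by rewrite (inj_eq (@complexI R)) oppr_eq0 invr_eq0.
apply/(invertible_scale _ k0)/neumann_invertible.
have -> : 1 - (- t^-1)%:C *: (z - t%:C%:A) = (t^-1)%:C *: z.
  rewrite scalerBr scalerA -rmorphM mulNr mulVf// rmorphN rmorph1 scaleN1r opprK.
  by rewrite opprD addrCA subrr addr0 rmorphN scaleNr opprK.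
by rewrite nrmZ cmod_real normfV mulrC ltr_pdivrMr ?normr_gt0// mul1r.
Qed.

Lemma spec_shift z r t : spec (z + r%:C%:A) t <-> spec z (t - r).
Proof.
by rewrite /spec /= rmorphB/= scalerBl opprB addrA.
Qed.

End Spectrum.

(** * The Weierstrass approximation theorem *)

Section Weierstrass.
Context {R : realType}.
Implicit Types (phi : nat -> R) (x c e M : R).

(** The Bernstein operator, without binomial coefficients: [bernstein n phi]
    evaluated at [x] is the expectation of [phi] at the number of successes in
    [n] independent trials of probability [x]. *)
Fixpoint bernstein n phi : {poly R} :=
  if n is m.+1
  then (1 - 'X) * bernstein m phi + 'X * bernstein m (fun k => phi k.+1)
  else (phi 0%N)%:P.

(** The right-hand side is [a] plus [b] times the mean square distance to [c] of
    a binomial variable; the induction conditions on the first trial. *)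
Lemma bernstein_bound n phi (v a b c x : R) : 0 <= x <= 1 ->
  (forall k, (k <= n)%N -> `|phi k - v| <= a + b * (k%:R - c) ^+ 2) ->
  `|(bernstein n phi).[x] - v|
    <= a + b * (n%:R * x * (1 - x) + (n%:R * x - c) ^+ 2).
Proof.
move=> /andP[x0 x1]; elim: n phi c => [|n IH] phi c phiv /=.
  by have := phiv 0%N isT; rewrite hornerC !mul0r !add0r.
rewrite !hornerE.
have h1 := IH phi c (fun k kn => phiv k (leqW kn)).
have h2 : `|(bernstein n (fun k => phi k.+1)).[x] - v| <=
    a + b * (n%:R * x * (1 - x) + (n%:R * x - (c - 1)) ^+ 2).
  apply: IH => k kn; rewrite (_ : k%:R - (c - 1) = k.+1%:R - c); first exact: phiv.
  by rewrite -natr1; ring.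
set u := (bernstein n phi).[x] in h1 *.
set w := (bernstein n _).[x] in h2 *.
have -> : (1 - x) * u + x * w - v = (1 - x) * (u - v) + x * (w - v) by ring.
rewrite (le_trans (ler_normD _ _))// !normrM (ger0_norm x0).
rewrite (@ger0_norm _ (1 - x)) ?subr_ge0//.
rewrite (le_trans (lerD (ler_wpM2l _ h1) (ler_wpM2l x0 h2))) ?subr_ge0//.
by rewrite le_eqVlt; apply/orP; left; apply/eqP; rewrite -natr1; ring.
Qed.

Lemma continuous_bounded (f : R -> R) M : continuous f ->
  exists B, forall x, `|x| <= M -> `|f x| <= B.
Proof.
move=> fc; have [M0|M0] := ltP M 0.
  by exists 0 => x xM; have := normr_ge0 x; lra.
have [||c cM fcM] := @EVT_max R (fun x => `|f x|) (- M) M; first lra.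
  by apply: continuous_subspaceT => x; apply: cvg_norm; exact: fc.
by exists `|f c| => x xM; apply: fcM; rewrite in_itv/= -ler_norml.
Qed.

(** Uniform continuity in the form that a second moment estimate can use: for
    distant points [K] absorbs the bound of [f], and compactness makes [K] uniform. *)
Lemma continuous_quadratic_modulus (f : R -> R) M e : continuous f -> 0 <= M -> 0 < e ->
  exists2 K : R, 0 <= K & forall x y, `|x| <= M -> `|y| <= M ->
    `|f y - f x| <= e + K * (y - x) ^+ 2.
Proof.
move=> fc M0 e0.
have [B fB] := continuous_bounded M fc.
have /compact_near_coveringP cov := @segment_compact R (- M) M.
pose P (K x : R) := forall y, `|y| <= M -> `|f y - f x| <= e + K * (y - x) ^+ 2.
have [] := cov R (pinfty_nbhs R) P _ _.
  move=> x0; rewrite /= in_itv/= -ler_norml => x0M.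
  have /cvgrPdist_lt/(_ (e / 2)) := fc x0; rewrite divr_gt0// => /(_ isT).
  move=> /nbhs_ballP[d /= d0 dP].
  have d2 : 0 < d / 2 by rewrite divr_gt0.
  exists (ball x0 (d / 2), [set K | (B + B + e) / (d / 2) ^+ 2 < K]).
    by split; [exact: nbhsx_ballx | apply: nbhs_pinfty_gt; exact: num_real].
  move=> [x K] /= [xx0 BK] y yM.
  have fx : `|f x0 - f x| < e / 2.
    by apply: dP; apply: le_ball xx0; lra.
  have Be : 0 <= B + B + e.
    by have := fB _ yM; have := normr_ge0 (f y); lra.
  have K0 : 0 <= K by rewrite (le_trans _ (ltW BK))// divr_ge0// sqr_ge0.
  have [yx0|yx0] := ltP `|x0 - y| d.
    have fy : `|f x0 - f y| < e / 2 by apply: dP.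
    have -> : f y - f x = (f x0 - f x) - (f x0 - f y) by ring.
    rewrite (le_trans (ler_normB _ _))//.
    by have := mulr_ge0 K0 (sqr_ge0 (y - x)); lra.
  have dyx : d / 2 <= `|y - x|.
    have := ler_normB (x0 - x) (y - x).
    rewrite (_ : x0 - x - (y - x) = x0 - y); last by ring.
    by move: xx0; rewrite /ball/=; lra.
  have : (B + B + e) <= K * (y - x) ^+ 2.
    rewrite -real_normK ?num_real//.
    apply: (@le_trans _ _ (K * (d / 2) ^+ 2)).
      by rewrite -ler_pdivrMr ?exprn_gt0// ltW.
    by rewrite ler_wpM2l// ler_pXn2r ?nnegrE ?(ltW d2).
  have -> : f y - f x = (f x0 - f x) + f y - f x0 by ring.
  have := ler_normB (f x0 - f x + f y) (f x0); have := ler_normD (f x0 - f x) (f y).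
  have := fB _ yM; have := fB _ x0M; lra.
move=> K0 [_ KP]; pose K := Num.max 0 (K0 + 1).
exists K; first by rewrite le_max lexx.
move=> x y xM yM; apply: (KP K).
- by rewrite lt_max ltrDl ltr01 orbT.
- by rewrite /= in_itv/= -ler_norml.
- by [].
Qed.

Theorem weierstrass (f : R -> R) M e : continuous f -> 0 < e ->
  exists p : {poly R}, forall t, `|t| <= M -> `|p.[t] - f t| < e.
Proof.
move=> fc e0; have [M0|M0] := ltP M 0.
  by exists 0 => t tM; have := normr_ge0 t; lra.
have [L L0 ML] : exists2 L, 0 < L & M <= L by exists (M + 1); lra.
have [||K K0 fK] := @continuous_quadratic_modulus f L (e / 2) fc; [lra | lra |].
have [n n0 ne] : exists2 n : nat, 0 < n%:R :> R & K * (2 * L) ^+ 2 / n%:R < e / 2.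
  exists (Num.truncn (2 * (K * (2 * L) ^+ 2) / e)).+1; first by rewrite ltr0n.
  have : 2 * (K * (2 * L) ^+ 2) / e < (Num.truncn (2 * (K * (2 * L) ^+ 2) / e)).+1%:R.
    by rewrite real_truncnS_gt// num_real.
  by rewrite ltr_pdivrMr// ltr_pdivrMr ?ltr0n//; lra.
pose phi k : R := f (- L + 2 * L * (k%:R / n%:R)).
exists (bernstein n phi \Po ((2 * L)^-1 *: ('X + L%:P))) => t tM.
rewrite horner_comp !hornerE; set x := (2 * L)^-1 * (t + L).
move: tM; rewrite ler_norml => /andP[Mt tM].
have x01 : 0 <= x <= 1.
  rewrite /x mulr_ge0 ?invr_ge0 ?mulr_ge0//=; [|lra..].
  rewrite mulrC ler_pdivrMr; lra.
have tE : t = - L + 2 * L * x by rewrite /x mulrA mulfV ?mul1r; lra.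
have phit k : (k <= n)%N ->
    `|phi k - f t| <= e / 2 + K * (2 * L / n%:R) ^+ 2 * (k%:R - n%:R * x) ^+ 2.
  move=> kn; have k01 : 0 <= (k%:R / n%:R : R) <= 1.
    by rewrite divr_ge0//= ler_pdivrMr// mul1r ler_nat.
  have -> : K * (2 * L / n%:R) ^+ 2 * (k%:R - n%:R * x) ^+ 2 =
      K * (- L + 2 * L * (k%:R / n%:R) - t) ^+ 2.
    by rewrite tE; field; rewrite gt_eqF.
  apply: fK; first by rewrite ler_norml; lra.
  by move: k01 => /andP[k0 k1]; rewrite ler_norml; nra.
have := bernstein_bound x01 phit; rewrite subrr expr0n addr0.
have -> : K * (2 * L / n%:R) ^+ 2 * (n%:R * x * (1 - x)) =
    K * (2 * L) ^+ 2 / n%:R * (x * (1 - x)) by field; rewrite gt_eqF.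
have KL : 0 <= K * (2 * L) ^+ 2 / n%:R.
  by rewrite divr_ge0 ?ler0n// mulr_ge0// sqr_ge0.
have xx : x * (1 - x) <= 1 by move: x01 => /andP[? ?]; nra.
move=> h; apply: (le_lt_trans h).
by have := ler_wpM2l KL xx; rewrite mulr1; lra.
Qed.

End Weierstrass.

(** * Continuous functional calculus *)

Section RealFunctions.
Context {R : realType}.
Implicit Types (f g : R -> R).

Lemma fcont_id : continuous (fun t : R => t).
Proof. by move=> t; exact: cvg_id. Qed.

Lemma fcont_cst (r : R) : continuous (fun t : R => r).
Proof. by move=> t; exact: cvg_cst. Qed.

Lemma fcontD f g : continuous f -> continuous g -> continuous (fun t => f t + g t).
Proof. by move=> fc gc t; apply: cvgD; [exact: fc|exact: gc]. Qed.

Lemma fcontN f : continuous f -> continuous (fun t => - f t).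
Proof. by move=> fc t; apply: cvgN; exact: fc. Qed.

Lemma fcontM f g : continuous f -> continuous g -> continuous (fun t => f t * g t).
Proof. by move=> fc gc t; apply: cvgM; [exact: fc|exact: gc]. Qed.

Lemma fcontV f : continuous f -> (forall t, f t != 0) -> continuous (fun t => (f t)^-1).
Proof. by move=> fc f0 t; apply: cvgV; [exact: f0|exact: fc]. Qed.

Lemma fcont_max f g : continuous f -> continuous g ->
  continuous (fun t => Num.max (f t) (g t)).
Proof. by move=> fc gc t; apply: continuous_max; [exact: fc|exact: gc]. Qed.

Lemma fcont_norm f : continuous f -> continuous (fun t => `|f t|).
Proof. by move=> fc t; apply: cvg_norm; exact: fc. Qed.

Lemma fcont_sqrt f : continuous f -> continuous (fun t => Num.sqrt (f t)).
Proof. by move=> fc t; apply: continuous_comp; [exact: fc|exact: sqrt_continuous]. Qed.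

End RealFunctions.

Ltac fcont := repeat lazymatch goal with
  | |- continuous (fun t => t) => exact: fcont_id
  | |- continuous (fun _ => ?r) => exact: fcont_cst
  | |- continuous (fun t => (@?f t + @?g t)%R) => apply: fcontD
  | |- continuous (fun t => (@?f t * @?g t)%R) => apply: fcontM
  | |- continuous (fun t => (- @?f t)%R) => apply: fcontN
  | |- continuous (fun t => Num.max (@?f t) (@?g t)) => apply: fcont_max
  | |- continuous (fun t => `|@?f t|%R) => apply: fcont_norm
  | |- continuous (fun t => Num.sqrt (@?f t)) => apply: fcont_sqrt
  | |- continuous _ => first [ assumption | exact: fcont_id | exact: norm_continuous
      | exact: opp_continuous | move=> ?; apply: cvgM; [exact: cvg_cst|exact: cvg_id] ]
  end.

Section FunctionalCalculus.
Context {R : realType} {A : cstarAlgType R}.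
Local Notation U := (unitization A).
Implicit Types (z w d : U) (r t e : R) (p q : {poly R}) (f g : R -> R).

(** The value of [f] at [z], characterized by sup-norm estimates on the spectrum. *)
Definition represents f z : set U := [set d | forall p e,
  (forall t, spec z t -> `|p.[t] - f t| <= e) -> nrm (peval p z - d) <= e].

Definition fc f z : U := xget 0 (represents f z).

Lemma nrm_peval_le p z e : staru z = z -> (forall t, spec z t -> `|p.[t]| <= e) ->
  nrm (peval p z) <= e.
Proof. by move=> /(nrm_peval_attained p)[t zt <-]; exact. Qed.

Lemma nrm_pevalB_le p q z e : staru z = z ->
  (forall t, spec z t -> `|p.[t] - q.[t]| <= e) -> nrm (peval p z - peval q z) <= e.
Proof.
move=> zs pq; rewrite -pevalN -pevalD; apply: nrm_peval_le => // t zt.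
by rewrite !hornerE pq.
Qed.

(** Weierstrass polynomials for [f] give a Cauchy sequence by [nrm_peval_attained],
    and its limit represents [f]. *)
Lemma nrm_peval_fc f z p e : continuous f -> staru z = z ->
  (forall t, spec z t -> `|p.[t] - f t| <= e) -> nrm (peval p z - fc f z) <= e.
Proof.
move=> fcont zs; move: p e.
suff exd : exists d, represents f z d by exact: (xgetPex 0 exd).
have i0 n : 0 < n.+1%:R^-1 :> R by rewrite invr_gt0.
have /choice[q qf] n := @weierstrass R f (nrm z) _ fcont (i0 n).
have qf' n t : spec z t -> `|(q n).[t] - f t| <= n.+1%:R^-1.
  by move=> /spec_bound zt; exact/ltW/qf.
have small e : 0 < e -> exists n, n.+1%:R^-1 < e :> R.
  by move=> e0; have [n] := ltr_add_invr e0; rewrite add0r; exists n.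
have le_inv n m : (n <= m)%N -> m.+1%:R^-1 <= n.+1%:R^-1 :> R.
  by move=> nm; rewrite lef_pV2 ?posrE// ler_nat ltnS.
have [e e0|d qd] := @nrm_complete _ _ (fun n => peval (q n) z).
  have [n ne] := small (e / 2) ltac:(lra); exists n => m nm.
  apply: (@le_lt_trans _ _ (n.+1%:R^-1 + n.+1%:R^-1)); last first.
    by move: ne; set x := _^-1 => ne; lra.
  apply: nrm_pevalB_le => // t zt.
  rewrite -(subrKA (f t)) (le_trans (ler_normD _ _))// lerD ?qf'// distrC.
  exact: le_trans (qf' m t zt) (le_inv _ _ nm).
exists d => p e pf; apply/ler_addgt0Pr => r r0.
have [n nr] := small (r / 2) ltac:(lra).
have r2 : 0 < r / 2 by lra.
have [m [/= mn md]] := filter_ex (filterI (nbhs_infty_ge n) (qd _ r2)).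
rewrite -(subrKA (peval (q m) z)) (le_trans (nrmD _ _))//.
have : nrm (peval p z - peval (q m) z) <= e + m.+1%:R^-1.
  apply: nrm_pevalB_le => // t zt.
  by rewrite -(subrKA (f t)) (le_trans (ler_normD _ _))// lerD ?pf// distrC qf'.
move: nr (le_inv _ _ mn) md; set x := n.+1%:R^-1; set y := m.+1%:R^-1; lra.
Qed.

Lemma fc_approx f z e : continuous f -> staru z = z -> 0 < e ->
  exists p, (forall t, `|t| <= nrm z -> `|p.[t] - f t| < e) /\
    nrm (peval p z - fc f z) <= e.
Proof.
move=> fcont zs e0; have [p pf] := weierstrass (nrm z) fcont e0.
exists p; split => //; apply: nrm_peval_fc => // t /spec_bound zt; exact/ltW/pf.
Qed.

Lemma fc_unique f z d : continuous f -> staru z = z ->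
  (forall e, 0 < e -> exists p, (forall t, spec z t -> `|p.[t] - f t| <= e) /\
    nrm (peval p z - d) <= e) -> fc f z = d.
Proof.
move=> fcont zs dP; apply/eqP; rewrite -subr_eq0; apply/eqP/nrm_eq0/eqP.
rewrite eq_le nrm_ge0 andbT; apply/ler_addgt0Pr => e e0; rewrite add0r.
have [|p [pf pd]] := dP (e / 2); first lra.
have := nrm_peval_fc fcont zs pf; rewrite nrmB => pf'.
by rewrite -(subrKA (peval p z)) (le_trans (nrmD _ _))//; lra.
Qed.

Lemma fc_poly p z : staru z = z -> fc (fun t => p.[t]) z = peval p z.
Proof.
move=> zs; apply: fc_unique => // [|e e0]; first exact: continuous_horner.
exists p; split=> [t _|]; rewrite subrr ?normr0 ?nrm0 ltW//.
Qed.

Lemma fc_id z : staru z = z -> fc (fun t => t) z = z.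
Proof.
move=> zs; rewrite -[RHS]pevalX -fc_poly//; congr fc.
by apply/funext => t; rewrite hornerX.
Qed.

Lemma fc_cst r z : staru z = z -> fc (fun=> r) z = r%:C%:A.
Proof.
move=> zs; rewrite -(pevalC r z) -fc_poly//; congr fc.
by apply/funext => t; rewrite hornerC.
Qed.

Lemma fc_ext f g z : continuous f -> continuous g -> staru z = z ->
  (forall t, spec z t -> f t = g t) -> fc f z = fc g z.
Proof.
move=> fcont gcont zs fg; apply: fc_unique => // e e0.
have [p [pg pd]] := fc_approx gcont zs e0; exists p; split => // t zt.
by rewrite fg//; apply/ltW/pg/spec_bound.
Qed.

Lemma nrm_fc_le f z r : continuous f -> staru z = z ->
  (forall t, spec z t -> `|f t| <= r) -> nrm (fc f z) <= r.
Proof.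
move=> fcont zs fr; apply/ler_addgt0Pr => e e0.
have [|p [pf pd]] := fc_approx fcont zs (e := e / 2); first lra.
rewrite nrmB in pd; rewrite -[fc f z](subrK (peval p z)) (le_trans (nrmD _ _))//.
have : nrm (peval p z) <= r + e / 2; last lra.
apply: nrm_peval_le => // t zt; rewrite -[p.[t]](subrK (f t)).
rewrite (le_trans (ler_normD _ _))//.
by have := pf t (spec_bound zt); have := fr t zt; lra.
Qed.

Lemma fcD f g z : continuous f -> continuous g -> staru z = z ->
  fc (fun t => f t + g t) z = fc f z + fc g z.
Proof.
move=> fcont gcont zs; apply: fc_unique => // [t|e e0].
  by apply: cvgD; [exact: fcont | exact: gcont].
have e2 : 0 < e / 2 by lra.
have [p [pf pF]] := fc_approx fcont zs e2.
have [q [qg qG]] := fc_approx gcont zs e2.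
exists (p + q); split=> [t /spec_bound zt|].
  rewrite hornerD opprD addrACA (le_trans (ler_normD _ _))//.
  by have := pf t zt; have := qg t zt; lra.
by rewrite pevalD opprD addrACA (le_trans (nrmD _ _))//; lra.
Qed.

Lemma fcB f g z : continuous f -> continuous g -> staru z = z ->
  fc (fun t => f t - g t) z = fc f z - fc g z.
Proof.
move=> fcont gcont zs; apply/eqP; rewrite eq_sym subr_eq -fcD//.
  by apply/eqP; congr fc; apply/funext => t; rewrite subrK.
by apply: fcontD => //; exact: fcontN.
Qed.

Lemma fcM f g z : continuous f -> continuous g -> staru z = z ->
  fc (fun t => f t * g t) z = fc f z * fc g z.
Proof.
move=> fcont gcont zs; apply: fc_unique => // [t|e e0].
  by apply: cvgM; [exact: fcont | exact: gcont].
have [Bf fB] := continuous_bounded (nrm z) fcont.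
have [Bg gB] := continuous_bounded (nrm z) gcont.
pose B := `|Bf| + `|Bg| + nrm (fc f z) + nrm (fc g z).
have [nf ng] := (nrm_ge0 (fc f z), nrm_ge0 (fc g z)).
have [bf bg] := (normr_ge0 Bf, normr_ge0 Bg).
have B0 : 0 <= B by rewrite /B; lra.
pose d := Num.min 1 (e / (2 * B + 1)).
have d0 : 0 < d by rewrite lt_min ltr01 divr_gt0//; lra.
have d1 : d <= 1 by rewrite ge_min lexx.
have dB : d * (2 * B + 1) <= e.
  by rewrite -ler_pdivlMr ?ge_min ?lexx ?orbT//; lra.
have [p [pf pF]] := fc_approx fcont zs d0.
have [q [qg qG]] := fc_approx gcont zs d0.
exists (p * q); split=> [t /spec_bound zt|].
  rewrite hornerM; have -> : p.[t] * q.[t] - f t * g t =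
    (p.[t] - f t) * (q.[t] - g t) + ((p.[t] - f t) * g t + f t * (q.[t] - g t)) by ring.
  apply: le_trans dB; rewrite (le_trans (ler_normD _ _))//.
  have fb : `|f t| <= B by have := fB _ zt; have := ler_norm Bf; rewrite /B; lra.
  have gb : `|g t| <= B by have := gB _ zt; have := ler_norm Bg; rewrite /B; lra.
  have := ler_normD ((p.[t] - f t) * g t) (f t * (q.[t] - g t)); rewrite !normrM.
  have h1 : `|p.[t] - f t| * `|g t| <= d * B by rewrite ler_pM// ltW// pf.
  have h2 : `|f t| * `|q.[t] - g t| <= B * d by rewrite ler_pM// ltW// qg.
  have h3 : `|p.[t] - f t| * `|q.[t] - g t| <= d * 1.
    by rewrite ler_pM// ?(ltW (pf _ zt))// (le_trans (ltW (qg _ zt))).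
  lra.
rewrite pevalM; have -> : peval p z * peval q z - fc f z * fc g z =
    (peval p z - fc f z) * (peval q z - fc g z) +
    ((peval p z - fc f z) * fc g z + fc f z * (peval q z - fc g z)).
  by rewrite addrA -mulrDr subrK mulrBl mulrBr addrA subrK.
apply: le_trans dB; rewrite (le_trans (nrmD _ _))//.
have h1 : nrm ((peval p z - fc f z) * fc g z) <= d * B.
  by rewrite (le_trans (nrmM _ _))// ler_pM ?nrm_ge0// /B; lra.
have h2 : nrm (fc f z * (peval q z - fc g z)) <= B * d.
  by rewrite (le_trans (nrmM _ _))// ler_pM ?nrm_ge0// /B; lra.
have h3 : nrm ((peval p z - fc f z) * (peval q z - fc g z)) <= d * 1.
  by rewrite (le_trans (nrmM _ _))// ler_pM ?nrm_ge0// (le_trans qG).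
have := nrmD ((peval p z - fc f z) * fc g z) (fc f z * (peval q z - fc g z)); lra.
Qed.

Lemma fc_star f z : continuous f -> staru z = z -> staru (fc f z) = fc f z.
Proof.
move=> fcont zs; apply/esym/fc_unique => // e e0.
have [p [pf pF]] := fc_approx fcont zs e0; exists p; split=> [t /spec_bound/pf/ltW//|].
by rewrite -[peval p z]peval_star// -staruB nrm_star.
Qed.

Lemma fc_comm f z w : continuous f -> staru z = z -> w * z = z * w ->
  w * fc f z = fc f z * w.
Proof.
move=> fcont zs wz; apply/eqP; rewrite -subr_eq0; apply/eqP/nrm_eq0/eqP.
rewrite eq_le nrm_ge0 andbT; apply/ler_addgt0Pr => e e0; rewrite add0r.
have [|p [_ pF]] := fc_approx fcont zs (e := e / (2 * (nrm w + 1))).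
  by rewrite divr_gt0// mulr_gt0// ltr_wpDl ?nrm_ge0.
rewrite nrmB in pF.
have -> : w * fc f z - fc f z * w = w * (fc f z - peval p z) - (fc f z - peval p z) * w.
  by rewrite mulrBr mulrBl (peval_comm _ wz) opprB addrA subrK.
rewrite (le_trans (nrmD _ _))// nrmN.
set D := _ - _ in pF *; have nD := nrm_ge0 D; have nw := nrm_ge0 w.
have : nrm D * (nrm w + 1) <= e / 2.
  by rewrite -ler_pdivlMr ?ltr_wpDl// -mulrA -invfM.
have := nrmM w D; have := nrmM D w; nra.
Qed.

(** The scalar part is a character of the unitization. *)
Lemma uscal_peval p z r : uscal z = r%:C -> uscal (peval p z) = p.[r]%:C.
Proof.
move=> zr; elim/poly_ind: p => [|p s IH]; first by rewrite /peval rmorph0 rmorph0 horner0.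
rewrite pevalD pevalM pevalX pevalC hornerMXaddC rmorphD rmorphM/= -IH -zr.
by rewrite mulr1.
Qed.

Lemma uscal_spec z r : uscal z = r%:C -> spec z r.
Proof.
move=> zr [y [/(congr1 (@uscal R A))/=]]; rewrite zr mulr1 subrr mulr0 => /eqP.
by rewrite eq_sym oner_eq0.
Qed.

Lemma uscal_fc f z r : continuous f -> staru z = z -> uscal z = r%:C ->
  uscal (fc f z) = (f r)%:C.
Proof.
move=> fcont zs zr; apply/eqP; rewrite -subr_eq0; apply/eqP/cmod_eq0/eqP.
rewrite eq_le cmod_ge0 andbT; apply/ler_addgt0Pr => e e0; rewrite add0r.
have [|p [pf pF]] := fc_approx fcont zs (e := e / 2); first lra.
rewrite -(subrKA (p.[r]%:C)) (le_trans (cmodD _ _))// -rmorphB cmod_real.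
have := pf r (spec_bound (uscal_spec zr)).
have : cmod (uscal (fc f z) - p.[r]%:C) <= e / 2; last lra.
by rewrite -(uscal_peval p zr) (le_trans _ pF)// nrmB (le_trans _ (nrm_scal _)).
Qed.

End FunctionalCalculus.

(** * Positive elements *)

Section Positivity.
Context {R : realType} {A : cstarAlgType R}.
Local Notation U := (unitization A).
Implicit Types (a : A) (x y z w u v s : U) (r t e M : R) (p q : {poly R}) (f g : R -> R).

Lemma inu_polyval p a : p.[0] = 0 -> inu (polyval p a) = peval p (inu a).
Proof.
move=> p0; rewrite inuK//; have := uscal_peval p (z := inu a) (r := 0) erefl.
by rewrite p0.
Qed.

Lemma inu_sa a : selfadjoint a -> staru (inu a) = inu a.
Proof. by move=> a_sa; rewrite inu_star a_sa. Qed.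

(** The calculus of [A] uses polynomials without constant term. Since [f 0 = 0],
    a Weierstrass polynomial may be corrected by its small value at [0]. *)
Lemma inu_fcalc f a : continuous f -> f 0 = 0 -> selfadjoint a ->
  inu (fcalc f a) = fc f (inu a).
Proof.
move=> fcont f0 /inu_sa a_sa.
have inu_fc : inu (upart (fc f (inu a))) = fc f (inu a).
  by rewrite inuK// (uscal_fc (r := 0))// f0.
have exd : is_fcalc f a (upart (fc f (inu a))).
  move=> e e0; exists (e / 2) => [|p p0 pf]; first lra.
  rewrite -nrm_inu inuB inu_fc inu_polyval//.
  have : nrm (peval p (inu a) - fc f (inu a)) <= e / 2; last lra.
  by apply: nrm_peval_fc => // t at'; exact/ltW/pf.
apply/esym/fc_unique => // e e0.
have [d d0 dP] := xgetPex (P := [set d : A | is_fcalc f a d]) 0 (ex_intro _ _ exd) _ e0.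
have m0 : 0 < Num.min d e / 2 by rewrite divr_gt0// lt_min d0.
have [p pf] := weierstrass (nrm (inu a)) fcont m0.
have p0f := pf 0; rewrite normr0 nrm_ge0 f0 subr0 in p0f.
have {}p0f := p0f isT.
have md : Num.min d e <= d by rewrite ge_min lexx.
have me : Num.min d e <= e by rewrite ge_min lexx orbT.
have qf t : spec (inu a) t -> `|(p - p.[0]%:P).[t] - f t| < Num.min d e.
  move=> /spec_bound/pf; rewrite !hornerE => pt; rewrite addrAC.
  by rewrite (le_lt_trans (ler_normB _ _))//; lra.
have q0 : (p - p.[0]%:P).[0] = 0 by rewrite !hornerE subrr.
exists (p - p.[0]%:P); split=> [t /qf qt|]; first by rewrite (le_trans (ltW qt)).
rewrite -inu_polyval// -inuB nrm_inu; apply/ltW/dP => // t /qf qt.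
exact: lt_le_trans qt md.
Qed.

Definition pos z := staru z = z /\ (forall t, spec z t -> 0 <= t).

Lemma specN z t : spec (- z) t -> spec z (- t).
Proof.
move=> zt zi; apply: zt; have N1 : (-1 : R[i]) != 0 by rewrite oppr_eq0 oner_eq0.
have -> : - z - t%:C%:A = (-1) *: (z - (- t)%:C%:A).
  by rewrite scaleN1r opprB rmorphN scaleNr addrC.
exact/invertible_scale.
Qed.

Lemma spec_scal_sub z r t : spec (r%:C%:A - z) t -> spec z (r - t).
Proof.
rewrite addrC => zt; have -> : r - t = - (t - r) by rewrite opprB.
exact/specN/spec_shift.
Qed.

Lemma scal_sub_spec z r t : spec z t -> spec (r%:C%:A - z) (r - t).
Proof.
by move=> zt; apply: spec_scal_sub; rewrite subKr.
Qed.

Lemma sa_scal r : staru (r%:C%:A : U) = r%:C%:A.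
Proof. by rewrite staruZ staru1 conjc_real. Qed.

Lemma iscale_sq w : ('i *: w) * ('i *: w) = - (w * w).
Proof. by rewrite -scalerAl -scalerAr scalerA -expr2 sqr_i scaleN1r. Qed.

(** For [t = - r^2 < 0], [s^2 - t = r^2 (1 + i b) (1 - i b)] with [b = s / r]. *)
Lemma pos_sq s : staru s = s -> pos (s * s).
Proof.
move=> ss; split; first by rewrite staruM ss.
move=> t st; rewrite leNgt; apply/negP => t0; apply: st.
have r0 : 0 < Num.sqrt (- t) by rewrite sqrtr_gt0 oppr_gt0.
set r := Num.sqrt (- t) in r0; pose b := (r^-1)%:C *: s.
have bs : staru b = b by rewrite staruZ ss conjc_real.
have r2 : r ^+ 2 = - t by rewrite sqr_sqrtr// oppr_ge0 ltW.
have wE : (1 + 'i *: b) * (1 + 'i *: (- b)) = 1 + b * b.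
  by rewrite scalerN mulrBr mulr1 mulrDl mul1r iscale_sq opprD addrA addrK opprK.
have -> : s * s - t%:C%:A = (r ^+ 2)%:C *: ((1 + 'i *: b) * (1 + 'i *: (- b))).
  have bb : (r ^+ 2)%:C *: (b * b) = s * s.
    rewrite /b -scalerAl -scalerAr !scalerA -!rmorphM (_ : _ * _ = 1) ?scale1r//.
    by field; rewrite gt_eqF.
  by rewrite wE scalerDr bb r2 rmorphN scaleNr addrC.
apply/invertible_scale; first by rewrite (inj_eq (@complexI R)) expf_neq0// gt_eqF.
by apply: invertibleM; apply: invertible_1Di; rewrite ?staruN bs.
Qed.

Lemma spec_peval z p t : spec z t -> spec (peval p z) p.[t].
Proof.
move=> zt pi; apply: zt.
have /factor_theorem[q pq] : root (p - p.[t]%:P) t by rewrite /root !hornerE subrr.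
have qE : peval p z - p.[t]%:C%:A = (z - t%:C%:A) * peval q z.
  have <- : peval ('X - t%:P) z = z - t%:C%:A by rewrite pevalD pevalN pevalX pevalC.
  by rewrite -pevalM mulrC -pq pevalD pevalN pevalC.
apply: (@invertible_comm _ _ _ (peval q z)); last by rewrite -qE.
by apply: peval_comm; rewrite mulrBl mulrBr mulr_algl mulr_algr.
Qed.

Lemma spec_fc_le f z t : continuous f -> staru z = z -> spec z t ->
  `|f t| <= nrm (fc f z).
Proof.
move=> fcont zs zt; apply/ler_addgt0Pr => e e0.
have [|p [pf pF]] := fc_approx fcont zs (e := e / 2); first lra.
have := spec_bound (spec_peval (p := p) zt); have := pf t (spec_bound zt).
have := ler_normD (f t - p.[t]) p.[t]; rewrite subrK distrC.
by have := nrmD (peval p z - fc f z) (fc f z); rewrite subrK; lra.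
Qed.

Lemma pos_fc f z : continuous f -> staru z = z -> (forall t, spec z t -> 0 <= f t) ->
  pos (fc f z).
Proof.
move=> fcont zs f0; pose g t := Num.sqrt `|f t|.
have gcont : continuous g by rewrite /g; fcont.
have -> : fc f z = fc g z * fc g z.
  rewrite -fcM//; apply: fc_ext => // [t|t zt].
    by apply: cvgM; exact: gcont.
  by rewrite -expr2 sqr_sqrtr// ger0_norm// f0.
exact/pos_sq/fc_star.
Qed.

Lemma pos_sqrt z : pos z -> exists2 s, staru s = s & s * s = z.
Proof.
move=> [zs z0]; pose g (t : R) := Num.sqrt `|t|.
have gcont : continuous g by rewrite /g; fcont.
exists (fc g z); first exact: fc_star.
rewrite -fcM// -[RHS]fc_id//; apply: fc_ext => // [t|t|t zt]; last 1 first.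
- by rewrite -expr2 sqr_sqrtr// ger0_norm// z0.
- by apply: cvgM; exact: gcont.
- exact: cvg_id.
Qed.

(** Positivity as a norm inequality, from which sums of positive elements are
    positive by the triangle inequality. *)
Lemma pos_nrmP z M : staru z = z -> nrm z <= M -> pos z <-> nrm (M%:C%:A - z) <= M.
Proof.
move=> zs zM; split=> [[_ z0]|Mz].
  have -> : M%:C%:A - z = peval (M%:P - 'X) z by rewrite pevalD pevalN pevalX pevalC.
  apply: nrm_peval_le => // t zt; rewrite !hornerE.
  have := spec_bound zt; rewrite ler_norml => /andP[_ tz].
  by have := z0 _ zt => t0; rewrite ger0_norm; lra.
split=> // t /(@scal_sub_spec _ M)/spec_bound.
by rewrite ler_norml; lra.
Qed.

Lemma posD z w : pos z -> pos w -> pos (z + w).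
Proof.
move=> pz pw; have [[zs _] [ws _]] := (pz, pw).
have sas : staru (z + w) = z + w by rewrite staruD zs ws.
apply/(pos_nrmP (M := nrm z + nrm w)) => //; first exact: nrmD.
rewrite rmorphD scalerDl opprD addrACA (le_trans (nrmD _ _))// lerD//.
  by apply/pos_nrmP.
by apply/pos_nrmP.
Qed.

Lemma pos_scale r z : 0 <= r -> pos z -> pos (r%:C *: z).
Proof.
move=> r0 /pos_sqrt[s ss <-].
rewrite -[r]sqr_sqrtr// expr2 rmorphM -scalerA scalerAl scalerAr.
by apply: pos_sq; rewrite staruZ conjc_real ss.
Qed.

Lemma pos1 : pos 1.
Proof. by rewrite -[1]mulr1; apply: pos_sq; exact: staru1. Qed.

Lemma pos_nrm_sub z r : staru z = z -> nrm z <= r -> pos (r%:C%:A - z).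
Proof.
move=> zs zr; split; first by rewrite staruB sa_scal zs.
by move=> t /spec_scal_sub/spec_bound; rewrite ler_norml; lra.
Qed.

Lemma pos_nrm_le z r : pos z -> pos (r%:C%:A - z) -> nrm z <= r.
Proof.
move=> [zs z0] [_ zr]; rewrite -[z in nrm z]pevalX.
apply: nrm_peval_le => // t zt; rewrite hornerX ger0_norm ?z0//.
by have := zr _ (scal_sub_spec (r := r) zt); lra.
Qed.

Lemma nrm_le_pos u v : pos u -> pos (v - u) -> nrm u <= nrm v.
Proof.
move=> pu pvu; have vs : staru v = v.
  by case: pu => us _; case: pvu => + _; rewrite staruB us => /addIr.
apply: pos_nrm_le => //.
have -> : (nrm v)%:C%:A - u = ((nrm v)%:C%:A - v) + (v - u) by rewrite addrA subrK.
by apply: posD => //; exact: pos_nrm_sub.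
Qed.

Lemma pos_anti z : pos z -> pos (- z) -> z = 0.
Proof.
move=> pz pNz; apply: nrm_eq0; apply/eqP; rewrite eq_le nrm_ge0 andbT.
by apply: pos_nrm_le => //; rewrite rmorph0 scale0r add0r.
Qed.

(** If [y] is the inverse of [w z - t], that of [z w - t] is [(z y w - 1) / t]. *)
Lemma spec_mulC z w t : t != 0 -> spec (z * w) t -> spec (w * z) t.
Proof.
move=> t0 + [y [yi iy]]; apply.
have tc0 : (t%:C : R[i]) != 0 by rewrite (inj_eq (@complexI R)).
set tt := t%:C%:A in yi iy *.
have e1 : y * w * z - y * tt = 1 by rewrite -mulrA -mulrBr.
have e2 : w * z * y - tt * y = 1 by rewrite -mulrBl.
exists ((t^-1)%:C *: (z * y * w - 1)).
have h : (z * y * w - 1) * (z * w - tt) = tt.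
  have c : z * y * w * (z * w) - z * y * w * tt = z * w.
    transitivity (z * (y * w * z - y * tt) * w); last by rewrite e1 mulr1.
    by rewrite mulrBr mulrBl !mulrA; congr (_ - _); rewrite /tt !mulr_algr -scalerAl.
  by rewrite mulrBl mulrBr mul1r c opprB addrC subrK.
have h' : (z * w - tt) * (z * y * w - 1) = tt.
  have c : z * w * (z * y * w) - tt * (z * y * w) = z * w.
    transitivity (z * (w * z * y - tt * y) * w); last by rewrite e2 mulr1.
    rewrite mulrBr mulrBl !mulrA; congr (_ - _).
    by rewrite /tt mulr_algr mulr_algl -!scalerAl.
  by rewrite mulrBr mulrBl mulr1 c opprB addrC subrK.
by rewrite -scalerAl -scalerAr h h' /tt scalerA -rmorphM mulVf// scale1r.
Qed.

(** Positivity of [x^* x]. With [x^* x = h_+ - h_-], the element [y = x k],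
    [k = h_-], has [y^* y = - h_-^3]; as [y^* y] and [y y^*] have the same
    nonzero spectrum and [y^* y + y y^*] is a sum of squares, [h_-^3] is both
    positive and negative. *)
Lemma pos_starM x : pos (staru x * x).
Proof.
set h := staru x * x; have hs : staru h = h by rewrite staruM staruK.
split=> // t0 ht0; rewrite leNgt; apply/negP => t0_lt0.
pose f (t : R) := Num.max (- t) 0.
have f_cont : continuous f by rewrite /f; fcont.
pose F (t : R) := f t * t * f t.
have Fcont : continuous F.
  by rewrite /F; fcont.
pose k := fc f h; have ks : staru k = k by exact: fc_star.
pose y := x * k.
have yy : staru y * y = fc F h.
  rewrite !fcM ?fc_id//; [|fcont..].
  by rewrite /y staruM ks -/k !mulrA.
have F0 t : F t <= 0.
  rewrite /F /f; case: (leP (- t) 0) => tn; first by rewrite mulr0.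
  by nra.
have [Gs G0] : pos (- (staru y * y)).
  have -> : - (staru y * y) = fc (fun t => -1 * F t) h.
    have -> : fc (fun t => -1 * F t) h = fc (fun=> -1) h * fc F h.
      by apply: fcM => // t; exact: cvg_cst.
    by rewrite yy fc_cst// rmorphN1 scaleN1r mulN1r.
  apply: pos_fc => // [t|t _]; first by apply: cvgM; [exact: cvg_cst|exact: Fcont].
  by rewrite mulN1r oppr_ge0.
have pyy' : pos (- (y * staru y)).
  split; first by rewrite staruN staruM staruK.
  move=> t; have [->//|tn0] := eqVneq t 0.
  move=> /specN yt; apply: G0; rewrite -[t]opprK.
  have := @spec_mulC _ _ (- t) _ yt; rewrite oppr_eq0 => /(_ tn0) yt'.
  by apply: specN; rewrite opprK.
have pD : pos (staru y * y + y * staru y).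
  pose c := (2^-1)%:C *: (y + staru y); pose d := (2^-1)%:C *: ('i *: (y - staru y)).
  have cs : staru c = c by rewrite staruZ staruD staruK conjc_real addrC.
  have ds : staru d = d.
    rewrite staruZ staruZ staruB staruK conjc_real; congr (_ *: _).
    by rewrite -[RHS]opprK -scalerN -scaleNr opprB; congr (_ *: _); simpc.
  suff -> : staru y * y + y * staru y = 2%:C *: (c * c + d * d).
    by apply: pos_scale => //; apply: posD; exact: pos_sq.
  have cc : c * c = (2^-1 * 2^-1)%:C *: ((y + staru y) * (y + staru y)).
    by rewrite /c -scalerAl -scalerAr scalerA -rmorphM.
  have dd : d * d = (2^-1 * 2^-1)%:C *: (- ((y - staru y) * (y - staru y))).
    by rewrite /d -scalerAl -scalerAr scalerA -rmorphM iscale_sq.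
  have e1 : (y + staru y) * (y + staru y) =
      (y * y + staru y * staru y) + (staru y * y + y * staru y).
    by rewrite mulrDl !mulrDr [staru y * y + _ in LHS]addrC addrACA [X in _ + X]addrC.
  have e2 : (y - staru y) * (y - staru y) =
      (y * y + staru y * staru y) - (staru y * y + y * staru y).
    by rewrite mulrBl !mulrBr opprB addrACA -opprD [X in _ - X]addrC.
  rewrite cc dd -scalerDr scalerA -rmorphM e1 e2 opprB [X in _ *: X]addrC addrA subrK.
  by rewrite (_ : 2 * _ = 2^-1) ?scale_half//; field.
have y0 : staru y * y = 0.
  apply: pos_anti; last by [].
  by rewrite -(addrK (y * staru y) (staru y * y)); exact: posD.
have := spec_fc_le Fcont hs ht0; rewrite -yy y0 nrm0.
have m : 0 < - t0 by rewrite oppr_gt0.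
have : F t0 < 0 by rewrite /F /f max_l ?(ltW m)// pmulr_llt0// pmulr_rlt0.
by rewrite normr_le0 => /[swap] /eqP ->; rewrite ltxx.
Qed.

Lemma pos_conj x z : pos z -> pos (staru x * z * x).
Proof.
move=> /pos_sqrt[s ss <-]; rewrite mulrA -{1}ss -staruM -mulrA; exact: pos_starM.
Qed.

End Positivity.

(** * Cuntz comparison *)

Section CuntzComparison.
Context {R : realType} {A : cstarAlgType R}.
Local Notation U := (unitization A).
Implicit Types (a b c d v w : A) (E X : U) (e r t : R).

Lemma cuntz_subP a b : cuntz_sub a b <->
  (forall e, 0 < e -> exists v, cnorm (a - v ** b ** star v) < e).
Proof.
split=> [[v vP] e e0|vP].
  have /cvgrPdist_lt/(_ _ e0)[n _ /(_ n (leqnn n))] := vP.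
  by rewrite sub0r normrN ger0_norm ?cnorm_ge0// => ?; exists (v n).
have i0 n : 0 < n.+1%:R^-1 :> R by rewrite invr_gt0.
have /choice[v vv] n := vP _ (i0 n).
exists v; apply/cvgrPdist_lt => e e0.
have [n] := ltr_add_invr e0; rewrite add0r => ne.
exists n => // m /= nm; rewrite sub0r normrN ger0_norm ?cnorm_ge0//.
rewrite (lt_trans (vv m))// (le_lt_trans _ ne)//.
by rewrite lef_pV2 ?posrE// ler_nat ltnS.
Qed.

Lemma cuntz_sub_trans a b c : cuntz_sub a b -> cuntz_sub b c -> cuntz_sub a c.
Proof.
move=> /cuntz_subP ab /cuntz_subP bc; apply/cuntz_subP => e e0.
have [|v va] := ab (e / 2); first lra.
have M0 : 0 < cnorm v ^+ 2 + 1 by rewrite ltr_wpDl ?sqr_ge0.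
have [|w wb] := bc (e / (2 * (cnorm v ^+ 2 + 1))).
  by rewrite divr_gt0// mulr_gt0.
exists (v ** w); rewrite starM.
have -> : a - v ** w ** c ** (star w ** star v) =
    (a - v ** b ** star v) + v ** (b - w ** c ** star w) ** star v.
  by rewrite cmulDr cmulDl cmulNr cmulNl addrA subrK !cmulA.
set D := b - _ in wb *.
have : cnorm (v ** D ** star v) <= cnorm D * (cnorm v ^+ 2 + 1).
  rewrite (le_trans (cnormM _ _))// cnorm_star.
  rewrite (le_trans (ler_wpM2r (cnorm_ge0 _) (cnormM _ _)))//.
  by have := cnorm_ge0 D; nra.
have : cnorm D * (cnorm v ^+ 2 + 1) <= e / 2.
  by rewrite -ler_pdivlMr// -mulrA -invfM ltW.
by have := cnormD (a - v ** b ** star v) (v ** D ** star v); lra.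
Qed.

Lemma uscalM_eq0 (z w : U) : uscal z = 0 -> uscal (z * w) = 0.
Proof. by move=> z0; rewrite /= z0 mul0r. Qed.

(** Elements of [A] conjugating [d] to an approximation of [w] are found in the
    form [w^(1/2) (V + k)^(-1/2) X], where [V = X d X^*]. *)
Lemma pos_cuntz_sub w d X : pos (inu w) -> pos (inu d) ->
  pos (X * inu d * staru X - inu w) -> cuntz_sub w d.
Proof.
move=> pw pd; set V := X * inu d * staru X => pVw.
have pV : pos V by have := pos_conj (staru X) pd; rewrite staruK.
have Vs := pV.1; have [s ss s2] := pos_sqrt pw.
have s0 : uscal s = 0.
  by have /(congr1 (@uscal R A))/= /eqP := s2; rewrite mulf_eq0 orbb => /eqP.
apply/cuntz_subP => e e0; pose k := e / 2; have k0 : 0 < k by rewrite /k; lra.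
have tk0 t : 0 < `|t| + k by rewrite ltr_wpDl.
pose g (t : R) := Num.sqrt `|(`|t| + k)^-1|.
pose h (t : R) := Num.sqrt `|k * (`|t| + k)^-1|.
have icont : continuous (fun t : R => (`|t| + k)^-1).
  by apply: fcontV => [|t]; [fcont|rewrite gt_eqF].
have gcont : continuous g by rewrite /g; fcont.
have hcont : continuous h by rewrite /h; fcont.
have g2 t : g t * g t = (`|t| + k)^-1.
  by rewrite -expr2 sqr_sqrtr// ger0_norm// invr_ge0 ltW.
have h2 t : h t * h t = k * (`|t| + k)^-1.
  by rewrite -expr2 sqr_sqrtr// ger0_norm//; apply: mulr_ge0; rewrite ?invr_ge0 ltW.
pose G := fc g V; pose H := fc h V.
have Gs : staru G = G by exact: fc_star.
have Hs : staru H = H by exact: fc_star.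
have gVg : G * V * G = 1 - H * H.
  have -> : G * V * G = fc (fun t => g t * t * g t) V.
    by rewrite !fcM ?fc_id//; fcont.
  have -> : 1 - H * H = fc (fun t => 1 - h t * h t) V.
    by rewrite fcB ?fcM ?fc_cst ?scale1r//; fcont.
  apply: fc_ext => // [||t Vt]; [fcont|fcont|].
  rewrite mulrAC g2 h2; have := tk0 t; rewrite ger0_norm ?(pV.2)// => tk.
  by field; rewrite gt_eqF.
exists (upart (s * G * X)).
rewrite -nrm_inu inuB !inuM -inu_star !inuK ?uscalM_eq0//.
have -> : inu w - s * G * X * inu d * staru (s * G * X) = s * (H * H) * s.
  rewrite !staruM ss Gs; have -> : s * G * X * inu d * (staru X * (G * s)) = s * (G * V * G) * s.
    by rewrite /V !mulrA.
  by rewrite gVg mulrBr mulrBl mulr1 s2 subKr.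
have -> : s * (H * H) * s = staru (H * s) * (H * s) by rewrite staruM ss Hs !mulrA.
rewrite nrm_starM -nrm_star -nrm_starM staruK staruM ss Hs.
have -> : H * s * (s * H) = staru H * inu w * H by rewrite Hs -s2 !mulrA.
apply: (@le_lt_trans _ _ (nrm (staru H * V * H))).
  apply: nrm_le_pos; first exact: pos_conj.
  by rewrite -mulrBl -mulrBr; exact: pos_conj.
have -> : staru H * V * H = fc (fun t => h t * t * h t) V.
  by rewrite Hs !fcM ?fc_id//; fcont.
apply: (@le_lt_trans _ _ k); last by rewrite /k; lra.
apply: nrm_fc_le => // [|t Vt]; first fcont.
have t0 := pV.2 _ Vt; have := tk0 t; rewrite mulrAC h2 ger0_norm// => tk.
rewrite ger0_norm; last first.
  by apply: mulr_ge0 => //; apply: mulr_ge0; rewrite ?invr_ge0 ltW.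
by rewrite -mulrA ler_piMr ?(ltW k0)// mulrC ler_pdivrMr ?mul1r; lra.
Qed.

Lemma cutdown_max0 e : 0 <= e -> Num.max (0 - e) 0 = 0.
Proof. by move=> e0; rewrite max_r// sub0r oppr_le0. Qed.

Lemma continuous_cut e : continuous (fun t : R => Num.max (t - e) 0).
Proof. fcont. Qed.

Lemma inu_cutdown e a : 0 <= e -> selfadjoint a ->
  inu (cutdown e a) = fc (fun t => Num.max (t - e) 0) (inu a).
Proof.
by move=> e0 a_sa; apply: inu_fcalc => //; [exact: continuous_cut|exact: cutdown_max0].
Qed.

Lemma pos_cutdown e a : 0 <= e -> selfadjoint a -> pos (inu (cutdown e a)).
Proof.
move=> e0 a_sa; rewrite inu_cutdown//; apply: pos_fc; [exact: continuous_cut|exact: inu_sa|].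
by move=> t _; rewrite le_max lexx orbT.
Qed.

Lemma pos_cutdown_sub e a : 0 <= e -> selfadjoint a ->
  pos (inu (cutdown e a) + e%:C%:A - inu a).
Proof.
move=> e0 a_sa; have as_ := inu_sa a_sa; rewrite inu_cutdown//.
pose f (t : R) := Num.max (t - e) 0 + (e - t).
have -> : fc (fun t => Num.max (t - e) 0) (inu a) + e%:C%:A - inu a = fc f (inu a).
  by rewrite fcD ?fcB ?fc_cst ?fc_id ?addrA//; fcont.
apply: pos_fc => //; first by rewrite /f; fcont.
by move=> t _; rewrite /f; have := le_max (t - e) (t - e) 0; rewrite lexx => /=; lra.
Qed.

(** A form of Rordam's lemma. With [c = e0 + r], choose [phi] such that
    [phi(t)^2 (t - c) = (t - e)_+]. For [u = phi(a)] the cutdown of [a] is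
    [u (a - c) u], and [a - c] lies below the compression of [(b - e0)_+] by [E]. *)
Lemma cutdown_cuntz_sub a b E (e0 e r : R) :
  selfadjoint a -> selfadjoint b -> staru E = E -> pos (1 - E * E) ->
  0 <= e0 -> 0 <= r -> e0 + r < e -> nrm (inu a - E * inu b * E) <= r ->
  cuntz_sub (cutdown e a) (cutdown e0 b).
Proof.
move=> a_sa b_sa Es E1 e00 r0 e0r ab; set d := cutdown e0 b.
have as_ := inu_sa a_sa; pose c := e0 + r.
have e0' : 0 <= e by lra.
pose psi (t : R) := Num.max (t - e) 0 * (Num.max (t - c) (e - c))^-1.
pose phi (t : R) := Num.sqrt `|psi t|.
have den t : 0 < Num.max (t - c) (e - c) by rewrite lt_max !subr_gt0 {2}/c e0r orbT.
have psicont : continuous psi.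
  apply: fcontM; first fcont.
  by apply: fcontV => [|t]; [fcont|rewrite gt_eqF].
have phicont : continuous phi by rewrite /phi; fcont.
have psi0 t : 0 <= psi t by rewrite mulr_ge0 ?invr_ge0 ?(ltW (den t))// le_max lexx orbT.
have phi2 t : phi t * phi t = psi t by rewrite -expr2 sqr_sqrtr// ger0_norm.
pose u := fc phi (inu a); have us : staru u = u by exact: fc_star.
have wE : inu (cutdown e a) = u * (inu a - c%:C%:A) * u.
  have -> : inu a - c%:C%:A = fc (fun t => t - c) (inu a).
    by rewrite fcB ?fc_id ?fc_cst//; fcont.
  rewrite inu_cutdown// /u -!fcM//; [|fcont..]; apply: fc_ext => //.
  - fcont.
  - fcont.
  - move=> t _; rewrite mulrAC phi2 /psi.
    have [te|te] := leP (t - e) 0; first by rewrite !mul0r.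
    rewrite max_l; last lra.
    have tc : 0 < t - c by rewrite /c; lra.
    by rewrite divfK// gt_eqF.
apply: (@pos_cuntz_sub _ _ (u * E)); [exact: pos_cutdown|exact: pos_cutdown|].
have -> : u * E * inu d * staru (u * E) - inu (cutdown e a) =
    staru u * (E * inu d * E + c%:C%:A - inu a) * u.
  rewrite wE staruM us Es -addrA -[c%:C%:A - _]opprB.
  by rewrite [u * (_ - (_ - _))]mulrBr mulrBl !mulrA.
apply: pos_conj.
have -> : E * inu d * E + c%:C%:A - inu a =
    (staru E * (inu d + e0%:C%:A - inu b) * E + e0%:C *: (1 - E * E)) +
    (r%:C%:A - (inu a - E * inu b * E)).
  rewrite Es mulrBr mulrBl mulrDr mulrDl mulr_algr scalerBr -scalerAl /c rmorphD scalerDl.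
  set D := E * inu d * E; set B := E * inu b * E; set Q := _ *: (E * E).
  rewrite [D + Q - B]addrAC [D - B + Q + _]addrACA subrr addr0 opprB.
  by rewrite [_%:A + (B - _)]addrCA [RHS]addrACA subrK -!addrA.
apply: posD; last first.
  by apply: pos_nrm_sub => //; rewrite staruB !staruM Es !inu_sa// mulrA.
by apply: posD; [apply: pos_conj; exact: pos_cutdown_sub|exact: pos_scale].
Qed.

End CuntzComparison.

(** * Automorphisms *)

Section Automorphisms.
Context {R : realType} {A : cstarAlgType R} (f : A -> A)
  (f_aut : star_automorphism f).
Local Notation U := (unitization A).
Implicit Types (a b h : A) (z w : U).

Definition extend z : U := Unitization (f (upart z)) (uscal z).

Lemma autZ k a : f (k *: a) = k *: f a.
Proof.
have [_ flin _ _] := f_aut; have f0 : f 0 = 0.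
  have := flin 1 0 0; rewrite !scale1r addr0 => /esym/eqP.
  by rewrite -subr_eq0 addrK => /eqP.
by have := flin k a 0; rewrite !addr0 f0 addr0.
Qed.

Lemma autD a b : f (a + b) = f a + f b.
Proof. by have [_ flin _ _] := f_aut; have := flin 1 a b; rewrite !scale1r. Qed.

Lemma autN a : f (- a) = - f a.
Proof. by rewrite -scaleN1r autZ scaleN1r. Qed.

Lemma autB a b : f (a - b) = f a - f b.
Proof. by rewrite autD autN. Qed.

Lemma aut0 : f 0 = 0.
Proof. by rewrite -[0 in LHS](scale0r 0) autZ scale0r. Qed.

Lemma autM a b : f (a ** b) = f a ** f b.
Proof. by have [_ _ + _] := f_aut; exact. Qed.

Lemma aut_star a : f (star a) = star (f a).
Proof. by have [_ _ _] := f_aut; exact. Qed.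

Lemma extend_invertible z : is_invertible z -> is_invertible (extend z).
Proof.
have eM u w : extend (u * w) = extend u * extend w.
  by congr Unitization; rewrite /= autD autM autD !autZ.
have e1 : extend 1 = 1 by congr Unitization; rewrite /= aut0.
by move=> [y [yz zy]]; exists (extend y); rewrite -!eM yz zy e1.
Qed.

(** A star-automorphism maps the spectrum into itself, and the norm of a
    self-adjoint element is its spectral radius. *)
Lemma aut_contractive a : cnorm (f a) <= cnorm a.
Proof.
have sa h : star h = h -> cnorm (f h) <= cnorm h.
  move=> hs; rewrite -!nrm_inu.
  have fhs : staru (inu (f h)) = inu (f h) by rewrite inu_star -aut_star hs.
  have [t ft] := nrm_peval_attained 'X fhs; rewrite pevalX hornerX => <-.
  apply: spec_bound => hi; apply: ft.
  have := extend_invertible hi; rewrite (_ : extend _ = inu (f h) - t%:C%:A)//.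
  by congr Unitization; rewrite /= !scaler0 !subr0.
rewrite -(@ler_pXn2r _ 2%N) ?nnegrE ?cnorm_ge0// -!cnorm_starM -aut_star -autM.
by apply: sa; rewrite starM starK.
Qed.

End Automorphisms.

(** * Orthogonal projections near almost orthogonal almost projections *)

Section Projections.
Context {R : realType} {A : cstarAlgType R}.
Local Notation U := (unitization A).
Implicit Types (a b q : A) (e r k : R).

(** The spectrum of [b] has a gap around [1 / 2], so a continuous function equal
    to [0] below the gap and [1] above it yields a projection. That function has
    the form [t g(t)], so whatever annihilates [b] annihilates the projection. *)
Lemma near_projection b k : selfadjoint b -> cnorm (b ** b - b) <= k -> k <= 8^-1 ->
  exists p, [/\ is_projection p, cnorm (p - b) <= 2 * k &
    exists g : U, inu p = inu b * g /\ inu p = g * inu b].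
Proof.
move=> b_sa bk k8; have bs := inu_sa b_sa.
have k0 : 0 <= k := le_trans (cnorm_ge0 _) bk.
have spk t : spec (inu b) t -> `|t ^+ 2 - t| <= k.
  move=> /(spec_peval (p := 'X * 'X - 'X)); rewrite !hornerE -expr2.
  rewrite pevalD pevalN pevalM pevalX -inuM -inuB => /spec_bound.
  by rewrite nrm_inu => /le_trans; exact.
pose f (t : R) := 1 - Num.max (1 - Num.max (2 * t - 2^-1) 0) 0.
have f_lo t : t <= 4^-1 -> f t = 0.
  by move=> t4; rewrite /f (@max_r _ _ (2 * t - 2^-1)) ?subr0 ?max_l ?subrr//; lra.
have f_hi t : 3 / 4 <= t -> f t = 1.
  by move=> t4; rewrite /f (@max_l _ _ (2 * t - 2^-1)) ?max_r ?subr0//; lra.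
have fcf : continuous f by rewrite /f; fcont.
have f01 t : spec (inu b) t -> f t * f t = f t /\ `|f t - t| <= 2 * k.
  move=> /spk; rewrite ler_norml => /andP[tk1 tk2].
  have [t4|t4] := leP t 4^-1.
    by rewrite f_lo// mulr0 sub0r normrN ler_norml; split=> //; nra.
  have [t3|t3] := leP (3 / 4) t; last by nra.
  by rewrite f_hi// mulr1 ler_norml; split=> //; nra.
pose g (t : R) := f t * (Num.max t 4^-1)^-1.
have m0 t : 0 < Num.max t 4^-1 :> R by rewrite lt_max invr_gt0 ltr0n orbT.
have gc : continuous g.
  apply: fcontM => //; apply: fcontV => [|t]; first fcont.
  by rewrite gt_eqF.
have fg t : f t = t * g t.
  rewrite /g; have [t4|t4] := leP t 4^-1; first by rewrite f_lo// mul0r mulr0.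
  by rewrite mulrCA mulfV ?mulr1// gt_eqF// (lt_trans _ t4)// invr_gt0 ltr0n.
have f0 : f 0 = 0 by apply: f_lo; rewrite invr_ge0.
have pE : inu (upart (fc f (inu b))) = fc f (inu b).
  by rewrite inuK// (uscal_fc (r := 0))// f0.
have fE : f = (fun t => t * g t) by apply/funext.
exists (upart (fc f (inu b))); split.
- split; apply: inu_inj; first by rewrite -inu_star pE fc_star.
  by rewrite inuM pE -fcM//; apply: fc_ext => //; [fcont|move=> t /f01[]].
- rewrite -nrm_inu inuB pE.
  have -> : fc f (inu b) - inu b = fc (fun t => f t - t) (inu b).
    by rewrite [RHS]fcB ?fc_id//; fcont.
  by apply: nrm_fc_le => //; [fcont|move=> t /f01[]].
- exists (fc g (inu b)); rewrite pE fE fcM ?fc_id//; [|fcont]; split=> //.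
  by rewrite fc_comm.
Qed.

Lemma cnorm_near_projection q k : selfadjoint q -> cnorm (q ** q - q) <= k -> k <= 1 ->
  cnorm q <= 2.
Proof.
move=> q_sa qk k1; rewrite leNgt; apply/negP => q2.
have : cnorm (q ** q) = cnorm q ^+ 2 by rewrite -{1}q_sa cnorm_starM.
have := cnormD (q ** q - q) q; rewrite subrK; nra.
Qed.

Lemma nrm_projection (z : U) : staru z = z -> z * z = z -> nrm z <= 1.
Proof.
move=> zs zz; have := nrm_sa zs; rewrite zz => h; rewrite leNgt; apply/negP => z1.
by move: h; nra.
Qed.

Lemma cmul_sumr (I : Type) (s : seq I) (p : I -> A) a :
  a ** (\sum_(i <- s) p i) = \sum_(i <- s) a ** p i.
Proof. exact: (big_morph _ (@cmulDr R A a) (@cmul0r R A a)). Qed.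

Lemma cmul_suml (I : Type) (s : seq I) (p : I -> A) a :
  (\sum_(i <- s) p i) ** a = \sum_(i <- s) p i ** a.
Proof.
exact: (big_morph (fun x => x ** a) (fun x y => @cmulDl R A x y a) (@cmul0l R A a)).
Qed.

Lemma cnorm_sum_le (I : eqType) (s : seq I) (p : I -> A) r :
  (forall i, i \in s -> cnorm (p i) <= r) -> cnorm (\sum_(i <- s) p i) <= (size s)%:R * r.
Proof.
elim: s => [|i s IH] pr; first by rewrite big_nil cnorm0 mul0r.
rewrite big_cons (le_trans (cnormD _ _))//= -natr1 mulrDl mul1r addrC lerD//.
  by apply: IH => j js; apply: pr; rewrite inE js orbT.
by apply: pr; rewrite mem_head.
Qed.

Lemma sum_projections (I : eqType) (s : seq I) (p : I -> A) : uniq s ->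
  (forall i, i \in s -> is_projection (p i)) ->
  (forall i j, i \in s -> j \in s -> i != j -> p i ** p j = 0) ->
  is_projection (\sum_(i <- s) p i) /\
  forall i, i \in s -> p i ** (\sum_(i <- s) p i) = p i /\ (\sum_(i <- s) p i) ** p i = p i.
Proof.
move=> us pproj pp; set S := \sum_(i <- s) p i.
have pS i : i \in s -> p i ** S = p i.
  move=> is_; rewrite cmul_sumr (bigD1_seq i)//= (pproj i is_).2 big_seq_cond big1 ?addr0//.
  by move=> j /andP[js ji]; rewrite pp// eq_sym.
have Ss : star S = S.
  rewrite (big_morph _ (@starD R A) (@star0 R A)); apply: eq_big_seq => i is_.
  exact: (pproj i is_).1.
have Sp i : i \in s -> S ** p i = p i.
  by move=> is_; rewrite -{1}Ss -{1}(pproj i is_).1 -starM pS// (pproj i is_).1.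
split; last by move=> i is_; split; [exact: pS|exact: Sp].
by split=> //; rewrite {1}/S cmul_suml; apply: eq_big_seq => i is_; exact: pS.
Qed.

(** The projections are found one at a time: the next almost projection is
    compressed by the complement of the sum of those already found, which moves
    it little, and is then replaced by a nearby projection. *)
Lemma perturb_orthogonal_projections n e : 0 < e -> exists2 k, 0 < k &
  forall (I : eqType) (s : seq I) (q : I -> A), uniq s -> size s = n ->
  (forall i, i \in s -> selfadjoint (q i) /\ cnorm (q i ** q i - q i) <= k) ->
  (forall i j, i \in s -> j \in s -> i != j -> cnorm (q i ** q j) <= k) ->
  exists p : I -> A,
    (forall i, i \in s -> is_projection (p i) /\ cnorm (p i - q i) <= e) /\
    (forall i j, i \in s -> j \in s -> i != j -> p i ** p j = 0).
Proof.
elim: n e => [|n IH] e e0.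
  by exists 1 => // I s q _ /size0nil -> _ _; exists (fun=> 0).
(* The errors below add up to at most [20 m / 64]. *)
pose m := Num.min e 1; have m0 : 0 < m by rewrite lt_min e0 ltr01.
have me : m <= e by rewrite ge_min lexx.
have m1 : m <= 1 by rewrite ge_min lexx orbT.
have n0 : 0 < n.+1%:R :> R by rewrite ltr0n.
pose e1 := m / (64 * n.+1%:R).
have e10 : 0 < e1 by rewrite divr_gt0// mulr_gt0.
have e1E : n.+1%:R * e1 = m / 64.
  by rewrite /e1 invfM mulrCA [n.+1%:R * (_ * _^-1)]mulrCA mulfV ?mulr1 // gt_eqF.
have ne1 : n%:R * e1 <= m / 64.
  by rewrite -e1E ler_wpM2r ?(ltW e10)// ler_nat.
have e164 : e1 <= m / 64.
  by rewrite -e1E ler_peMl ?(ltW e10)// ler1n.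
have [k1 k10 IHk] := IH e1 e10.
pose k := Num.min k1 e1; have k0 : 0 < k by rewrite lt_min k10.
have kk1 : k <= k1 by rewrite ge_min lexx.
have ke1 : k <= e1 by rewrite ge_min lexx orbT.
exists k => // I [//|i s] q /=/andP[iNs us] [sn] qk qq.
have [||p [pq pp]] := IHk I s q us sn.
- move=> j js; have [|h1 h2] := qk j; first by rewrite inE js orbT.
  by split=> //; exact: le_trans h2 kk1.
- by move=> j l js ls jl; apply: le_trans _ kk1; apply: qq => //; rewrite inE ?js ?ls orbT.
have [S_proj pS] := sum_projections us (fun j js => (pq j js).1) pp.
set S := \sum_(j <- s) p j in S_proj pS.
have [qi_sa qik] := qk i (mem_head _ _).
have qi2 : cnorm (q i) <= 2 by apply: (cnorm_near_projection qi_sa qik); lra.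
pose th := 3 * m / 64.
have Sq : cnorm (S ** q i) <= th.
  rewrite cmul_suml; apply: (@le_trans _ _ ((size s)%:R * (3 * e1))); last first.
    by rewrite sn /th; lra.
  apply: cnorm_sum_le => j js.
  have -> : p j ** q i = (p j - q j) ** q i + q j ** q i by rewrite cmulDl cmulNl subrK.
  have qji : cnorm (q j ** q i) <= k.
    by apply: qq; rewrite ?mem_head ?inE ?js ?orbT//; apply: contraNneq iNs => <-.
  have : cnorm ((p j - q j) ** q i) <= e1 * 2.
    by rewrite (le_trans (cnormM _ _))// ler_pM ?cnorm_ge0//; exact: (pq j js).2.
  by have := cnormD ((p j - q j) ** q i) (q j ** q i); lra.
have [T TE] : exists T : U, T = 1 - inu S by exists (1 - inu S).
have Ss : staru (inu S) = inu S by apply: inu_sa; exact: S_proj.1.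
have SS : inu S * inu S = inu S by rewrite -inuM S_proj.2.
have Ts : staru T = T by rewrite TE staruB staru1 Ss.
have TT : T * T = T by rewrite TE mulrBl mul1r mulrBr mulr1 SS subrr subr0.
have T1 : nrm T <= 1 by exact: nrm_projection.
have uT : uscal (T * inu (q i) * T) = 0 by rewrite /= mulr0 mul0r.
pose b := upart (T * inu (q i) * T).
have bE : inu b = T * inu (q i) * T by exact: inuK.
have b_sa : selfadjoint b.
  by apply: inu_inj; rewrite -inu_star bE !staruM Ts inu_star qi_sa mulrA.
have TxT (x : U) : nrm (T * x * T) <= nrm x.
  rewrite (le_trans (nrmM _ _))// -[leRHS]mulr1 ler_pM ?nrm_ge0//.
  by rewrite (le_trans (nrmM _ _))// -[leRHS]mul1r ler_wpM2r ?nrm_ge0.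
set Q := inu (q i) in bE *; have Qs : staru Q = Q by exact: inu_sa.
have SQ : nrm (inu S * Q) <= th by rewrite -inuM nrm_inu.
have QS : nrm (Q * inu S) <= th by rewrite -nrm_star staruM Qs Ss.
have bq : cnorm (b - q i) <= 2 * th.
  have -> : cnorm (b - q i) = nrm (- (Q * inu S) - inu S * Q * T).
    rewrite -nrm_inu inuB bE -/Q {1}TE mulrBl mul1r mulrBl {1}TE mulrBr mulr1.
    by rewrite addrAC [Q - _ - Q]addrAC subrr add0r.
  have : nrm (inu S * Q * T) <= th * 1.
    by rewrite (le_trans (nrmM _ _))// ler_pM ?nrm_ge0.
  by have := nrmD (- (Q * inu S)) (- (inu S * Q * T)); rewrite !nrmN; lra.
have bb : cnorm (b ** b - b) <= k + 2 * th.
  have -> : cnorm (b ** b - b) = nrm (T * ((Q * Q - Q) - Q * inu S * Q) * T).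
    have -> : Q * Q - Q - Q * inu S * Q = Q * T * Q - Q.
      by rewrite TE mulrBr mulr1 mulrBl addrAC.
    by rewrite -nrm_inu inuB inuM bE mulrBr mulrBl !mulrA -[T * Q * T * T]mulrA TT.
  rewrite (le_trans (TxT _))// (le_trans (nrmD _ _))// nrmN lerD//.
    by rewrite -inuM -inuB nrm_inu.
  rewrite (le_trans (nrmM _ _))// mulrC ler_pM ?nrm_ge0//; first by rewrite nrm_inu.
have [|pi [pi_proj pib [g [pg gp]]]] := near_projection b_sa bb.
  rewrite /th; lra.
have pb j : j \in s -> inu (p j) * inu b = 0 /\ inu b * inu (p j) = 0.
  move=> js; have [pjS Spj] := pS j js.
  have pT : inu (p j) * T = 0 by rewrite TE mulrBr mulr1 -inuM pjS subrr.
  have Tp : T * inu (p j) = 0 by rewrite TE mulrBl mul1r -inuM Spj subrr.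
  split; first by rewrite bE !mulrA pT !mul0r.
  by rewrite bE -mulrA Tp mulr0.
have ppi j : j \in s -> p j ** pi = 0 /\ pi ** p j = 0.
  move=> js; have [pb1 pb2] := pb j js.
  split; apply: inu_inj; first by rewrite inuM pg mulrA pb1 mul0r.
  by rewrite inuM gp -mulrA pb2 mulr0.
have ij j : j \in s -> (j == i) = false.
  by move=> js; apply/negbTE; apply: contraNneq iNs => <-.
exists (fun j => if j == i then pi else p j); split=> [j|j l].
  rewrite inE; have [->|ji]/= := eqVneq j i; last first.
    by move=> js; have [? h] := pq j js; split=> //; apply: le_trans h _; lra.
  move=> _; split=> //; rewrite -(subrKA b) (le_trans (cnormD _ _))//.
  by rewrite /th in pib bq; lra.
rewrite !inE; have [->|ji]/= := eqVneq j i; have [->|li]/= := eqVneq l i.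
- by rewrite ?eqxx.
- by move=> _ ls _; have [] := ppi l ls.
- by move=> js _ _; have [] := ppi j js.
- exact: pp.
Qed.

End Projections.

(** * Real rank zero and the unitization *)

Section RealRankZero.
Context {R : realType} {B : cstarAlgType R}.
Local Notation U := (unitization B).
Implicit Types (a b e x : B) (z w y : U) (r k : R).

Lemma uscalX z n : uscal (z ^+ n) = uscal z ^+ n.
Proof. by elim: n => [//|n IH]; rewrite !exprS /= IH. Qed.

(** If the operator norm of [z] is smaller than its scalar part, then after
    rescaling [z = 1 - a] with [1 - a] a strict contraction of [B], and the
    limit of [1 - (1 - a)^n] is a unit of [B]. *)
Lemma nonunital_scal_le z : ~ unital B -> cmod (uscal z) <= unorm z.
Proof.
move=> nB; rewrite leNgt; apply/negP => zlt; apply: nB.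
have m0 : 0 < cmod (uscal z) := le_lt_trans (unorm_ge0 z) zlt.
have mu0 : uscal z != 0 by apply: contraTneq m0 => ->; rewrite cmod0 ltxx.
pose w : U := (uscal z)^-1 *: z; pose th := unorm z / cmod (uscal z).
have th0 : 0 <= th by rewrite divr_ge0 ?unorm_ge0 ?cmod_ge0.
have th1 : th < 1 by rewrite ltr_pdivrMr// mul1r.
have wx x : cnorm (act w x) <= th * cnorm x.
  rewrite actZ cnormZ -/(cmod _) /th [unorm z / _]mulrC -mulrA.
  have -> : cmod (uscal z)^-1 = (cmod (uscal z))^-1.
    by apply: complexI; rewrite fmorphV/= -!cmodE normfV.
  by rewrite ler_wpM2l ?invr_ge0 ?cmod_ge0// cnorm_act.
have wn n x : cnorm (act (w ^+ n) x) <= th ^+ n * cnorm x.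
  elim: n => [|n IH]; first by rewrite !expr0 act1 mul1r.
  by rewrite exprS actM (le_trans (wx _))// exprS -mulrA ler_wpM2l.
have w1 : uscal w = 1 by rewrite /= mulVf.
pose a := upart (1 - w).
have aE : inu a = 1 - w by rewrite inuK// -[LHS]/(1 - uscal w) w1 subrr.
pose u n := 1 - w ^+ n.
have act_inuM v x : inu (act v x) = v * inu x.
  by congr Unitization; rewrite /= ?mulr0// scale0r addr0.
have [|n|l ul] := @converges_geometric _ _ u (cnorm a) th.
- by rewrite th0 th1.
- have -> : u n.+1 - u n = inu (act (w ^+ n) a).
    rewrite act_inuM aE.
    by rewrite mulrBr mulr1 -exprSr /u opprB addrC addrA subrK.
  by rewrite nrm_inu mulrC.
have l0 : uscal l = 0.
  apply: cmod_eq0; apply/eqP; rewrite eq_le cmod_ge0 andbT.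
  apply/ler_addgt0Pr => e e0; rewrite add0r.
  have [n nl] := filter_ex (ul e e0); apply: le_trans (ltW nl).
  rewrite nrmB (le_trans _ (nrm_scal _))//= uscalX w1 expr1n subrr oppr0 addr0//.
have lx x : upart l ** x = x.
  apply: inu_inj; rewrite inuM inuK//.
  apply: converges_uniq (convergesM ul (converges_cst (inu x))) _ => e e0.
  have : (fun n => th ^+ n * cnorm x) @ \oo --> 0 * cnorm x.
    by apply: cvgMl; apply: cvg_expr; rewrite ger0_norm.
  rewrite mul0r => /cvgrPdist_lt/(_ _ e0); apply: filterS => n.
  rewrite sub0r normrN ger0_norm ?mulr_ge0 ?exprn_ge0 ?cnorm_ge0// => ne.
  rewrite mulrBl mul1r addrAC subrr add0r nrmN -act_inuM.
  by rewrite nrm_inu (le_lt_trans (wn _ _)).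
have ls : star (upart l) = upart l.
  have h := lx (star (upart l)).
  by rewrite -[RHS]starK -[in RHS]h starM starK h.
exists (upart l) => x; split=> //.
by rewrite -[x in LHS]starK -{1}ls -starM lx starK.
Qed.

Lemma nonunital_nrm z : ~ unital B -> nrm z = unorm z.
Proof. by move=> nB; apply/eqP; rewrite eq_le nrm_unorm andbT ge_max lexx nonunital_scal_le. Qed.

(** When [B] has a unit [e], an invertible [y] of [B] becomes the invertible
    element [y + lam (1 - e)] of the unitization. *)
Lemma real_rank_zero_unitization a (lam eps : R) : real_rank_zero B ->
  selfadjoint a -> lam != 0 -> 0 < eps ->
  exists y : U, [/\ staru y = y, is_invertible y & nrm (inu a + lam%:C%:A - y) < eps].
Proof.
move=> [rr_unital rr_nonunital] a_sa lam0 eps0.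
have [[e e_unit]|nB] := pselect (unital B); last first.
  have sa : staru (inu a + lam%:C%:A) = inu a + lam%:C%:A.
    by rewrite staruD inu_sa// sa_scal.
  have [y [ys yi yx]] := rr_nonunital nB _ _ sa eps0.
  by exists y; split=> //; rewrite nonunital_nrm.
have es : star e = e.
  have h := (e_unit (star e)).1.
  by rewrite -[RHS]starK -[in RHS]h starM starK h.
have sa : selfadjoint (a + lam%:C *: e) by rewrite /selfadjoint starD starZ es a_sa conjc_real.
have [y [ys [z [zy yz]] yx]] := rr_unital e e_unit _ _ sa eps0.
have [F FE] : exists F : U, F = 1 - inu e by exists (1 - inu e).
have Fb b : F * inu b = 0 by rewrite FE mulrBl mul1r -inuM (e_unit b).1 subrr.
have bF b : inu b * F = 0 by rewrite FE mulrBr mulr1 -inuM (e_unit b).2 subrr.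
have FF : F * F = F by rewrite {2}FE mulrBr mulr1 Fb subr0.
have Fs : staru F = F by rewrite FE staruB staru1 inu_star es.
have lamc : lam%:C != 0 :> R[i] by rewrite (inj_eq (@complexI R)).
exists (inu y + lam%:C *: F); split.
- by rewrite staruD inu_sa// staruZ Fs conjc_real.
- exists (inu z + lam%:C^-1 *: F); split.
    rewrite mulrDl !mulrDr -!scalerAr -!scalerAl bF Fb FF !scaler0 addr0 add0r.
    by rewrite -inuM zy scalerA ?mulVf ?mulfV// scale1r FE addrC subrK.
  rewrite mulrDl !mulrDr -!scalerAr -!scalerAl bF Fb FF !scaler0 addr0 add0r.
  by rewrite -inuM yz scalerA ?mulVf ?mulfV// scale1r FE addrC subrK.
- have -> : inu a + lam%:C%:A - (inu y + lam%:C *: F) = inu (a + lam%:C *: e - y).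
    rewrite FE scalerBr opprD opprB inuB inuD inuZ.
    by rewrite addrACA [lam%:C%:A + _]addrCA subrr addr0 addrAC.
  by rewrite nrm_inu.
Qed.

Lemma nrm_subX_le z w M n : 1 <= M -> nrm z <= M -> nrm w <= M ->
  nrm (z ^+ n - w ^+ n) <= n%:R * M ^+ n * nrm (z - w).
Proof.
move=> M1 zM wM; have M0 : 0 <= M by lra.
elim: n => [|n IH]; first by rewrite subrr nrm0 !mul0r.
have -> : z ^+ n.+1 - w ^+ n.+1 = z * (z ^+ n - w ^+ n) + (z - w) * w ^+ n.
  by rewrite mulrBr mulrBl -!exprS addrA subrK.
rewrite (le_trans (nrmD _ _))//.
have h1 : nrm (z * (z ^+ n - w ^+ n)) <= M * (n%:R * M ^+ n * nrm (z - w)).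
  by rewrite (le_trans (nrmM _ _))// ler_pM ?nrm_ge0.
have h2 : nrm ((z - w) * w ^+ n) <= nrm (z - w) * M ^+ n.+1.
  rewrite (le_trans (nrmM _ _))// ler_wpM2l ?nrm_ge0// (le_trans (nrmX _ _))//.
  rewrite (@le_trans _ _ (M ^+ n))//; first by rewrite lerXn2r ?nnegrE ?nrm_ge0.
  by rewrite exprS ler_peMl ?exprn_ge0.
rewrite (le_trans (lerD h1 h2))// -natr1 exprS.
by rewrite le_eqVlt; apply/orP; left; apply/eqP; ring.
Qed.

(** [y - t = y (1 - t y^-1)] is invertible for small [t]. *)
Lemma spec_gap y : is_invertible y -> exists2 g : R, 0 < g & forall t, spec y t -> g <= `|t|.
Proof.
move=> [y1 [y1y yy1]]; have n0 : 0 < nrm y1 + 1 by rewrite ltr_wpDl ?nrm_ge0.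
exists (nrm y1 + 1)^-1; first by rewrite invr_gt0.
move=> t yt; rewrite leNgt; apply/negP => tlt; apply: yt.
have -> : y - t%:C%:A = y * (1 - t%:C *: y1).
  by rewrite mulrBr mulr1 -scalerAr yy1.
apply: invertibleM; first by exists y1.
apply: neumann_invertible; rewrite opprB addrCA subrr addr0 nrmZ cmod_real.
have : `|t| * (nrm y1 + 1) < 1 by rewrite -ltr_pdivlMr// div1r.
by have := normr_ge0 t; have := nrm_ge0 y1; nra.
Qed.

Lemma fcX (f : R -> R) z n : continuous f -> staru z = z ->
  continuous (fun t => f t ^+ n) /\ fc (fun t => f t ^+ n) z = fc f z ^+ n.
Proof.
move=> fcont zs; elim: n => [|n [cn IH]].
  by split; [exact: fcont_cst|rewrite fc_cst// expr0 scale1r].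
have -> : (fun t => f t ^+ n.+1) = (fun t => f t * f t ^+ n).
  by apply/funext => t; rewrite exprS.
by split; [fcont|rewrite fcM// IH exprS].
Qed.

End RealRankZero.

(** * Almost projections in algebras of real rank zero *)

Section AlmostProjections.
Context {R : realType} {B : cstarAlgType R}.
Local Notation U := (unitization B).
Implicit Types (a b e x : B) (z w y : U) (r k : R).

Lemma geometric_small (c k : R) : 0 <= c < 1 -> 0 < k -> exists m, c ^+ m <= k.
Proof.
move=> /andP[c0 c1] k0; have : (fun n => c ^+ n) @ \oo --> (0 : R).
  by apply: cvg_expr; rewrite ger0_norm.
move=> /cvgrPdist_lt/(_ _ k0)[n _ /(_ n (leqnn n))].
by rewrite sub0r normrN ger0_norm ?exprn_ge0// => /ltW; exists n.
Qed.

(** The function [min(max(t / g, 0), 1)], written with maxima only. *)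
Definition step (g t : R) : R := 1 - Num.max (1 - Num.max (t / g) 0) 0.

Lemma step_continuous g : continuous (step g).
Proof.
rewrite /step; apply: fcontD; first fcont.
apply: fcontN; apply: fcont_max; last fcont.
apply: fcontD; first fcont.
apply: fcontN; apply: fcont_max; last fcont.
by apply: fcontM; fcont.
Qed.

Lemma step_neg g t : 0 < g -> t <= 0 -> step g t = 0.
Proof.
move=> g0 t0; have tg : t / g <= 0 by rewrite pmulr_lle0 ?invr_gt0.
by rewrite /step (max_r tg) subr0 max_l ?subrr.
Qed.

Lemma step_large g t : 0 < g -> g <= t -> step g t = 1.
Proof.
move=> g0 gt; have tg : 1 <= t / g by rewrite ler_pdivlMr// mul1r.
by rewrite /step (@max_l _ _ (t / g)) ?max_r ?subr0//; lra.
Qed.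

(** As [y] is invertible its spectrum has a gap at [0], so the indicator function
    of the positive half-line agrees on it with a continuous function. *)
Lemma positive_spectral_projection y : staru y = y -> is_invertible y ->
  exists chi : R -> R, [/\ continuous chi,
    forall t, spec y t -> t < 0 -> chi t = 0,
    forall t, spec y t -> 0 <= t -> chi t = 1 &
    fc chi y * fc chi y = fc chi y].
Proof.
move=> ys /spec_gap[g g0 gy]; exists (step g).
have lo t : spec y t -> t < 0 -> step g t = 0 by move=> _ /ltW; exact: step_neg.
have hi t : spec y t -> 0 <= t -> step g t = 1.
  by move=> /gy + t0; rewrite ger0_norm//; exact: step_large.
have sc : continuous (step g) by exact: step_continuous.
split=> //; rewrite -fcM//; apply: fc_ext => // [|t yt]; first by apply: fcontM.
by have [t0|t0] := ltP t 0; [rewrite (lo t)// mulr0|rewrite (hi t)// mulr1].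
Qed.

(** Given a self-adjoint [e], let [q] be the projection onto the positive part
    of an invertible perturbation [y] of [e^2 - d]. Where [q] vanishes [e^2] is
    at most about [d], and [q] is almost fixed by [f = 1 - (1 - e^2 / L)^m],
    which is a multiple of [e] and close to [1] where [e^2 >= d]; hence [f q f]
    is the required element. *)
Lemma rr0_almost_projection e k : real_rank_zero B -> selfadjoint e -> 0 < k ->
  exists2 r : B, selfadjoint r & let q := e ** r ** e in
    cnorm (q ** q - q) < k /\ cnorm (e - q ** e) < k.
Proof.
move=> rr e_sa k0; pose E := inu e; have Es : staru E = E by exact: inu_sa.
pose ne := nrm E; have ne0 : 0 <= ne by exact: nrm_ge0.
pose k' := Num.min 1 k.
have k'0 : 0 < k' by rewrite lt_min ltr01.
have k'1 : k' <= 1 by rewrite ge_min lexx.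
have k'k : k' <= k by rewrite ge_min lexx orbT.
(* [(1 - q) e] has norm at most the square root of [2 d], that is [k' / 4];
   [f q f] will be within [zeta] of [q]. *)
pose d := k' ^+ 2 / 32; have d0 : 0 < d by rewrite divr_gt0// exprn_gt0.
have d1 : d <= 1 by rewrite /d; nra.
pose zeta := k' / (8 * (1 + ne)).
have zeta0 : 0 < zeta by rewrite divr_gt0// mulr_gt0// ltr_wpDr.
have zetaE : zeta * (8 * (1 + ne)) = k' by rewrite divfK// gt_eqF// mulr_gt0// ltr_wpDr.
have zeta8 : 8 * zeta <= k' by rewrite -zetaE; nra.
have zetane : zeta * ne <= k' / 8 by rewrite -zetaE; nra.
pose k1 := zeta / 6; have k10 : 0 < k1 by rewrite divr_gt0.
(* Both [e^2] and [y + d] have spectrum below [L]. *)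
pose L := ne ^+ 2 + 2 * d + 1.
have ne2 : 0 <= ne ^+ 2 by exact: sqr_ge0.
have L0 : 0 < L by rewrite /L; lra.
have L1 : 1 <= L by rewrite /L; lra.
have [m mP] : exists m, (1 - d / L) ^+ m <= k1.
  apply: geometric_small => //.
  have dL : d / L <= 1 by rewrite ler_pdivrMr// mul1r /L; lra.
  by have := divr_gt0 d0 L0; lra.
(* The power [m] is fixed before the perturbation [y] is chosen: [h^m] and
   [h'^m] are close if [h] and [h'] are close in terms of [m]. *)
pose eta := Num.min d (k1 / (m%:R * 2 ^+ m + 1)).
have den0 : 0 < m%:R * 2 ^+ m + 1 :> R by rewrite ltr_wpDl// mulr_ge0// exprn_ge0.
have eta0 : 0 < eta by rewrite lt_min d0 divr_gt0.
have etad : eta <= d by rewrite ge_min lexx.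
have etam : m%:R * 2 ^+ m * eta <= k1.
  have : eta <= k1 / (m%:R * 2 ^+ m + 1) by rewrite ge_min lexx orbT.
  rewrite ler_pdivlMr//; nra.
have e2_sa : selfadjoint (e ** e) by rewrite /selfadjoint starM e_sa.
have [|y [ys yi yE]] := real_rank_zero_unitization (lam := - d) rr e2_sa _ eta0.
  by rewrite oppr_eq0 gt_eqF.
rewrite inuM -/E rmorphN scaleNr in yE.
pose D := E * E - d%:C%:A - y; have Ds : staru D = D.
  by rewrite /D !staruB staruM Es ys sa_scal.
have yE2 : E * E = y + d%:C%:A + D.
  by rewrite /D addrC -addrA [- y + _]addrA addNr add0r subrK.
have nE2 : nrm (E * E) = ne ^+ 2 by exact: nrm_sa.
have spec_lo t : spec y t -> - (d + eta) <= t.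
  have : pos (y + (d + eta)%:C%:A).
    have -> : y + (d + eta)%:C%:A = E * E + (eta%:C%:A - D).
      rewrite yE2 rmorphD scalerDl addrA -[RHS]addrA; congr (_ + _).
      by rewrite [RHS]addrCA subrr addr0.
    by apply: posD; [exact: pos_sq|apply: pos_nrm_sub => //; exact: ltW].
  move=> [_ yp] yt; rewrite -subr_ge0 opprK; apply: yp; apply/spec_shift.
  by rewrite addrK.
have spec_hi t : spec y t -> t <= L - d.
  have : nrm y <= ne ^+ 2 + d + eta.
    have -> : y = E * E - (d%:C%:A + D) by rewrite yE2 -[y + _ + D]addrA addrK.
    rewrite (le_trans (nrmD _ _))// nrmN nE2 -addrA lerD2l.
    by rewrite (le_trans (nrmD _ _))// nrm_real ger0_norm ?lerD// ltW.
  move=> ny /spec_bound; rewrite ler_norml => /andP[_ ty].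
  by rewrite /L; move: etad; lra.
have [chi [chic chi0 chi1 chi2]] := positive_spectral_projection ys yi.
pose q := fc chi y; have qs : staru q = q by exact: fc_star.
have q1 : nrm q <= 1 by apply: nrm_projection.
have Li0 : 0 <= L^-1 by rewrite invr_ge0 ltW.
have L11 : L^-1 <= 1 by rewrite invf_le1.
have cL : (L^-1 : R)%:C *: (L%:C%:A : U) = 1.
  by rewrite scalerA -rmorphM mulVf ?scale1r// gt_eqF.
pose h : U := 1 - (L^-1)%:C *: (E * E).
pose h' : U := 1 - (L^-1)%:C *: (y + d%:C%:A).
have hs : staru h = h by rewrite staruB staru1 staruZ staruM Es conjc_real.
have h1 : nrm h <= 1.
  have -> : h = (L^-1)%:C *: (L%:C%:A - E * E) by rewrite scalerBr cL.
  rewrite nrmZ cmod_real ger0_norm// mulrC ler_pdivrMr// mul1r.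
  apply/pos_nrmP; [by rewrite staruM Es|by rewrite nE2 /L; lra|exact: pos_sq].
have hh' : nrm (h - h') <= eta.
  have -> : h - h' = - ((L^-1)%:C *: D).
    by rewrite /h /h' opprB addrC addrA subrK -scalerBr yE2 opprD addrA subrr add0r scalerN.
  rewrite nrmN nrmZ cmod_real ger0_norm// (le_trans _ (ltW yE))//.
  by rewrite -[leRHS]mul1r ler_wpM2r ?nrm_ge0.
have h'2 : nrm h' <= 2.
  by rewrite -(subKr h h') (le_trans (nrmD _ _))// nrmN; move: etad; lra.
have hm : nrm (h ^+ m * q) <= 2 * k1.
  have hq1 : nrm ((h ^+ m - h' ^+ m) * q) <= k1.
    apply: (@le_trans _ _ (m%:R * 2 ^+ m * eta)) => //.
    rewrite (le_trans (nrmM _ _))// -[leRHS]mulr1 ler_pM ?nrm_ge0//.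
    rewrite (le_trans (@nrm_subX_le _ _ _ _ 2 m _ _ _))//; [lra|lra|].
    by rewrite ler_wpM2l// mulr_ge0// exprn_ge0.
  have hq2 : nrm (h' ^+ m * q) <= k1.
    pose phi (t : R) := 1 - L^-1 * (t + d).
    have phic : continuous phi by rewrite /phi; fcont.
    have phiE : fc phi y = h'.
      rewrite /phi fcB ?fcM ?fcD ?fc_id ?fc_cst//; try by fcont.
      by rewrite scale1r mulr_algl.
    have [phimc phim] := fcX m phic ys.
    rewrite -phiE -phim -fcM//; apply: nrm_fc_le => //; first by apply: fcontM.
    move=> t yt; have [t0|t0] := ltP t 0; first by rewrite chi0// mulr0 normr0 ltW.
    rewrite chi1// mulr1 normrX; apply: le_trans mP; rewrite lerXn2r ?nnegrE//.
      by have : d / L <= 1 by [rewrite ler_pdivrMr// mul1r /L; lra]; lra.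
    have tL := spec_hi t yt.
    have le1 : L^-1 * (t + d) <= 1 by rewrite mulrC ler_pdivrMr// mul1r; lra.
    rewrite /phi ger0_norm; last lra.
    by rewrite lerB// mulrC ler_wpM2l//; lra.
  have -> : h ^+ m * q = (h ^+ m - h' ^+ m) * q + h' ^+ m * q.
    by rewrite -mulrDl subrK.
  by rewrite (le_trans (nrmD _ _))//; lra.
have [f fE] : exists f : U, f = 1 - h ^+ m by exists (1 - h ^+ m).
have fs : staru f = f by rewrite fE staruB staru1 staruX hs.
have f2 : nrm f <= 2.
  rewrite fE (le_trans (nrmD _ _))// nrmN nrm1.
  by have : nrm (h ^+ m) <= 1 by [rewrite (le_trans (nrmX _ _))// exprn_ile1 ?nrm_ge0]; lra.
have fq : nrm (f * q - q) <= 2 * k1.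
  by rewrite fE mulrBl mul1r addrAC subrr add0r nrmN.
have qf : nrm (q * f - q) <= 2 * k1.
  by rewrite -nrm_star staruB staruM fs qs.
have fqf : nrm (f * q * f - q) <= zeta.
  have -> : f * q * f - q = (f * q - q) * f + (q * f - q).
    by rewrite mulrBl addrA subrK.
  have : nrm ((f * q - q) * f) <= 2 * k1 * 2 by rewrite (le_trans (nrmM _ _))// ler_pM ?nrm_ge0.
  by have := nrmD ((f * q - q) * f) (q * f - q); rewrite /k1 in fq qf *; lra.
pose S := \sum_(i < m) h ^+ i.
have Ss : staru S = S.
  rewrite (big_morph _ (@staruD R B) (@staru0 R B)); apply: eq_bigr => i _.
  by rewrite staruX hs.
have ES : E * S = S * E.
  rewrite mulr_sumr mulr_suml; apply: eq_bigr => i _; apply/commrX.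
  by rewrite /GRing.comm /h mulrBr mulrBl mulr1 mul1r -scalerAl -scalerAr mulrA.
have fE1 : f = (L^-1)%:C *: (E * (E * S)).
  by rewrite fE -opprB subrX1 -mulNr opprB /h subKr -scalerAl mulrA.
have fE2 : f = (L^-1)%:C *: ((S * E) * E).
  by rewrite fE1 ES mulrA ES.
pose r := upart ((L^-1)%:C *: (E * S) * q * ((L^-1)%:C *: (S * E))).
have rE : inu r = (L^-1)%:C *: (E * S) * q * ((L^-1)%:C *: (S * E)).
  by apply: inuK; rewrite /= !(mul0r, mulr0).
have QE : inu (e ** r ** e) = f * q * f.
  rewrite !inuM rE -/E {1}fE1 fE2.
  by rewrite -!scalerAl -!scalerAr -!scalerAl !mulrA.
exists r.
  apply: inu_inj; rewrite -inu_star rE !staruM !staruZ !staruM Es Ss qs conjc_real.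
  by rewrite !mulrA.
have [c cE] : exists c : U, c = f * q * f - q by exists (f * q * f - q).
have qc : f * q * f = q + c by rewrite cE addrC subrK.
rewrite -cE in fqf.
rewrite /= -!nrm_inu; split.
  rewrite inuB inuM QE qc.
  have -> : (q + c) * (q + c) - (q + c) = (q * c + c * q) + (c * c - c).
    rewrite mulrDl !mulrDr chi2 opprD addrACA [q + _]addrC addrK.
    by rewrite !addrA.
  have n1 : nrm (q * c) <= 1 * zeta by rewrite (le_trans (nrmM _ _))// ler_pM ?nrm_ge0.
  have n2 : nrm (c * q) <= zeta * 1 by rewrite (le_trans (nrmM _ _))// ler_pM ?nrm_ge0.
  have n3 : nrm (c * c) <= zeta * 1.
    rewrite (le_trans (nrmM _ _))// ler_pM ?nrm_ge0//.
    by apply: le_trans fqf _; lra.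
  have := nrmD (q * c + c * q) (c * c - c); have := nrmD (q * c) (c * q).
  have := nrmD (c * c) (- c); rewrite nrmN.
  have : nrm c <= zeta by []. 
  lra.
rewrite inuB inuM QE qc -/E.
have -> : E - (q + c) * E = (1 - q) * E - c * E.
  by rewrite mulrDl mulrBl mul1r opprD addrA.
have n1 : nrm (c * E) <= zeta * ne by rewrite (le_trans (nrmM _ _))// ler_pM ?nrm_ge0.
have p_s : staru (1 - q) = 1 - q by rewrite staruB staru1 qs.
have p1 : nrm (1 - q) <= 1.
  by apply: nrm_projection => //; rewrite mulrBl mul1r mulrBr mulr1 chi2 subrr subr0.
have n2 : nrm ((1 - q) * E) <= k' / 4.
  rewrite -nrm_star staruM p_s Es -(@ler_pXn2r _ 2%N) ?nnegrE ?nrm_ge0 ?divr_ge0 ?(ltW k'0)//.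
  rewrite -nrm_starM staruM p_s Es.
  have -> : (1 - q) * E * (E * (1 - q)) = (1 - q) * (y + d%:C%:A) * (1 - q) + (1 - q) * D * (1 - q).
    by rewrite -mulrDl -mulrDr -yE2 !mulrA.
  have m1 : nrm ((1 - q) * (y + d%:C%:A) * (1 - q)) <= d.
    have -> : (1 - q) * (y + d%:C%:A) * (1 - q) =
        fc (fun t => (1 - chi t) * (t + d) * (1 - chi t)) y.
      by rewrite !fcM ?fcB ?fcD ?fc_id ?fc_cst ?scale1r//; fcont.
    apply: nrm_fc_le => //; first fcont.
    move=> t yt; have [t0|t0] := ltP t 0; last by rewrite chi1// subrr mulr0 normr0 ltW.
    have := spec_lo t yt; rewrite chi0// subr0 mulr1 mul1r ler_norml; lra.
  have m2 : nrm ((1 - q) * D * (1 - q)) <= eta.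
    rewrite (le_trans (nrmM _ _))// -[leRHS]mulr1 ler_pM ?nrm_ge0//.
    rewrite (le_trans (nrmM _ _))// -[leRHS]mul1r ler_pM ?nrm_ge0//; exact: ltW.
  rewrite (le_trans (nrmD _ _))// (@le_trans _ _ (2 * d))//; first lra.
  by rewrite /d; lra.
have := nrmD ((1 - q) * E) (- (c * E)); rewrite nrmN; lra.
Qed.

End AlmostProjections.

(** * Orthogonal sums and representing sequences *)

Section OrthogonalSums.
Context {R : realType} {A : cstarAlgType R} {I : finType}.
Implicit Types (p : I -> A).

(** The square of an orthogonal sum is the orthogonal sum of the squares, so the
    number of terms bounds all the powers [2 ^ k] of the norm. *)
Lemma orthogonal_sum_pow k p : (forall i, selfadjoint (p i)) ->
  (forall i, cnorm (p i) <= 1) -> (forall i j, i != j -> p i ** p j = 0) ->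
  cnorm (\sum_i p i) ^+ (2 ^ k) <= (size (index_enum I))%:R.
Proof.
elim: k p => [|k IH] p p_sa p1 pp.
  by rewrite expn0 expr1 -[leRHS]mulr1; apply: cnorm_sum_le => i _.
have S_sa : star (\sum_i p i) = \sum_i p i.
  by rewrite (big_morph _ (@starD R A) (@star0 R A)); apply: eq_bigr => i _; exact: p_sa.
rewrite expnS exprM -cnorm_starM S_sa.
have -> : (\sum_i p i) ** (\sum_i p i) = \sum_i p i ** p i.
  rewrite cmul_suml; apply: eq_bigr => i _; rewrite cmul_sumr (bigD1 i)//= big1 ?addr0//.
  by move=> j ji; rewrite pp// eq_sym.
apply: IH => [i|i|i j ij].
- by rewrite /selfadjoint starM p_sa.
- by rewrite (le_trans (cnormM _ _))// -[leRHS]mulr1 ler_pM ?cnorm_ge0.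
- by rewrite -cmulA (cmulA (p i) (p j)) pp// cmul0l cmul0r.
Qed.

Lemma orthogonal_sum_contractive p : (forall i, selfadjoint (p i)) ->
  (forall i, cnorm (p i) <= 1) -> (forall i j, i != j -> p i ** p j = 0) ->
  cnorm (\sum_i p i) <= 1.
Proof.
move=> p_sa p1 pp; set z := cnorm _; rewrite leNgt; apply/negP => z1.
have zp k : z ^+ (2 ^ k) <= (size (index_enum I))%:R by exact: orthogonal_sum_pow.
set N : R := (size (index_enum I))%:R in zp; have z0 : 0 < z by lra.
have N0 : 0 < N by apply: lt_le_trans (zp 0%N); rewrite exprn_gt0.
have [m mN] : exists m, z^-1 ^+ m <= (2 * N)^-1.
  apply: geometric_small; last by rewrite invr_gt0 mulr_gt0.
  by rewrite invr_ge0 ltW//= invf_lt1.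
have : z ^+ m <= N.
  by apply: le_trans (zp m); rewrite ler_weXn2l ?(ltW z1)// ltnW// ltn_expl.
move: mN; rewrite exprVn lef_pV2 ?posrE ?mulr_gt0 ?exprn_gt0//; lra.
Qed.

End OrthogonalSums.

Section Lifting.
Context {R : realType} {A : cstarAlgType R} (omega : free_ultrafilter).
Implicit Types (u v r : linf A) (a : A).

Lemma uclass_cmul u v : uclass omega (linf_mul u v) = uclass omega u ** uclass omega v.
Proof. by rewrite [RHS]umulE. Qed.

Lemma uclass_star u : uclass omega (linf_star u) = star (uclass omega u).
Proof. by rewrite [RHS]ustarE. Qed.

Lemma linf_ext u v : (forall n, u n = v n) -> u = v.
Proof. by move=> uv; apply: val_inj; apply/funext. Qed.

Lemma cnorm_uclass_lt u (e : R) : cnorm (uclass omega u) < e ->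
  \forall n \near fu_sets omega, cnorm (u n) < e.
Proof. by rewrite ucnormE; exact: ulim_lt. Qed.

Lemma uclass_eq0 u : (forall e : R, 0 < e ->
    \forall n \near fu_sets omega, cnorm (u n) < e) -> uclass omega u = 0.
Proof.
move=> ue; apply: (@cnorm0_eq0 R); apply/eqP.
rewrite ucnormE eq_le ulim_ge0 andbT; apply/ler_addgt0Pr => e e0; rewrite add0r.
by apply: ulim_le; apply: filterS (ue e e0) => n /ltW.
Qed.

Lemma uclassB u v : uclass omega (u - v) = uclass omega u - uclass omega v.
Proof. by rewrite uclassD uclassN. Qed.

Lemma uclass_central u : (forall a (e : R), 0 < e ->
    \forall n \near fu_sets omega, cnorm (u n ** a - a ** u n) < e) ->
  uclass omega u \in central_sub A omega.
Proof.
move=> ua; apply/asboolP => a; apply/eqP; rewrite -subr_eq0.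
by rewrite /uconst -!uclass_cmul -uclassB; apply/eqP/uclass_eq0 => e; exact: ua.
Qed.

Lemma central_almost_commutes u a (e : R) :
  uclass omega u \in central_sub A omega -> 0 < e ->
  \forall n \near fu_sets omega, cnorm (u n ** a - a ** u n) < e.
Proof.
move=> /asboolP/(_ a) ua e0.
apply: (@cnorm_uclass_lt (linf_mul u (linf_const a) - linf_mul (linf_const a) u)).
by rewrite uclassB !uclass_cmul -/(uconst omega a) ua subrr cnorm0.
Qed.

(** The element provided by [rr0_almost_projection] in the central sequence
    algebra is represented by a sequence, made self-adjoint by averaging it with
    its adjoint. *)
Lemma lift_almost_projection u (k : R) :
  real_rank_zero (central_seq_algebra A omega) ->
  (forall n, selfadjoint (u n)) ->
  (forall a (e : R), 0 < e ->
    \forall n \near fu_sets omega, cnorm (u n ** a - a ** u n) < e) -> 0 < k ->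
  exists r : linf A, let q n := u n ** r n ** u n in
    [/\ forall n, selfadjoint (r n),
        \forall n \near fu_sets omega, cnorm (q n ** q n - q n) < k,
        \forall n \near fu_sets omega, cnorm (u n - q n ** u n) < k &
        forall a (e : R), 0 < e ->
          \forall n \near fu_sets omega, cnorm (q n ** a - a ** q n) < e].
Proof.
move=> rr u_sa ua k0; have uC := uclass_central ua.
pose e : central_seq_algebra A omega := SubCStar uC.
have e_sa : selfadjoint e.
  apply: val_inj; rewrite -[LHS]/(star (uclass omega u)) -uclass_star.
  by congr uclass; apply: linf_ext => n; exact: u_sa.
have [r0 r0_sa [qq eq]] := rr0_almost_projection rr e_sa k0.
pose c := urepr (val r0).
pose r : linf A := (2^-1)%:C *: (c + linf_star c).
have r_sa n : selfadjoint (r n).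
  rewrite /selfadjoint -[r n]/((2^-1)%:C *: (c n + star (c n))).
  by rewrite starZ starD starK conjc_real addrC.
have rE : uclass omega r = val r0.
  rewrite uclassZ uclassD uclass_star ureprK.
  have -> : star (val r0) = val r0 by rewrite -[in RHS]r0_sa.
  by rewrite scale_half.
pose q := linf_mul (linf_mul u r) u.
have qE : uclass omega q = val (e ** r0 ** e) by rewrite !uclass_cmul rE.
exists r; split=> //.
- apply: (@cnorm_uclass_lt (linf_mul q q - q)).
  by rewrite uclassB uclass_cmul qE.
- apply: (@cnorm_uclass_lt (u - linf_mul q u)).
  by rewrite uclassB uclass_cmul qE.
- move=> a e' e'0; apply: (@central_almost_commutes q) => //.
  by rewrite qE; exact: valP.
Qed.

End Lifting.

(** * Sequences of towers and transfer of the comparison condition *)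

Section WeakToStrong.
Context {R : realType} {A : cstarAlgType R} {G : finGroupType}.
Implicit Types (alpha : G -> A -> A) (a x y : A) (e : R) (p : G -> A).

Lemma seq_bound (s : seq A) : exists2 M : R, 1 <= M & forall a, a \in s -> cnorm a <= M.
Proof.
elim: s => [|b s [M M1 sM]]; first by exists 1.
exists (M + cnorm b); first by rewrite ler_wpDr ?cnorm_ge0.
move=> a; rewrite inE => /orP[/eqP ->|/sM aM]; first by lra.
by rewrite ler_wpDr ?cnorm_ge0.
Qed.

Lemma near_seq (T : eqType) (F : set_system nat) (FF : Filter F) (s : seq T)
    (P : nat -> T -> Prop) : (forall a : T, a \in s -> \forall n \near F, P n a) ->
  \forall n \near F, forall a : T, a \in s -> P n a.
Proof.
elim: s => [|b s IH] sP; first by apply: nearW.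
have sP' : forall a : T, a \in s -> \forall n \near F, P n a.
  by move=> a as_; apply: sP; rewrite inE as_ orbT.
apply: filterS2 (sP b (mem_head _ _)) (IH sP') => n Pb Ps a.
by rewrite inE => /orP[/eqP ->|/Ps].
Qed.

Lemma separable_exhaustion : separable_space A ->
  exists F : nat -> set A, (forall n, finite_set (F n)) /\
    forall a e, 0 < e -> exists N b, cnorm (a - b) < e /\
      forall n, (N <= n)%N -> F n b.
Proof.
move=> [D [/countable_injP[f finj] Dd]].
exists (fun n => [set a | D a /\ (f a <= n)%N]); split=> [n|a e e0].
  have finj' : {in [set a | D a /\ (f a <= n)%N] &, injective f}.
    by move=> a b /set_mem[Da _] /set_mem[Db _]; apply: finj; exact: mem_set.
  rewrite -(eq_finite_set (inj_card_eq finj')).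
  by apply: sub_finite_set (finite_II n.+1) => _ [a [_ an] <-].
have [||b [/ball_cnorm ab Db]] := Dd (ball a e%:C).
- by exists a; apply: ballxx; rewrite ltcR.
- exact: ball_open.
by exists (f b), b; split=> // n fn; split.
Qed.

Lemma harmonic_small (e0 e : R) : 0 < e ->
  exists N : nat, forall n, (N <= n)%N -> e0 / n.+1%:R < e.
Proof.
move=> e_gt0; exists (Num.truncn (e0 / e)) => n Nn.
have lt1 : e0 / e < n.+1%:R.
  apply: (@lt_le_trans _ _ (Num.truncn (e0 / e)).+1%:R); last by rewrite ler_nat ltnS.
  by rewrite real_truncnS_gt// num_real.
by rewrite ltr_pdivrMr ?ltr0n// mulrC -ltr_pdivrMr.
Qed.

(** The weak property for finite sets exhausting a countable dense set, with
    errors tending to zero. *)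
Lemma weak_rokhlin_sequence alpha e0 x y :
  separable_space A -> weak_tracial_rokhlin alpha -> 0 < e0 -> 
  is_positive x -> is_positive y -> cnorm x = 1 ->
  exists p : nat -> G -> A, let P n := \sum_(g : G) p n g in
  [/\ forall n g, selfadjoint (p n g) /\ cnorm (p n g) <= 1,
      forall n g h, g != h -> p n g ** p n h = 0,
      forall a g e, 0 < e -> exists N, forall n, (N <= n)%N ->
        cnorm (p n g ** a - a ** p n g) < e,
      forall n g h, cnorm (alpha g (p n h) - p n (g * h)%g) < e0 / n.+1%:R &
      forall n, cuntz_sub (cutdown (e0 / n.+1%:R) (y ** y - y ** P n ** y)) x /\
        cnorm (P n ** x ** P n) > 1 - e0 / n.+1%:R].
Proof.
move=> /separable_exhaustion[F [Ffin Fdense]] wtr e00 x_pos y_pos x1.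
have en0 n : 0 < e0 / n.+1%:R by rewrite divr_gt0.
have /choice[p pP] n := wtr (F n) (e0 / n.+1%:R) x y (Ffin n) (en0 n) x_pos y_pos x1.
exists p; split.
- by move=> n g; have [/(_ g)[[]]] := pP n.
- by move=> n; have [] := pP n.
- move=> a g e e_gt0; have e4 : 0 < e / 4 by lra.
  have [N [b [ab Nb]]] := Fdense a _ e4.
  have [N' N'e] := harmonic_small e0 e4.
  exists (maxn N N') => n; rewrite geq_max => /andP[/Nb Fb /N'e ne].
  have [/(_ g)[[_ _] pg1] _ /(_ b g Fb) pb _] := pP n.
  have {}pb := lt_trans pb ne; set u := p n g in pg1 pb *.
  have -> : u ** a - a ** u = (u ** b - b ** u) + (u ** (a - b) - (a - b) ** u).
    rewrite cmulDr cmulDl cmulNr cmulNl opprB addrA [X in _ = X + _]addrC.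
    by rewrite !subrKA.
  have h1 : cnorm (u ** (a - b)) <= 1 * (e / 4).
    by rewrite (le_trans (cnormM _ _))// ler_pM ?cnorm_ge0// ltW.
  have h2 : cnorm ((a - b) ** u) <= e / 4 * 1.
    by rewrite (le_trans (cnormM _ _))// ler_pM ?cnorm_ge0// ltW.
  have := cnormD (u ** b - b ** u) (u ** (a - b) - (a - b) ** u).
  have := cnormD (u ** (a - b)) (- ((a - b) ** u)); rewrite cnormN; lra.
- by move=> n g h; have [_ _ _ []] := pP n.
- by move=> n; have [_ _ _ []] := pP n.
Qed.

(** As [E = 1 - Q] almost commutes with [y], the elements [y E y] and
    [E y^2 E] are close; as [E P] is small, so are [E y^2 E] and
    [E (y^2 - y P y) E]. Hence [y^2 - y Q y] is nearly the compression of
    [y^2 - y P y] by [E], and [cutdown_cuntz_sub] applies. *)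
Lemma cuntz_sub_absorb x y (P Q : A) (M e0 e th nu : R) :
  selfadjoint y -> selfadjoint P -> is_projection Q -> cnorm P <= 1 ->
  cnorm y <= M -> cnorm (P - Q ** P) <= th -> cnorm (Q ** y - y ** Q) <= nu ->
  0 <= e0 -> e0 + (4 * M * nu + 2 * nu ^+ 2 + M ^+ 2 * th) < e ->
  cuntz_sub (cutdown e0 (y ** y - y ** P ** y)) x ->
  cuntz_sub (cutdown e (y ** y - y ** Q ** y)) x.
Proof.
move=> y_sa P_sa [Q_sa QQ] P1 yM PQ Qy e00 e0e; apply: cuntz_sub_trans.
have nu0 : 0 <= nu := le_trans (cnorm_ge0 _) Qy.
have th0 : 0 <= th := le_trans (cnorm_ge0 _) PQ.
have M0 : 0 <= M := le_trans (cnorm_ge0 _) yM.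
set q := inu Q; set Y := inu y; set p := inu P.
have qs : staru q = q by exact: inu_sa.
have Ys : staru Y = Y by exact: inu_sa.
have ps : staru p = p by exact: inu_sa.
have qq : q * q = q by rewrite -inuM QQ.
have [E EE] : exists E : unitization A, E = 1 - q by exists (1 - q).
have Es : staru E = E by rewrite EE staruB staru1 qs.
have E2 : E * E = E by rewrite EE mulrBl mul1r mulrBr mulr1 qq subrr subr0.
have E1 : nrm E <= 1 by exact: nrm_projection.
have [K KE] : exists K : unitization A, K = q * Y - Y * q by exists (q * Y - Y * q).
have Kn : nrm K <= nu by rewrite KE -!inuM -inuB nrm_inu.
have Yn : nrm Y <= M by rewrite nrm_inu.
have pn : nrm p <= 1 by rewrite nrm_inu.
have Ep : nrm (E * p) <= th by rewrite EE mulrBl mul1r -inuM -inuB nrm_inu.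
have EY : E * Y = Y * E - K.
  by rewrite EE KE mulrBl mulrBr mul1r mulr1 opprB subrKA.
have YE : Y * E = E * Y + K by rewrite EY subrK.
set r := _ + M ^+ 2 * th in e0e.
have M1 : 0 <= 4 * M * nu by rewrite !mulr_ge0.
have M2 : 0 <= M ^+ 2 * th by rewrite mulr_ge0// sqr_ge0.
have M3 : 0 <= nu ^+ 2 by exact: sqr_ge0.
apply: (@cutdown_cuntz_sub _ _ _ _ E e0 e r) => //.
- by rewrite /selfadjoint starD starN !starM y_sa Q_sa cmulA.
- by rewrite /selfadjoint starD starN !starM y_sa P_sa cmulA.
- by rewrite E2 EE subKr -qq; exact: pos_sq.
- by rewrite /r; lra.
rewrite !inuB !inuM -/q -/Y -/p.
have yQy : Y * Y - Y * q * Y = Y * E * Y by rewrite EE mulrBr mulr1 mulrBl.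
have eq1 : E * (Y * Y) * E = Y * E * Y + (Y * E * K - K * E * Y - K * K).
  have -> : E * (Y * Y) * E = (Y * E - K) * (E * Y + K) by rewrite -EY -YE !mulrA.
  rewrite mulrDr !mulrBl !mulrA -[Y * E * E]mulrA E2.
  by rewrite -!addrA; congr (_ + _); rewrite addrCA.
have eq2 : E * (Y * p * Y) * E =
    (Y * (E * p) * (E * Y) + Y * E * (p * K)) - (K * (p * E) * Y + K * p * K).
  have -> : E * (Y * p * Y) * E = (Y * E - K) * p * (E * Y + K).
    by rewrite -EY -YE !mulrA.
  by rewrite mulrDr !mulrBl opprD addrACA !mulrA.
have cancel3 (u v w : unitization A) : u - (u + v - w) = w - v.
  by rewrite opprB addrCA; congr (_ + _); rewrite opprD addrA subrr sub0r.
rewrite yQy mulrBr mulrBl eq1 eq2 cancel3.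
have nM (u v : unitization A) (b c : R) : nrm u <= b -> nrm v <= c -> nrm (u * v) <= b * c.
  by move=> ub vc; rewrite (le_trans (nrmM _ _))// ler_pM ?nrm_ge0.
have pEn : nrm (p * E) <= th by rewrite -nrm_star staruM Es ps.
have yE : nrm (Y * E) <= M * 1 by exact/nM.
have Ey : nrm (E * Y) <= 1 * M by exact/nM.
have t1 : nrm (Y * (E * p) * (E * Y)) <= M * th * (1 * M) by apply/nM => //; exact/nM.
have t2 : nrm (Y * E * (p * K)) <= M * 1 * (1 * nu) by apply/nM => //; exact/nM.
have t3 : nrm (K * (p * E) * Y) <= nu * (1 * 1) * M by apply/nM => //; apply/nM => //; exact/nM.
have t4 : nrm (K * p * K) <= nu * 1 * nu by apply/nM => //; exact/nM.
have t5 : nrm (Y * E * K) <= M * 1 * nu by exact/nM.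
have t6 : nrm (K * E * Y) <= nu * 1 * M by apply/nM => //; exact/nM.
have t7 : nrm (K * K) <= nu * nu by exact/nM.
rewrite (le_trans (nrmD _ _))// nrmN.
have s1 := nrmD (Y * (E * p) * (E * Y) + Y * E * (p * K)) (- (K * (p * E) * Y + K * p * K)).
have s2 := nrmD (Y * (E * p) * (E * Y)) (Y * E * (p * K)).
have s3 := nrmD (K * (p * E) * Y) (K * p * K).
have s4 := nrmD (Y * E * K - K * E * Y) (- (K * K)).
have s5 := nrmD (Y * E * K) (- (K * E * Y)).
rewrite !nrmN in s1 s4 s5.
have -> : r = (M * th * (1 * M) + M * 1 * (1 * nu) + (nu * (1 * 1) * M + nu * 1 * nu))
  + (M * 1 * nu + nu * 1 * M + nu * nu) by rewrite /r; ring.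
rewrite lerD//.
  by rewrite (le_trans s1)// lerD// ?(le_trans s2)// ?(le_trans s3)// lerD.
by rewrite (le_trans s4)// lerD// (le_trans s5)// lerD.
Qed.

End WeakToStrong.

(** * Towers of projections *)

(** Take [32 N M^2 eta = min(eps, 1)]: the four left-hand sides are at most [3],
    [2], [22] and [7] times [N M^2 eta]. They bound the errors in the commutation,
    equivariance, comparison and norm conditions. *)
Lemma error_budget (R : realType) (N M eps : R) : 1 <= N -> 1 <= M -> 0 < eps ->
  exists2 eta : R, 0 < eta & [/\ (2 * M + 1) * eta < eps, 2 * eta < eps,
    forall t, t <= eta -> t + (4 * M * (N * ((2 * M + 1) * eta)) +
      2 * (N * ((2 * M + 1) * eta)) ^+ 2 + M ^+ 2 * (N * (3 * eta))) < eps &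
    forall t, t <= eta -> t + 2 * (N * (3 * eta)) < eps].
Proof.
move=> N1 M1 eps0; have MM : M <= M ^+ 2 by rewrite expr2 ler_peMr//; lra.
have [T TE] : exists T, T = N * M ^+ 2 by exists (N * M ^+ 2).
have NMT : N * M <= T by rewrite TE ler_wpM2l//; lra.
have NT : N <= T by rewrite TE ler_peMr//; lra.
have MT : M <= T by rewrite TE (le_trans MM)// ler_peMl//; lra.
have min0 : 0 < Num.min eps 1 by rewrite lt_min eps0 ltr01.
have m0 : Num.min eps 1 <= eps by rewrite ge_min lexx.
have m1 : Num.min eps 1 <= 1 by rewrite ge_min lexx orbT.
have T0 : 0 < 32 * T by lra.
have [eta etaT] : exists eta, 32 * T * eta = Num.min eps 1.
  by exists (Num.min eps 1 / (32 * T)); rewrite mulrC divfK// gt_eqF.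
have eta0 : 0 < eta by rewrite -(pmulr_rgt0 _ T0) etaT.
exists eta => //; rewrite -etaT in min0 m0 m1.
have ge0 := ltW eta0; have Te : 0 < T * eta by rewrite mulr_gt0//; lra.
have Me : M * eta <= T * eta by rewrite ler_wpM2r.
have NMe : N * M * eta <= T * eta by rewrite ler_wpM2r.
have NM2e : N * M ^+ 2 * eta <= T * eta by rewrite TE.
have Ne : N * eta <= T * eta by rewrite ler_wpM2r.
have ee : eta <= T * eta by rewrite ler_peMl//; lra.
clear TE etaT MM NMT NT MT; split=> [||t te|t te]; [lra|lra| |lra].
have -> : 4 * M * (N * ((2 * M + 1) * eta)) =
    8 * (N * M ^+ 2 * eta) + 4 * (N * M * eta) by ring.
have -> : M ^+ 2 * (N * (3 * eta)) = 3 * (N * M ^+ 2 * eta) by ring.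
have nuE : N * ((2 * M + 1) * eta) = 2 * (N * M * eta) + N * eta by ring.
have nu0 : 0 <= N * ((2 * M + 1) * eta) by rewrite !mulr_ge0//; lra.
have nu3 : N * ((2 * M + 1) * eta) <= 3 * (T * eta) by rewrite nuE; lra.
have nu2 : (N * ((2 * M + 1) * eta)) ^+ 2 <= 3 * (T * eta).
  by rewrite expr2 (le_trans _ nu3)// ler_piMr//; lra.
lra.
Qed.

Section Translates.
Context {R : realType} {A : cstarAlgType R} {G : finGroupType} (alpha : G -> A -> A)
  (alpha_action : cstar_action alpha).
Implicit Types (a r q : A) (p P : G -> A).

Let aut g : star_automorphism (alpha g) := alpha_action.1 g.

Lemma action1 a : alpha 1%g a = a.
Proof.
have [/bij_inj inj1 _ _ _] := aut 1%g; apply: inj1.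
by rewrite -alpha_action.2 mulg1.
Qed.

(** The translates of [q = e r e], [e = p 1], are almost orthogonal because those
    of [e] are close to the [p g], and are replaced by orthogonal projections [P g].
    As [1 - Q] annihilates [P g], which is close to [alpha g q], and [alpha g q] almost
    acts as a unit on [alpha g e], which is close to [p g], the product
    [(1 - Q) (p g)] is small. *)
Lemma rokhlin_projections (eta : R) : 0 < eta -> exists2 k : R, 0 < k &
  forall p r (C e0 : R), (forall g, selfadjoint (p g)) -> (forall g, cnorm (p g) <= 1) ->
  (forall g h, g != h -> p g ** p h = 0) ->
  (forall g h, cnorm (alpha g (p h) - p (g * h)%g) <= e0) ->
  selfadjoint r -> cnorm r <= C -> 2 * e0 * C ^+ 2 <= k -> e0 <= eta ->
  let q := p 1%g ** r ** p 1%g in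
  cnorm (q ** q - q) <= k -> cnorm (p 1%g - q ** p 1%g) <= eta ->
  exists P, let Q := \sum_g P g in
    [/\ forall g, is_projection (P g), forall g h, g != h -> P g ** P h = 0,
        is_projection Q, forall g, cnorm (P g - alpha g q) <= eta &
        forall g, cnorm (p g - Q ** p g) <= 3 * eta].
Proof.
move=> eta0.
have [k k0 perturb] := @perturb_orthogonal_projections R A (size (index_enum G)) _ eta0.
exists k => // p r C e0 p_sa p1 pp palpha r_sa rC Ck e0eta q qq pq.
have e00 : 0 <= e0 := le_trans (cnorm_ge0 _) (palpha 1%g 1%g).
have C0 : 0 <= C := le_trans (cnorm_ge0 _) rC.
set e := p 1%g in q qq pq *.
have ep g : cnorm (alpha g e - p g) <= e0 by have := palpha g 1%g; rewrite mulg1.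
have e1 g : cnorm (alpha g e) <= 1 := le_trans (aut_contractive (aut g) _) (p1 _).
have r1 g : cnorm (alpha g r) <= C := le_trans (aut_contractive (aut g) _) rC.
have q_sa : selfadjoint q by rewrite /selfadjoint /q !starM r_sa p_sa cmulA.
have ee g h : g != h -> cnorm (alpha g e ** alpha h e) <= 2 * e0.
  move=> gh; have -> : alpha g e ** alpha h e =
    (alpha g e - p g) ** alpha h e + p g ** (alpha h e - p h).
    by rewrite cmulDl cmulNl cmulDr cmulNr (pp _ _ gh) subr0 subrK.
  have h1 : cnorm ((alpha g e - p g) ** alpha h e) <= e0 * 1.
    by rewrite (le_trans (cnormM _ _))// ler_pM ?cnorm_ge0.
  have h2 : cnorm (p g ** (alpha h e - p h)) <= 1 * e0.
    by rewrite (le_trans (cnormM _ _))// ler_pM ?cnorm_ge0.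
  by rewrite (le_trans (cnormD _ _))//; lra.
have nM a b (c d : R) : cnorm a <= c -> cnorm b <= d -> cnorm (a ** b) <= c * d.
  by move=> ac bd; rewrite (le_trans (cnormM _ _))// ler_pM ?cnorm_ge0.
have [||P [Pq PP]] := perturb G (index_enum G) (fun g => alpha g q) (index_enum_uniq G) erefl.
- move=> g _; split; first by rewrite /selfadjoint -(aut_star (aut g)) q_sa.
  by rewrite -(autM (aut g)) -(autB (aut g)) (le_trans (aut_contractive (aut g) _)).
- move=> g h _ _ gh; rewrite /q !(autM (aut _)).
  have -> : alpha g e ** alpha g r ** alpha g e ** (alpha h e ** alpha h r ** alpha h e) =
      (alpha g e ** alpha g r) ** (alpha g e ** alpha h e) ** (alpha h r ** alpha h e).
    by rewrite !cmulA.
  apply: le_trans Ck; apply: (@le_trans _ _ (1 * C * (2 * e0) * (C * 1))).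
    by apply/nM; [apply/nM; [exact/nM|exact/ee]|exact/nM].
  by rewrite le_eqVlt; apply/orP; left; apply/eqP; ring.
have mem g : g \in index_enum G by exact: mem_index_enum.
have Pproj g : is_projection (P g) by have [] := Pq g (mem g).
have Porth g h : g != h -> P g ** P h = 0 by exact: PP.
have [Q_proj PQ] := @sum_projections R A G (index_enum G) P (index_enum_uniq G)
  (fun g _ => Pproj g) (fun g h _ _ => Porth g h).
exists P; split=> // [g|g]; first by have [] := Pq g (mem g).
set Q := \sum_g P g in Q_proj PQ *.
have [QP PQg] := PQ g (mem g).
(* [alpha g] applied to [e - q e] bounds [(1 - P g) (alpha g e)]. *)
have Pg : cnorm (alpha g e - P g ** alpha g e) <= 2 * eta.
  have -> : alpha g e - P g ** alpha g e =
      alpha g (e - q ** e) - (P g - alpha g q) ** alpha g e.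
    by rewrite (autB (aut g)) (autM (aut g)) cmulDl cmulNl opprB addrA subrK.
  have h1 : cnorm (alpha g (e - q ** e)) <= eta.
    by rewrite (le_trans (aut_contractive (aut g) _)).
  have h2 : cnorm ((P g - alpha g q) ** alpha g e) <= eta * 1.
    by apply/nM => //; have [] := Pq g (mem g).
  by rewrite (le_trans (cnormD _ _))// cnormN; lra.
have [E EE] : exists E : unitization A, E = 1 - inu Q by exists (1 - inu Q).
have Qs : staru (inu Q) = inu Q by apply: inu_sa; exact: Q_proj.1.
have E1 : nrm E <= 1.
  apply: nrm_projection; first by rewrite EE staruB staru1 Qs.
  by rewrite EE mulrBl mul1r mulrBr mulr1 -inuM Q_proj.2 subrr subr0.
have EP a : E * inu (P g ** a) = 0.
  by rewrite EE mulrBl mul1r -inuM cmulA PQg subrr.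
have -> : cnorm (p g - Q ** p g) =
    nrm (E * inu (alpha g e - P g ** alpha g e) - E * inu (alpha g e - p g)).
  rewrite -mulrBr -inuB opprB [X in inu X]addrC subrKA inuB mulrBr EP subr0.
  by rewrite EE mulrBl mul1r -inuM -inuB nrm_inu.
have h1 : nrm (E * inu (alpha g e - P g ** alpha g e)) <= 1 * (2 * eta).
  by rewrite (le_trans (nrmM _ _))// ler_pM ?nrm_ge0// nrm_inu.
have h2 : nrm (E * inu (alpha g e - p g)) <= 1 * e0.
  by rewrite (le_trans (nrmM _ _))// ler_pM ?nrm_ge0// nrm_inu.
by rewrite (le_trans (nrmD _ _))// nrmN; lra.
Qed.

End Translates.

Theorem theorem2 (R : realType) (A : cstarAlgType R) (G : finGroupType)
    (alpha : G -> A -> A)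
    (A_simple : simple_cstar A) (A_separable : separable_space A)
    (alpha_action : cstar_action alpha)
    (alpha_wtRp : weak_tracial_rokhlin alpha)
    (rr0 : exists omega : free_ultrafilter,
      real_rank_zero (central_seq_algebra A omega)) :
  tracial_rokhlin alpha.
Proof.
have [omega rr] := rr0 => F eps x y Ffin eps0 x_pos y_pos x1.
have [s FE] := (finite_seqP F).1 Ffin.
have [M M1 sM] := seq_bound (y :: s).
have aut g : star_automorphism (alpha g) := alpha_action.1 g.
have [N NE] : exists N : R, N = (size (index_enum G))%:R.
  by exists (size (index_enum G))%:R.
have N1 : 1 <= N.
  rewrite NE ler1n lt0n size_eq0; apply/eqP => G0.
  by have := mem_index_enum (1%g : G); rewrite G0.
have [eta eta0 [small_comm small_equiv small_cuntz small_norm]] := error_budget N1 M1 eps0.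
have [k k0 tr] := rokhlin_projections alpha_action eta0.
have [p [p1 pp pcomm palpha pxy]] :=
  weak_rokhlin_sequence A_separable alpha_wtRp eta0 x_pos y_pos x1.
have ub : (fun n => p n 1%g) \in @bounded_seq R A.
  by apply/bounded_seqP; exists 1 => n; exact: (p1 n 1%g).2.
have kmin : 0 < Num.min k eta by rewrite lt_min k0.
have [||r [r_sa qq uq qcomm]] := @lift_almost_projection _ _ omega (LInf ub) _ rr _ _ kmin.
- by move=> n; exact: (p1 n 1%g).1.
- move=> a e e0; have [n0 n0P] := pcomm a 1%g e e0.
  by apply: filterS (fu_ge omega n0) => n; exact: n0P.
pose q n := p n 1%g ** r n ** p n 1%g.
have [C rC] := linf_bounded r.
have [n0 n0P] := harmonic_small (2 * eta * C ^+ 2) k0.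
(* [alpha g q] commutes with [a] as well as [q] with the inverse translate of [a]. *)
pose S := [seq alpha g a | g <- index_enum G, a <- y :: s].
have qS : \forall n \near fu_sets omega, forall a, a \in S ->
    cnorm (q n ** a - a ** q n) < eta.
  by apply: near_seq => a _; exact: qcomm.
have [n [[[n0n nS] nq] nu]] :=
  filter_ex (filterI (filterI (filterI (fu_ge omega n0) qS) qq) uq).
rewrite /= -/(q n) in nq nu.
have en : eta / n.+1%:R <= eta.
  by rewrite ler_pdivrMr ?ltr0n// ler_peMr ?(ltW eta0)// ler1n.
have en0 : 0 < eta / n.+1%:R by rewrite divr_gt0.
have [||||||||||P [Pproj Porth Q_proj Pq pQ]] := tr (p n) (r n) C (eta / n.+1%:R).
- by move=> g; exact: (p1 n g).1.
- by move=> g; exact: (p1 n g).2.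
- exact: pp.
- by move=> g h; exact: ltW.
- exact: r_sa.
- exact: rC.
- by have := n0P n n0n; rewrite mulrAC => /ltW; rewrite !mulrA [_ / _ * _]mulrAC.
- exact: en.
- by apply: le_trans (ltW nq) _; rewrite ge_min lexx.
- by apply: le_trans (ltW nu) _; rewrite ge_min lexx orbT.
set Q := \sum_g P g in Q_proj pQ; pose Pn := \sum_g p n g.
have nM a b (c d : R) : cnorm a <= c -> cnorm b <= d -> cnorm (a ** b) <= c * d.
  by move=> ac bd; rewrite (le_trans (cnormM _ _))// ler_pM ?cnorm_ge0.
have comm a g : a \in y :: s -> cnorm (P g ** a - a ** P g) <= (2 * M + 1) * eta.
  move=> as_; have aM := sM a as_.
  have bS : alpha g^-1%g a \in S by apply: allpairs_f => //; exact: mem_index_enum.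
  have gq : alpha g (q n ** alpha g^-1%g a - alpha g^-1%g a ** q n) =
      alpha g (q n) ** a - a ** alpha g (q n).
    rewrite (autB (aut g)) !(autM (aut g)) -(alpha_action.2 g g^-1%g).
    by rewrite mulgV action1.
  have -> : P g ** a - a ** P g = (P g - alpha g (q n)) ** a - a ** (P g - alpha g (q n)) +
      alpha g (q n ** alpha g^-1%g a - alpha g^-1%g a ** q n).
    rewrite gq cmulDl cmulDr cmulNl cmulNr opprB -[RHS]addrA.
    by rewrite [X in _ = _ + X]addrC !subrKA.
  have h1 : cnorm ((P g - alpha g (q n)) ** a) <= eta * M by exact/nM.
  have h2 : cnorm (a ** (P g - alpha g (q n))) <= M * eta by exact/nM.
  have h3 := le_trans (aut_contractive (aut g) _) (ltW (nS _ bS)).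
  rewrite (le_trans (cnormD _ _))//.
  have -> : (2 * M + 1) * eta = (eta * M + M * eta) + eta by ring.
  by rewrite lerD// (le_trans (cnormD _ _))// cnormN lerD.
have Pn1 : cnorm Pn <= 1.
  apply: orthogonal_sum_contractive => [g|g|]; last exact: pp.
    exact: (p1 n g).1.
  exact: (p1 n g).2.
have Pn_sa : selfadjoint Pn.
  rewrite /selfadjoint (big_morph _ (@starD R A) (@star0 R A)).
  by apply: eq_bigr => g _; exact: (p1 n g).1.
have PQ : cnorm (Pn - Q ** Pn) <= N * (3 * eta).
  rewrite NE cmul_sumr -sumrB; apply: cnorm_sum_le => g _; exact: pQ.
have [cun nPxP] := pxy n.
exists P; split=> //.
- move=> a g; rewrite FE => as_.
  apply: le_lt_trans small_comm; apply: comm.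
  by rewrite inE as_ orbT.
split=> [g h||].
- have -> : alpha g (P h) - P (g * h)%g =
      alpha g (P h - alpha h (q n)) - (P (g * h)%g - alpha (g * h)%g (q n)).
    by rewrite (autB (aut g)) alpha_action.2 opprB addrA subrK.
  have h1 := le_trans (aut_contractive (aut g) _) (Pq h).
  apply: le_lt_trans small_equiv; rewrite (le_trans (cnormD _ _))// cnormN mulr2n mulrDl.
  by rewrite mul1r lerD.
- apply: (@cuntz_sub_absorb _ _ x y Pn Q M (eta / n.+1%:R) eps (N * (3 * eta))
      (N * ((2 * M + 1) * eta))) => //.
  + exact: y_pos.1.
  + by apply: sM; rewrite mem_head.
  + rewrite NE cmul_sumr cmul_suml -sumrB; apply: cnorm_sum_le => g _.
    by apply: comm; rewrite mem_head.
  + exact: ltW.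
  + exact: small_cuntz.
have Q1 : cnorm Q <= 1.
  rewrite -nrm_inu; apply: nrm_projection; first by apply: inu_sa; exact: Q_proj.1.
  by rewrite -inuM Q_proj.2.
have PQ' : cnorm (Pn - Pn ** Q) <= N * (3 * eta).
  by rewrite -cnorm_star starD starN starM Q_proj.1 Pn_sa.
have h : cnorm (Pn ** x ** Pn) <= cnorm (Q ** x ** Q) + 2 * (N * (3 * eta)).
  have -> : Pn ** x ** Pn = Pn ** (Q ** x ** Q) ** Pn +
      ((Pn - Pn ** Q) ** x ** Pn + Pn ** Q ** x ** (Pn - Q ** Pn)).
    rewrite !cmulDl !cmulDr !cmulNl !cmulNr !cmulA.
    by rewrite subrKA [RHS]addrC subrK.
  have h1 : cnorm (Pn ** (Q ** x ** Q) ** Pn) <= 1 * cnorm (Q ** x ** Q) * 1.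
    by apply/nM => //; exact/nM.
  have h2 : cnorm ((Pn - Pn ** Q) ** x ** Pn) <= N * (3 * eta) * 1 * 1.
    by apply/nM => //; apply/nM => //; rewrite x1.
  have h3 : cnorm (Pn ** Q ** x ** (Pn - Q ** Pn)) <= 1 * 1 * 1 * (N * (3 * eta)).
    by apply/nM => //; apply/nM; rewrite ?x1//; exact/nM.
  have -> : cnorm (Q ** x ** Q) + 2 * (N * (3 * eta)) = 1 * cnorm (Q ** x ** Q) * 1 +
    (N * (3 * eta) * 1 * 1 + 1 * 1 * 1 * (N * (3 * eta))) by ring.
  rewrite (le_trans (cnormD _ _))// lerD// (le_trans (cnormD _ _))//.
  by rewrite lerD.
have lt1 := lt_le_trans nPxP h; have lt2 := small_norm _ en.
suff : 1 - eps < cnorm (Q ** x ** Q) by [].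
move: lt1 lt2; clear; set t := eta / _; lra.
Qed.
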